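(* Let $\Omega\subset\mathbb R^n$ be any smooth bounded connected open set, let $\mathcal M=\overline\Omega$ be endowed with the Euclidean metric, and let $q\in L^\infty(\mathcal M;\mathbb R)$. There exist an open set $\omega\subset\Omega$ and constants $c_\omega,\delta>0$ such that for any $\lambda>0$ there is a function $\mathfrak f_\lambda\in C^\infty(\overline\Omega)$ such that: - $(\overline\Omega,\nabla\mathfrak f_\lambda,\omega)$ satisfies (FC) and $T_{FC}(\overline\Omega,\nabla\mathfrak f_\lambda,\omega)\le\operatorname{diam}(\Omega)$; - $T_{unif}(\omega)\ge c_\omega\lambda$ (for the equation with $\mathfrak f=\mathfrak f_\lambda$); - $\lambda^2\delta\le\|\nabla\mathfrak f_\lambda\|^2_{L^\infty(\Omega)}\le\lambda^2\operatorname{diam}(\Omega)^2+n$. In particular, for all $\Lambda>0$ there is $\mathfrak f\in C^\infty(\overline\Omega)$ such that $T_{unif}(\omega)\ge\Lambda\,T_{FC}(\overline\Omega,\nabla\mathfrak f,\omega)$.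
   Context: (FC): given $\mathfrak f\in C^\infty(\overline\Omega)$, extend it to a compactly supported $W^{2,\infty}$ function $\tilde{\mathfrak f}$ on $\mathbb R^n$, and for $x\in\overline\Omega$ let $\gamma_x$ be the (global) solution of $\dot\gamma_x(t)=-\nabla\tilde{\mathfrak f}(\gamma_x(t))$, $\gamma_x(0)=x$. $(\overline\Omega,\nabla\mathfrak f,\omega,T)$ satisfies the Flushing Condition (FC) if for all $x\in\overline\Omega$ there is $t\in(0,T)$ such that $\gamma_x(t)\notin\overline\Omega$ or $\gamma_x(t)\in\omega$. $(\overline\Omega,\nabla\mathfrak f,\omega)$ satisfies (FC) if this holds for some $T>0$, and $T_{FC}(\overline\Omega,\nabla\mathfrak f,\omega)$ is the infimum of such $T$. These definitions do not depend on the extension. Equation, for $\varepsilon>0$: $$(\partial_t-\nabla\mathfrak f\cdot\nabla-q-\varepsilon\Delta)u=0\text{ in }(0,T)\times\Omega,\quad u=0\text{ on }(0,T)\times\partial\Omega,\quad u|_{t=0}=u_0\in L^2(\Omega).$$ Observability inequality with constant $C_0(T,\varepsilon)$: $C_0(T,\varepsilon)^2\int_0^T\int_\omega|u|^2\,dx\,dt\ge\|u(T)\|^2_{L^2(\Omega)}$ for all $u_0\in L^2(\Omega)$. $T_{unif}(\omega)$ is the infimum of all $T>0$ for which there exist $K_0,\varepsilon_0>0$ such that for all $\varepsilon\in(0,\varepsilon_0)$ the observability inequality holds with some $C_0(T,\varepsilon)\le K_0$ ($\inf\emptyset=+\infty$). *)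

(* Defs.v *)
From HB Require Import structures.
From mathcomp Require Import all_boot all_order all_algebra.
From mathcomp Require Import all_classical all_reals all_analysis.

Set Implicit Arguments.
Unset Strict Implicit.
Unset Printing Implicit Defensive.

Import Order.TTheory GRing.Theory Num.Theory.
Import numFieldNormedType.Exports.

Local Open Scope classical_set_scope.
Local Open Scope ring_scope.

(* The sigma-algebra of 'rV[R]_n is generated by the coordinates, hence it is
   the Borel sigma-algebra of R^n. *)
Fact rV_display : measure_display.
Proof. exact: default_measure_display. Qed.

Section rV_measurable.
Variables (R : realType) (n : nat).

Let coord (i : 'I_n) (x : 'rV[R]_n) : R := x ord0 i.

Let rV_set0 : g_sigma_preimage coord set0.
Proof. exact: sigma_algebra0. Qed.

Let rV_setC A : g_sigma_preimage coord A -> g_sigma_preimage coord (~` A).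
Proof. exact: sigma_algebraC. Qed.

Let rV_bigcup (F : _^nat) : (forall i, g_sigma_preimage coord (F i)) ->
  g_sigma_preimage coord (\bigcup_i (F i)).
Proof. exact: sigma_algebra_bigcup. Qed.

HB.instance Definition _ := @isMeasurable.Build rV_display
  'rV[R]_n (g_sigma_preimage coord) rV_set0 rV_setC rV_bigcup.

Lemma measurable_coord (i : 'I_n) :
  measurable_fun [set: 'rV[R]_n] (fun x => x ord0 i).
Proof.
move=> _ Y mY; rewrite setTI; apply: sub_sigma_algebra => /=.
rewrite -bigcup_seq/=; exists i => /=; first by rewrite mem_index_enum.
by exists Y => //; rewrite setTI.
Qed.

Lemma measurable_fun_rVP d (T : measurableType d) (f : T -> 'rV[R]_n) :
  (forall i, measurable_fun [set: T] (fun t => f t ord0 i)) ->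
  measurable_fun [set: T] f.
Proof.
move=> mf _ A mA; rewrite setTI.
suff : <<s \big[setU/set0]_(i < n) preimage_set_system setT (coord i) measurable >>
    `<=` [set B | measurable (f @^-1` B)] by exact.
apply: smallest_sub.
  split=> /=; first by rewrite preimage_set0.
  - by move=> B mB; rewrite setTD preimage_setC; exact: measurableC.
  - by move=> F mF; rewrite preimage_bigcup; exact: bigcup_measurable.
rewrite -bigcup_seq => _ [i _ [B mB <-]] /=.
by rewrite setTI -[X in measurable X]setTI; exact: mf.
Qed.

End rV_measurable.

Section lebesgue_rV.
Variable R : realType.

Definition rV_cons n (p : R * 'rV[R]_n) : 'rV[R]_n.+1 :=
  \row_i (if unlift ord0 i is Some j then p.2 ord0 j else p.1).

Lemma measurable_rV_cons n : measurable_fun setT (@rV_cons n).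
Proof.
apply: measurable_fun_rVP => i.
under eq_fun do rewrite mxE.
case: unliftP => [j _|_]; last exact: measurable_fst.
apply: (measurableT_comp (@measurable_coord R n j)); exact: measurable_snd.
Qed.

Definition rV_cube n (k : nat) : set 'rV[R]_n :=
  [set x | forall i, x ord0 i \in `[- k%:R, k%:R]].

Lemma measurable_rV_cube n k : measurable (@rV_cube n k).
Proof.
rewrite (_ : rV_cube k = \bigcap_(i in [set: 'I_n])
    ((fun x : 'rV[R]_n => x ord0 i) @^-1` `[- k%:R, k%:R])); last first.
  by apply/seteqP; split => x /= h i; [move=> _ /=; exact: h|exact: h].
apply: fin_bigcap_measurable; first exact: finite_finset.
move=> i _; rewrite -[X in measurable X]setTI.
by apply: measurable_coord.
Qed.

Lemma bigcup_rV_cube n : \bigcup_k @rV_cube n k = setT.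
Proof.
apply/seteqP; split => // x _.
exists (\max_(i < n) Num.bound `|x ord0 i|)%N => // i.
rewrite /= in_itv/= -ler_norml.
apply: (le_trans (ltW (archi_boundP (normr_ge0 (x ord0 i))))).
by rewrite ler_nat (leq_bigmax i).
Qed.

Lemma preimage_rV_cons_cube n k :
  @rV_cons n @^-1` rV_cube k = `[- k%:R, k%:R] `*` rV_cube k.
Proof.
apply/seteqP; split => -[a v] /=.
- move=> h; split.
    by have := h ord0; rewrite mxE unlift_none.
  by move=> j; have := h (lift ord0 j); rewrite mxE liftK.
- by move=> [ha hv] i; rewrite mxE; case: unliftP => [j _|_].
Qed.

Section sigma_finite_pack.
Variables (n : nat) (m : {measure set 'rV[R]_n -> \bar R}).
Hypothesis msf : sigma_finite setT m.
Let mu (_ : sigma_finite setT m) : set 'rV[R]_n -> \bar R := m.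
HB.instance Definition _ := Measure.on (mu msf).
HB.instance Definition _ := Measure_isSigmaFinite.Build _ _ _ (mu msf) msf.
Definition sigma_finite_pack : {sigma_finite_measure set 'rV[R]_n -> \bar R} :=
  mu msf.
End sigma_finite_pack.

Fixpoint lebesgue_rV (n : nat) : set 'rV[R]_n -> \bar R :=
  match n return set 'rV[R]_n -> \bar R with
  | 0 => @dirac _ 'rV[R]_0 0 R
  | k.+1 => fun A => ((@lebesgue_measure R \x @lebesgue_rV k) (@rV_cons k @^-1` A))%E
  end.

Let lebesgue_rV_structure n :
  exists2 m : {measure set 'rV[R]_n -> \bar R},
    m = @lebesgue_rV n :> (set _ -> _) & forall k, (m (rV_cube k) < +oo)%E.
Proof.
elim: n => [|n [m mE mfin]].
  exists (@dirac _ 'rV[R]_0 0 R) => // k.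
  by rewrite [ltLHS]diracE ltry.
have msf : sigma_finite setT m.
  exists (@rV_cube n); first by rewrite bigcup_rV_cube.
  by move=> k; split => //; exact: measurable_rV_cube.
pose ms := sigma_finite_pack msf.
pose lm : {measure set (measurableTypeR R * 'rV[R]_n) -> \bar R} :=
  (@lebesgue_measure R \x ms)%E.
exists (measure_function_pushforward__canonical__measure_function_Measure lm
  (@measurable_rV_cons n)).
  by apply/funext => A /=; rewrite /pushforward /= -mE.
move=> k; rewrite /= /pushforward preimage_rV_cons_cube /lm/=.
have mI : measurable (`[- k%:R, k%:R] : set (measurableTypeR R)).
  exact: measurable_itv.
rewrite [ltLHS](product_measure1E lebesgue_measure ms mI (measurable_rV_cube _)).
apply: lte_mul_pinfty => //.
- have := lebesgue_measure_itv `[- k%:R : R, k%:R].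
  by move=> /= ->; case: ifP.
- exact: mfin.
Qed.

Let lebesgue_rV0 n : @lebesgue_rV n set0 = 0%E.
Proof. by have [m <- _] := lebesgue_rV_structure n; exact: measure0. Qed.

Let lebesgue_rV_ge0 n A : (0 <= @lebesgue_rV n A)%E.
Proof. by have [m <- _] := lebesgue_rV_structure n; exact: measure_ge0. Qed.

Let lebesgue_rV_sigma_additive n : semi_sigma_additive (@lebesgue_rV n).
Proof.
by have [m <- _] := lebesgue_rV_structure n; exact: measure_semi_sigma_additive.
Qed.

HB.instance Definition _ n := isMeasure.Build _ _ _ (@lebesgue_rV n)
  (@lebesgue_rV0 n) (@lebesgue_rV_ge0 n) (@lebesgue_rV_sigma_additive n).

Let lebesgue_rV_sigma_finite n : sigma_finite setT (@lebesgue_rV n).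
Proof.
exists (@rV_cube n); first by rewrite bigcup_rV_cube.
move=> k; split; first exact: measurable_rV_cube.
by have [m <-] := lebesgue_rV_structure n; exact.
Qed.

HB.instance Definition _ n := Measure_isSigmaFinite.Build _ _ _ (@lebesgue_rV n)
  (@lebesgue_rV_sigma_finite n).

End lebesgue_rV.
Arguments lebesgue_rV {R n}.

Section smooth_functions.
Variable R : realType.

(* Directional derivatives along all vectors: in finite dimension this is the
   usual C^k, and it covers functions on R, on R^n and on R x R^n alike. *)
Fixpoint Ck (V : normedModType R) (k : nat) (f : V -> R) : Prop :=
  continuous f /\
  match k with
  | 0 => True
  | k'.+1 => forall v : V, (forall x, derivable f x v) /\ Ck k' ('D_v f)
  end.

Definition Cinfty (V : normedModType R) (f : V -> R) := forall k, Ck k f.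

Definition test_function (V : normedModType R) (U : set V) (phi : V -> R) :=
  [/\ Cinfty phi, compact (closure [set x | phi x != 0])
    & closure [set x | phi x != 0] `<=` U].

Variable n : nat.
Implicit Types (f : 'rV[R]_n -> R) (A Omega : set 'rV[R]_n).

(* The norm of the normed module 'rV[R]_n is the sup norm. *)
Definition enorm (v : 'rV[R]_n) : R := Num.sqrt (\sum_i v ord0 i ^+ 2).

Definition partial (i : 'I_n) f : 'rV[R]_n -> R := 'D_(delta_mx ord0 i) f.

Definition grad f (x : 'rV[R]_n) : 'rV[R]_n := \row_i partial i f x.

Definition dot (v w : 'rV[R]_n) : R := \sum_i v ord0 i * w ord0 i.

Definition diam A : R :=
  sup [set d | exists x y, [/\ A x, A y & d = enorm (x - y)]].

(* Local defining functions; [Omega] is meant to be open, so that its boundary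
   is [closure Omega `\` Omega]. *)
Definition smooth_boundary Omega :=
  forall x, (closure Omega `\` Omega) x ->
  exists (U : set 'rV[R]_n) (rho : 'rV[R]_n -> R),
    [/\ open U, U x, Cinfty rho, grad rho x != 0
      & Omega `&` U = [set y | rho y < 0] `&` U].

Definition Cinfty_closure Omega f :=
  exists2 g, Cinfty g & {in closure Omega, f =1 g}.

End smooth_functions.

Section sobolev.
Variables (R : realType) (n : nat).
Local Notation mu := (@lebesgue_rV R n).
Implicit Types (f g v : 'rV[R]_n -> R) (U Omega : set 'rV[R]_n)
  (G : 'rV[R]_n -> 'rV[R]_n).

Definition Linfty U f :=
  measurable_fun U f /\ exists M, {ae mu, forall x, U x -> `|f x| <= M}.

Definition L2sq U f : \bar R := (\int[mu]_(x in U) ((f x) ^+ 2)%:E)%E.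

Definition L2 U f := measurable_fun U f /\ (L2sq U f < +oo)%E.

Definition weak_partial U (i : 'I_n) f g :=
  forall phi, test_function U phi ->
    \int[mu]_(x in U) (f x * partial i phi x) =
    - \int[mu]_(x in U) (g x * phi x).

(* The Sobolev space W^{k,oo}(U). *)
Fixpoint Wkinfty U (k : nat) f : Prop :=
  Linfty U f /\
  match k with
  | 0 => True
  | k'.+1 => forall i, exists2 g, weak_partial U i f g & Wkinfty U k' g
  end.

(* [v] belongs to H^1(Omega), with weak gradient [G]. *)
Definition H1 Omega v G :=
  L2 Omega v /\
  forall i, L2 Omega (fun x => G x ord0 i) /\
            weak_partial Omega i v (fun x => G x ord0 i).

(* [v], with weak gradient [G], is in the closure of C_c^oo(Omega) in H^1. *)
Definition H10 Omega v G :=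
  H1 Omega v G /\
  exists phi : nat -> 'rV[R]_n -> R,
    [/\ forall k, test_function Omega (phi k),
        L2sq Omega (phi k \- v) @[k --> \oo] --> 0%E
      & forall i, L2sq Omega (partial i (phi k) \- (fun x => G x ord0 i))
                    @[k --> \oo] --> 0%E].

End sobolev.

Section flushing.
Variables (R : realType) (n : nat).
Implicit Types (f : 'rV[R]_n -> R) (Omega omega : set 'rV[R]_n).

(* A W^{2,oo} function is taken in its C^1 representative, so that the
   gradient flow makes sense pointwise. *)
Definition W2infty_extension Omega f ft :=
  [/\ Wkinfty setT 2 ft, Ck 1 ft, compact (closure [set x | ft x != 0])
    & {in closure Omega, ft =1 f}].

Definition gradient_trajectory f (x : 'rV[R]_n) (gamma : R -> 'rV[R]_n) :=
  gamma 0 = x /\ forall t : R, is_derive t 1 gamma (- grad f (gamma t)).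

Definition flushing_in Omega f omega (T : R) :=
  exists2 ft, W2infty_extension Omega f ft &
  forall x, closure Omega x ->
  exists2 gamma, gradient_trajectory ft x gamma &
  exists2 t, 0 < t < T & ~ closure Omega (gamma t) \/ omega (gamma t).

Definition flushing Omega f omega :=
  exists2 T, 0 < T & flushing_in Omega f omega T.

Definition T_FC Omega f omega : \bar R :=
  ereal_inf [set T%:E | T in [set T | 0 < T /\ flushing_in Omega f omega T]].

End flushing.

Section observability.
Variables (R : realType) (n : nat).
Local Notation mu := (@lebesgue_rV R n).
Local Notation leb := (@lebesgue_measure R).
Implicit Types (f q : 'rV[R]_n -> R) (u : R -> 'rV[R]_n -> R)
  (Omega omega : set 'rV[R]_n) (phi : R * 'rV[R]_n -> R).

Definition time_partial phi (t : R) (x : 'rV[R]_n) : R := 'D_(1, 0) phi (t, x).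

(* The gradient in the space variable. *)
Definition space_grad phi (t : R) (x : 'rV[R]_n) : 'rV[R]_n :=
  \row_i 'D_(0, delta_mx ord0 i) phi (t, x).

(* The weak solution in C([0,T]; L^2(Omega)) /\ L^2(0,T; H^1_0(Omega)) of
     (d_t - grad f . grad - q - eps Laplacian) u = 0,   u(0) = u0,
   where [G t] is the weak gradient of [u t]; the equation holds in the sense of
   distributions on (0,T) x Omega. *)
Definition weak_solution Omega f q (eps T : R) (u0 : 'rV[R]_n -> R) u :=
  [/\ forall t, t \in `[0, T] -> L2 Omega (u t),
      forall t, t \in `[0, T] ->
        L2sq Omega (u s \- u t) @[s --> within `[0, T] (nbhs t)] --> 0%E,
      {ae mu, forall x, Omega x -> u 0 x = u0 x}
    & exists G : R -> 'rV[R]_n -> 'rV[R]_n,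
      [/\ measurable_fun (`]0, T[ `*` Omega) (fun p => u p.1 p.2)
            /\ measurable_fun (`]0, T[ `*` Omega) (fun p => G p.1 p.2),
          (\int[leb]_(t in `]0%R, T[) L2sq Omega (u t) < +oo)%E
            /\ forall i, (\int[leb]_(t in `]0%R, T[)
                 L2sq Omega (fun x => G t x ord0 i) < +oo)%E,
          {ae leb, forall t, t \in `]0, T[ -> H10 Omega (u t) (G t)}
        & forall phi, test_function (`]0, T[ `*` Omega) phi ->
            \int[leb]_(t in `]0, T[) \int[mu]_(x in Omega)
              (- (u t x * time_partial phi t x)
               - dot (grad f x) (G t x) * phi (t, x)
               - q x * u t x * phi (t, x)
               + eps * dot (G t x) (space_grad phi t x)) = 0 ]].

Definition observable Omega f q omega (T eps C0 : R) :=
  forall (u0 : 'rV[R]_n -> R) u, L2 Omega u0 -> weak_solution Omega f q eps T u0 u ->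
  (L2sq Omega (u T) <=
     (C0 ^+ 2)%:E * \int[leb]_(t in `]0%R, T[) L2sq omega (u t))%E.

Definition uniformly_observable Omega f q omega (T : R) :=
  exists K0 eps0, [/\ 0 < K0, 0 < eps0
    & forall eps, 0 < eps < eps0 ->
        exists2 C0, 0 <= C0 <= K0 & observable Omega f q omega T eps C0].

Definition T_unif Omega f q omega : \bar R :=
  ereal_inf [set T%:E | T in
    [set T | 0 < T /\ uniformly_observable Omega f q omega T]].

(* The norm of grad f in L^oo(Omega). *)
Definition grad_sup_norm Omega f : \bar R :=
  'N[mu]_+oo[EFin \o ((fun x => enorm (grad f x)) \_ Omega)].

End observability.

(* Main.v *)
(* The potential is a one dimensional profile f = F(x_0 - a), where a is the infimum of x_0
   on Omega, F'(s) = 1 + alpha s (2 D - s), D is the diameter of Omega, and alpha is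
   chosen so that (1 + alpha D^2)^2 = 1 + lambda^2 D^2. Since F' >= 1, the flow leaves
   the closure of Omega within time D, but it is slow near s = 0, whereas F(rho) is at
   least lambda rho^2 / 2; omega is the part of Omega where x_0 > a + rho.

   With the weight r = exp(f / eps) the operator becomes symmetric. Let w be the ground
   state of the functional int r (eps |grad w|^2 - q w^2) / int r w^2, obtained by
   minimization in H^1_0 (Rellich's theorem), and E the minimum; then exp(- E t) w is a
   solution. Completing the square bounds the functional from below by
   int r w^2 F'^2 / (4 eps) up to O(1), and trial functions exp(- f / (2 eps)) psi with psi
   supported where F' is close to 1 give E <= (1 + o(1)) / (4 eps). Hence w concentrates
   for r w^2 near s = 0: the mass of w^2 on Omega is at least about exp(- F(sigma) / eps) / 2
   with sigma small, against at most exp(- F(rho) / eps) on omega. An observability constant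
   bounded in eps then forces 2 E T >= (F(rho) - F(sigma)) / eps - O(1), that is,
   T >= c F(rho) >= c' lambda. *)
From HB Require Import structures.
Require Import Defs.
From mathcomp Require Import all_boot all_order all_algebra.
From mathcomp Require Import all_classical all_reals all_analysis.
From mathcomp Require Import measurable_realfun ess_sup_inf ring lra.
Import Order.TTheory GRing.Theory Num.Theory numFieldNormedType.Exports.

Set Implicit Arguments.
Unset Strict Implicit.
Unset Printing Implicit Defensive.

Local Open Scope classical_set_scope.
Local Open Scope ring_scope.

(** * Square integrable functions *)

(** The leading energy 1 / (4 eps) sees only the smallest value 1 of F', whatever lambda is, while
    the ratio of the two masses is governed by F(rho), which grows with lambda; this contrast is the
    lower bound on T. F is convex on [0, D], so the error left by completing the square has a
    favourable sign and only the bound on q is lost. F' is concave there, hence above lambda s, and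
    its maximum sqrt (1 + lambda^2 D^2) at s = D is what the upper bound on the gradient allows, as
    n >= 1. Estimates involving derivatives are proved for a minimizing sequence of test functions,
    where integration by parts is immediate; the bounds on w^2 follow in the L2 limit. (FC) concerns
    a compactly supported extension, whose trajectory must solve the equation at every real time,
    also after leaving the domain. The flow of F is a Riccati equation whose solution stays between
    its two equilibria, so a cutoff equal to 1 on a large enough ball never meets it. *)

Lemma discr_le0 (R : realFieldType) (a b c : R) : 0 <= c ->
  (forall t, 0 <= a + 2 * t * b + t ^+ 2 * c) -> b ^+ 2 <= a * c.
Proof.
move=> c0 H; have [cE|cN] := eqVneq c 0.
  have [->|bN] := eqVneq b 0; first by rewrite cE expr0n/= mulr0.
  have := H (- (a + 1) / (2 * b)); rewrite cE mulr0 addr0.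
  have -> : 2 * (- (a + 1) / (2 * b)) * b = - (a + 1) by field.
  lra.
have := H (- b / c).
have -> : a + 2 * (- b / c) * b + (- b / c) ^+ 2 * c = (a * c - b ^+ 2) / c by field.
by rewrite pmulr_lge0 ?subr_ge0// invr_gt0 lt_def cN.
Qed.

Section sqi.
Context d (T : measurableType d) (R : realType).
Variables (mu : {measure set T -> \bar R}) (D : set T).
Hypothesis mD : measurable D.
Implicit Types f g h : T -> R.

(** For [lebesgue_rV] this is convertible to [L2], and later proofs pass silently from one to the
    other. The abstract measure also serves integrals along segments. *)
Definition sqi f := measurable_fun D f /\ (\int[mu]_(x in D) ((f x) ^+ 2)%:E < +oo)%E.

Lemma sqi_sqr_integrable f : sqi f -> mu.-integrable D (EFin \o (fun x => f x ^+ 2)).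
Proof.
move=> [mf fi]; apply/integrableP; split.
  by apply/measurable_EFinP; exact: measurable_funX.
by under eq_integral do rewrite /= ger0_norm ?sqr_ge0//.
Qed.

Lemma sqi_mul f g : sqi f -> sqi g -> mu.-integrable D (EFin \o (fun x => f x * g x)).
Proof.
move=> sf sg.
have iD := integrableD mD (sqi_sqr_integrable sf) (sqi_sqr_integrable sg).
apply: le_integrable iD => //.
  by apply/measurable_EFinP; apply: measurable_funM; [case: sf|case: sg].
move=> x _ /=; rewrite lee_fin normrM.
rewrite [leRHS]ger0_norm ?addr_ge0 ?sqr_ge0//.
rewrite -(real_normK (num_real (f x))) -(real_normK (num_real (g x))).
have := sqr_ge0 (`|f x| - `|g x|); have := sqr_ge0 `|f x|.
have := sqr_ge0 `|g x|; rewrite sqrrB; nra.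
Qed.

Lemma sqi_dominated f g : measurable_fun D f -> sqi g ->
  (exists C : R, 0 <= C /\ forall x, D x -> f x ^+ 2 <= C * g x ^+ 2) -> sqi f.
Proof.
move=> mf [mg gi] [C [C0 H]]; split => //.
apply: (@le_lt_trans _ _ (\int[mu]_(x in D) (C%:E * (g x ^+ 2)%:E))%E).
  apply: ge0_le_integral => //.
  - by move=> x _; rewrite lee_fin sqr_ge0.
  - by apply/measurable_EFinP; exact: measurable_funX.
  - apply: measurable_funeM; apply/measurable_EFinP; exact: measurable_funX.
rewrite ge0_integralZl//.
- by apply: lte_mul_pinfty => //; exact: integral_ge0 => x _; rewrite lee_fin sqr_ge0.
- by apply/measurable_EFinP; exact: measurable_funX.
- by move=> x _; rewrite lee_fin sqr_ge0.
Qed.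

Lemma sqiM_bounded f h : sqi f -> measurable_fun D h ->
  (exists C : R, forall x, D x -> `|h x| <= C) -> sqi (fun x => h x * f x).
Proof.
move=> sf mh [C HC]; apply: (@sqi_dominated _ f) => //.
  by apply: measurable_funM => //; case: sf.
exists (C ^+ 2); split=> [|x Dx]; first exact: sqr_ge0.
rewrite exprMn ler_wpM2r ?sqr_ge0// -(real_normK (num_real (h x))).
by rewrite lerXn2r ?nnegrE ?HC ?normr_ge0// (le_trans (normr_ge0 _) (HC _ Dx)).
Qed.

Lemma sqiZ a f : sqi f -> sqi (fun x => a * f x).
Proof. by move=> sf; apply: (sqiM_bounded sf) => //; exists `|a|. Qed.

Lemma sqiD f g : sqi f -> sqi g -> sqi (fun x => f x + g x).
Proof.
move=> sf sg; split; first by apply: measurable_funD; [case: sf|case: sg].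
have iD := integrableD mD (sqi_sqr_integrable sf) (sqi_sqr_integrable sg).
have := integrableZl mD 2 iD => /integrableP[_]; apply: le_lt_trans.
apply: ge0_le_integral => //.
- by move=> x _; rewrite lee_fin sqr_ge0.
- apply/measurable_EFinP; apply: measurable_funX.
  by apply: measurable_funD; [case: sf|case: sg].
- apply: measurableT_comp => //; apply: measurable_funeM.
  apply: emeasurable_funD; apply/measurable_EFinP; apply: measurable_funX;
  by [case: sf|case: sg].
- move=> x _ /=; rewrite lee_fin ger0_norm; last first.
    by rewrite mulr_ge0// addr_ge0 ?sqr_ge0.
  have := sqr_ge0 (f x - g x); rewrite sqrrB sqrrD; nra.
Qed.

Lemma sqiN f : sqi f -> sqi (fun x => - f x).
Proof.
move=> sf; have := sqiZ (-1) sf.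
by rewrite (_ : (fun x => - f x) = (fun x => -1 * f x))//; apply/funext => x; rewrite mulN1r.
Qed.

Lemma sqiB f g : sqi f -> sqi g -> sqi (fun x => f x - g x).
Proof. by move=> sf sg; apply: sqiD => //; exact: sqiN. Qed.

Lemma sqi_bounded h : (mu D < +oo)%E -> measurable_fun D h ->
  (exists C : R, forall x, D x -> `|h x| <= C) -> sqi h.
Proof.
move=> Dfin mh [C HC]; split => //.
apply: (@le_lt_trans _ _ (\int[mu]_(x in D) (C ^+ 2)%:E)%E).
  apply: ge0_le_integral => //.
  - by move=> x _; rewrite lee_fin sqr_ge0.
  - by apply/measurable_EFinP; exact: measurable_funX.
  move=> x Dx; rewrite lee_fin -(real_normK (num_real (h x))).
  by rewrite lerXn2r ?nnegrE ?HC ?normr_ge0// (le_trans (normr_ge0 _) (HC _ Dx)).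
by rewrite integral_cst// lte_mul_pinfty// lee_fin sqr_ge0.
Qed.

Lemma bounded_integrable h : (mu D < +oo)%E -> measurable_fun D h ->
  (exists C : R, forall x, D x -> `|h x| <= C) -> mu.-integrable D (EFin \o h).
Proof.
move=> Dfin mh [C HC]; apply: measurable_bounded_integrable => //.
exists C; split; first exact: num_real.
by move=> M CM x Dx; apply: le_trans (ltW CM); exact: HC.
Qed.

Lemma sqi_EFin f : sqi f ->
  (\int[mu]_(x in D) ((f x) ^+ 2)%:E)%E = (\int[mu]_(x in D) (f x ^+ 2))%:E.
Proof.
move=> /sqi_sqr_integrable fi.
by rewrite /Rintegral fineK//; exact: (integrable_fin_num mD fi).
Qed.

Lemma sqi_cauchy_schwarz f g : sqi f -> sqi g ->
  (\int[mu]_(x in D) (f x * g x)) ^+ 2 <=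
  (\int[mu]_(x in D) (f x ^+ 2)) * (\int[mu]_(x in D) (g x ^+ 2)).
Proof.
move=> sf sg; apply: discr_le0.
  by apply: Rintegral_ge0 => x _; exact: sqr_ge0.
move=> t.
have iff := sqi_sqr_integrable sf; have igg := sqi_sqr_integrable sg.
have ifg := sqi_mul sf sg.
have -> : \int[mu]_(x in D) (f x ^+ 2) + 2 * t * \int[mu]_(x in D) (f x * g x) +
    t ^+ 2 * \int[mu]_(x in D) (g x ^+ 2) =
    \int[mu]_(x in D) ((f x ^+ 2 + 2 * t * (f x * g x)) + t ^+ 2 * g x ^+ 2).
  rewrite RintegralD//; last 2 first.
  - exact: (integrableD mD iff (integrableZl mD (2 * t) ifg)).
  - exact: (integrableZl mD (t ^+ 2) igg).
  rewrite RintegralD//; last exact: (integrableZl mD (2 * t) ifg).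
  by rewrite !RintegralZl.
apply: Rintegral_ge0 => x _.
have -> : f x ^+ 2 + 2 * t * (f x * g x) + t ^+ 2 * g x ^+ 2 = (f x + t * g x) ^+ 2.
  by ring.
exact: sqr_ge0.
Qed.

(** A real integral is 0 when its extended value is infinite, so this expresses L2 convergence only
    together with [sqi] hypotheses on the sequence and the limit. *)
Definition cvg_sqi (u : nat -> T -> R) f :=
  (fun k => \int[mu]_(x in D) ((u k x - f x) ^+ 2)) @ \oo --> (0 : R).

Lemma cvg_sqi_mul u f g : (forall k, sqi (u k)) -> sqi f -> sqi g -> cvg_sqi u f ->
  (fun k => \int[mu]_(x in D) (u k x * g x)) @ \oo --> \int[mu]_(x in D) (f x * g x).
Proof.
move=> su sf sg uf.
have H k : \int[mu]_(x in D) (u k x * g x) = \int[mu]_(x in D) (f x * g x) +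
    \int[mu]_(x in D) ((u k x - f x) * g x).
  rewrite -RintegralD//; [|exact: sqi_mul|by apply: sqi_mul => //; exact: sqiB].
  by apply: eq_Rintegral => x _; ring.
rewrite (funext H).
rewrite -[X in _ --> X]addr0; apply: cvgD; first exact: cvg_cst.
apply: norm_cvg0.
set G := \int[mu]_(x in D) (g x ^+ 2).
have c0 : (fun k => Num.sqrt (\int[mu]_(x in D) ((u k x - f x) ^+ 2) * G)) @ \oo --> (0 : R).
  rewrite -[X in _ --> X](@sqrtr0 R).
  apply: (continuous_cvg _ (@sqrt_continuous R _)).
  by rewrite -(mul0r G); apply: cvgM => //; exact: cvg_cst.
apply: (squeeze_cvgr _ (cvg_cst 0) c0).
apply: nearW => k; rewrite normr_ge0/= -sqrtr_sqr ler_wsqrtr//.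
by apply: sqi_cauchy_schwarz => //; exact: sqiB.
Qed.

(** The identity h u^2 = h (u - f)^2 + 2 u (h f) - h f^2 leaves one term that tends to 0 and one
    that is linear in u, to which [cvg_sqi_mul] applies. *)
Lemma cvg_sqi_sqr u f h : (forall k, sqi (u k)) -> sqi f -> measurable_fun D h ->
  (exists C : R, forall x, D x -> `|h x| <= C) -> cvg_sqi u f ->
  (fun k => \int[mu]_(x in D) (h x * u k x ^+ 2)) @ \oo --> \int[mu]_(x in D) (h x * f x ^+ 2).
Proof.
move=> su sf mh bh uf.
have ihs g : sqi g -> mu.-integrable D (EFin \o (fun x => h x * g x ^+ 2)).
  move=> sg; have := sqi_mul (sqiM_bounded sg mh bh) sg.
  by apply: eq_integrable => // x _ /=; rewrite -mulrA.
have suf k : sqi (fun x => u k x - f x) by exact: sqiB.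
have H k : \int[mu]_(x in D) (h x * u k x ^+ 2) =
    (\int[mu]_(x in D) (h x * (u k x - f x) ^+ 2) +
    2 * \int[mu]_(x in D) (u k x * (h x * f x))) - \int[mu]_(x in D) (h x * f x ^+ 2).
  have i1 : mu.-integrable D (EFin \o (fun x => u k x * (h x * f x))).
    by apply: sqi_mul => //; exact: sqiM_bounded.
  have i2 := integrableZl mD 2 i1.
  rewrite -RintegralZl// -RintegralD//; last exact: ihs.
  rewrite -RintegralB//; [|exact: (integrableD mD (ihs _ (suf k)) i2)|exact: ihs].
  by apply: eq_Rintegral => x _; ring.
rewrite (funext H).
rewrite [X in _ --> X](_ : _ =
    (0 + 2 * \int[mu]_(x in D) (f x * (h x * f x))) - \int[mu]_(x in D) (h x * f x ^+ 2)); last first.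
  rewrite add0r (_ : \int[mu]_(x in D) (f x * (h x * f x)) = \int[mu]_(x in D) (h x * f x ^+ 2)).
    by ring.
  by apply: eq_Rintegral => x _; ring.
apply: cvgB; last exact: cvg_cst.
apply: cvgD; last first.
  by apply: cvgZr; apply: cvg_sqi_mul => //; exact: sqiM_bounded.
have [C HC] := bh; apply: norm_cvg0.
have c0 : (fun k => C * \int[mu]_(x in D) ((u k x - f x) ^+ 2)) @ \oo --> (0 : R).
  by rewrite -[X in _ --> X](mulr0 C); exact: cvgZr.
apply: (squeeze_cvgr _ (cvg_cst 0) c0).
apply: nearW => k; rewrite normr_ge0/=.
apply: (le_trans (le_normr_Rintegral mD (ihs _ (suf k)))).
rewrite -RintegralZl//; last exact: sqi_sqr_integrable.
apply: le_Rintegral => //.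
- exact: (integrable_norm (ihs _ (suf k))).
- exact: (integrableZl mD C (sqi_sqr_integrable (suf k))).
- by move=> x Dx; rewrite normrM (ger0_norm (sqr_ge0 _)) ler_wpM2r ?sqr_ge0// HC.
Qed.

End sqi.

(** Cauchy-Schwarz with the weights 2^-j and 2^j: a weighted sum of squared increments controls the
    increments themselves, at a geometric rate. It is applied pointwise to prove completeness of
    L2. *)
Lemma fast_cauchy_sqr (R : realType) (u : nat -> R) (s : R) :
  (forall l, \sum_(0 <= j < l) (2 ^+ j * (u j.+1 - u j) ^+ 2) <= s) ->
  exists2 a : R, u @ \oo --> a & forall k, (a - u k) ^+ 2 <= 2^-1 ^+ k * (2 * s).
Proof.
move=> Hs.
pose c j : R := 2 ^+ j * (u j.+1 - u j) ^+ 2.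
have c0 j : 0 <= c j by rewrite /c mulr_ge0 ?sqr_ge0 ?exprn_ge0.
pose h : R := 2^-1.
have h0 j : 0 < h ^+ j by rewrite exprn_gt0 // invr_gt0.
have hS j : h ^+ j = 2 * h ^+ j.+1 by rewrite exprS /h; field.
(* The first factor is the sum of 2^-j over k <= j < k + m in closed form, so this is the
   Cauchy-Schwarz inequality, by induction on m. *)
have step k m : (u (k + m)%N - u k) ^+ 2 <=
    (2 * h ^+ k - 2 * h ^+ (k + m)) * \sum_(k <= j < k + m) c j.
  elim: m => [|m IH]; first by rewrite addn0 !subrr expr0n mul0r.
  rewrite addnS big_nat_recr /= ?leq_addr//.
  set S := \sum_(k <= j < k + m) c j in IH *.
  have S0 : 0 <= S by apply: sumr_ge0.
  set A := 2 * h ^+ k - 2 * h ^+ (k + m) in IH *.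
  have A0 : 0 <= A.
    rewrite subr_ge0 ler_wpM2l// exprD -[leRHS]mulr1 ler_wpM2l ?(ltW (h0 _))//.
    by rewrite exprn_ile1 /h; lra.
  set B := h ^+ (k + m).
  have B0 : 0 < B by exact: h0.
  have -> : 2 * h ^+ k - 2 * h ^+ (k + m).+1 = A + B.
    by rewrite /A -hS /B (hS (k + m)); ring.
  set d := u (k + m).+1 - u (k + m)%N.
  have -> : c (k + m) = d ^+ 2 / B.
    by rewrite /c -/d /B /h exprVn invrK mulrC.
  set a := u (k + m)%N - u k in IH *.
  have -> : u (k + m).+1 - u k = a + d by rewrite /a /d; ring.
  (* Since a^2 <= A S by induction, the cross term is bounded by the arithmetic-geometric mean
     inequality. *)
  have key : 2 * a * d <= A * (d ^+ 2 / B) + B * S.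
    apply: le_trans (ler_norm _) _.
    have X0 : 0 <= A * (d ^+ 2 / B) by rewrite mulr_ge0// divr_ge0 ?sqr_ge0// ltW.
    have Y0 : 0 <= B * S by rewrite mulr_ge0// ltW.
    rewrite -(@ler_pXn2r _ 2)// ?nnegrE ?addr_ge0// real_normK ?num_real//.
    have e : (A * (d ^+ 2 / B)) * (B * S) = A * S * d ^+ 2.
      by field; rewrite gt_eqF.
    have -> : (A * (d ^+ 2 / B) + B * S) ^+ 2 =
        (A * (d ^+ 2 / B) - B * S) ^+ 2 + 4 * ((A * (d ^+ 2 / B)) * (B * S)) by ring.
    have -> : (2 * a * d) ^+ 2 = 4 * (a ^+ 2 * d ^+ 2) by ring.
    rewrite e; apply: (@le_trans _ _ (4 * (A * S * d ^+ 2))); last by rewrite lerDr sqr_ge0.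
    by rewrite ler_wpM2l// ler_wpM2r// sqr_ge0.
  have -> : (A + B) * (S + d ^+ 2 / B) = A * S + (A * (d ^+ 2 / B) + B * S) + d ^+ 2.
    by field; rewrite gt_eqF.
  have -> : (a + d) ^+ 2 = a ^+ 2 + 2 * a * d + d ^+ 2 by ring.
  by rewrite lerD2r; exact: (lerD IH key).
have s0 : 0 <= s by apply: le_trans (Hs 0%N); rewrite big_geq.
have bnd k m : (u (k + m)%N - u k) ^+ 2 <= h ^+ k * (2 * s).
  apply: (le_trans (step k m)).
  have Sle : \sum_(k <= j < k + m) c j <= s.
    apply: le_trans (Hs (k + m)%N); rewrite (@big_cat_nat _ _ _ k 0)//= ?leq_addr//.
    by rewrite lerDr; apply: sumr_ge0 => j _; exact: c0.
  have Sge : 0 <= \sum_(k <= j < k + m) c j by apply: sumr_ge0.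
  apply: (@le_trans _ _ (2 * h ^+ k * \sum_(k <= j < k + m) c j)).
    by rewrite ler_wpM2r// gerBl mulr_ge0// ltW.
  by rewrite [leRHS]mulrCA mulrA ler_wpM2l// mulr_ge0// ltW.
have cu : cvg (u @ \oo).
  apply: cauchy_cvg; apply: cauchy_exP => e e0.
  have : (fun k => h ^+ k * (2 * s)) @ \oo --> (0 * (2 * s) : R).
    by apply: cvgM; [apply: cvg_expr; rewrite ger0_norm /h; lra|exact: cvg_cst].
  rewrite mul0r => /cvgrPdist_lt /(_ (e ^+ 2)).
  rewrite exprn_gt0// => /(_ isT) [k _ /(_ k (leqnn k))].
  rewrite sub0r normrN => kE; exists (u k); exists k => // m /= km.
  have := bnd k (m - k)%N; rewrite subnKC// => H.
  rewrite /ball /= distrC -(@ltr_pXn2r _ 2)// ?nnegrE ?(ltW e0)// real_normK ?num_real//.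
  by apply: (le_lt_trans H); exact: le_lt_trans (ler_norm _) kE.
exists (limn u) => // k.
have cc : (fun m => (u m - u k) ^+ 2) @ \oo --> (limn u - u k) ^+ 2.
  by apply: cvgM; apply: cvgB => //; exact: cvg_cst.
apply: (cvgr_to_le cc).
exists k => // m /= km; have := bnd k (m - k)%N; by rewrite subnKC.
Qed.

(** * Completeness of L2 *)

Section sqi_complete.
Context d (T : measurableType d) (R : realType).
Variables (mu : {measure set T -> \bar R}) (D : set T).
Hypothesis mD : measurable D.

(** The rate 4^-k leaves room for the weights 2^j: the series [S] of weighted squared increments has
    a finite integral, hence is finite almost everywhere on D, and there the sequence converges with
    an error dominated by [S]. Measurability of the limit on the whole space serves joint
    measurability in time and space later. *)
Lemma sqi_complete (u : nat -> T -> R) (C : R) :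
  (forall k, measurable_fun setT (u k)) -> (forall k, sqi mu D (u k)) ->
  (forall k, \int[mu]_(x in D) ((u k.+1 x - u k x) ^+ 2) <= C * 4^-1 ^+ k) ->
  exists w, [/\ measurable_fun setT w, sqi mu D w, cvg_sqi mu D u w &
    forall x, (forall k, u k x = 0) -> w x = 0].
Proof.
move=> mu_ su Hu.
pose c j x : R := 2 ^+ j * (u j.+1 x - u j x) ^+ 2.
have c0 j x : 0 <= c j x by rewrite /c mulr_ge0 ?sqr_ge0 ?exprn_ge0.
have mc j : measurable_fun D (EFin \o c j).
  apply/measurable_EFinP; apply: measurable_funM => //; apply: measurable_funX.
  by apply: measurable_funB; exact: measurable_funTS.
have sd j : sqi mu D (fun x => u j.+1 x - u j x) by exact: sqiB.
pose S x : \bar R := (\sum_(0 <= j <oo) (c j x)%:E)%E.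
have S0 x : (0 <= S x)%E by apply: nneseries_ge0 => // j _ _; rewrite lee_fin.
have mS : measurable_fun D S.
  by apply: ge0_emeasurable_sum; [move=> k x Dx _; rewrite lee_fin; exact: c0|move=> k _; exact: mc].
have C0 : 0 <= C.
  have := Hu 0%N; rewrite expr0 mulr1; apply: le_trans.
  by apply: Rintegral_ge0 => x _; exact: sqr_ge0.
have ISle : (\int[mu]_(x in D) S x <= (2 * C)%:E)%E.
  rewrite /S integral_nneseries//; last by move=> *; rewrite lee_fin.
  have ile j : (\int[mu]_(x in D) (c j x)%:E <= (C * 2^-1 ^+ j)%:E)%E.
    under eq_integral do rewrite /c EFinM.
    rewrite ge0_integralZl//; last 2 first.
    - by case/integrableP : (sqi_sqr_integrable (sd j)).
    - by move=> x _; rewrite lee_fin sqr_ge0.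
    rewrite sqi_EFin// -EFinM lee_fin.
    have -> : C * 2^-1 ^+ j = 2 ^+ j * (C * 4^-1 ^+ j).
      have -> : (4^-1 : R) = 2^-1 * 2^-1 by field.
      by rewrite exprMn [RHS]mulrC -!mulrA -[in RHS]exprMn mulVf// expr1n mulr1.
    by rewrite ler_wpM2l ?exprn_ge0.
  apply: lime_le.
    apply: is_cvg_nneseries => j _ _; apply: integral_ge0 => x _.
    by rewrite lee_fin.
  apply: nearW => k.
  apply: (@le_trans _ _ (\sum_(0 <= j < k) (C * 2^-1 ^+ j)%:E)%E).
    by apply: lee_sum => j _.
  rewrite sumEFin lee_fin -mulr_sumr mulrC ler_wpM2r//.
  have -> : \sum_(0 <= i < k) (2^-1 : R) ^+ i = 2 - 2 * 2^-1 ^+ k.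
    elim: k => [|k IH]; first by rewrite big_geq// expr0; ring.
    by rewrite big_nat_recr//= IH exprS; field.
  by rewrite gerBl mulr_ge0// exprn_ge0// invr_ge0.
have IS0 : (0 <= \int[mu]_(x in D) S x)%E by exact: integral_ge0.
have iS : mu.-integrable D S.
  apply/integrableP; split => //.
  under eq_integral do rewrite gee0_abs//.
  by apply: le_lt_trans ISle _; rewrite ltry.
have Sfin := integrable_ae mD iS.
(* The upper limit is measurable without any convergence and equals the limit wherever there is
   one. *)
pose w x : R := fine (limn_esup (fun k => (u k x)%:E)).
have mw : measurable_fun setT w.
  have ml : measurable_fun setT (fun x => limn_esup (fun k => (u k x)%:E)).
    by apply: measurable_fun_limn_esup => k; apply/measurable_EFinP.
  exact: (@measurableT_comp _ _ _ _ _ _ fine _ _ (fine_measurable measurableT) ml).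
have wlim x a : (u ^~ x) @ \oo --> a -> w x = a.
  move=> ua; rewrite /w; have ua' : (fun k => (u k x)%:E) @ \oo --> a%:E.
    by apply: cvg_EFin => //; exact: nearW.
  by rewrite is_cvg_limn_esupE ?(cvg_lim _ ua')//; apply/cvg_ex; exists a%:E.
have wk : {ae mu, forall x, D x -> forall k,
    (((w x - u k x) ^+ 2)%:E <= (2^-1 ^+ k * 2)%:E * S x)%E}.
  move: Sfin; apply: filterS => x Sx Dx k; have {}Sx := Sx Dx.
  have [l|a ua ka] := @fast_cauchy_sqr R (u ^~ x) (fine (S x)).
    rewrite -lee_fin fineK// -sumEFin; apply: nneseries_lim_ge => j _ _.
    by rewrite lee_fin; exact: c0.
  by rewrite (wlim _ _ ua) -(fineK Sx) -EFinM lee_fin -mulrA ka.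
have mwu k : measurable_fun D (fun x => w x - u k x).
  by apply: measurable_funB; exact: measurable_funTS.
have bk k : (\int[mu]_(x in D) ((w x - u k x) ^+ 2)%:E <= (2^-1 ^+ k * 2 * (2 * C))%:E)%E.
  apply: (@le_trans _ _ (\int[mu]_(x in D) ((2^-1 ^+ k * 2)%:E * S x))%E).
    apply: ae_ge0_le_integral => //.
    - by move=> x _; rewrite lee_fin sqr_ge0.
    - by apply/measurable_EFinP; apply: measurable_funX.
    - by move=> x _; rewrite mule_ge0// lee_fin mulr_ge0// exprn_ge0// invr_ge0.
    - exact: measurable_funeM.
    - by move: wk; apply: filterS => x + Dx; exact.
  rewrite ge0_integralZl// ?lee_fin ?mulr_ge0 ?exprn_ge0 ?invr_ge0//.
  by rewrite [leRHS]EFinM lee_wpmul2l// lee_fin mulr_ge0// exprn_ge0// invr_ge0.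
have swu k : sqi mu D (fun x => w x - u k x).
  by split => //; apply: le_lt_trans (bk k) _; rewrite ltry.
exists w; split => //.
- have := sqiD mD (swu 0%N) (su 0%N).
  rewrite (_ : (fun x => w x - u 0%N x + u 0%N x) = w)//.
  by apply/funext => x; rewrite subrK.
- have c1 : (fun k => 2^-1 ^+ k * 2 * (2 * C)) @ \oo --> (0 : R).
    rewrite -[X in _ --> X](mul0r (2 * C)); apply: cvgMr_tmp.
    rewrite -[X in _ --> X](mul0r 2); apply: cvgMr_tmp.
    by apply: cvg_expr; rewrite ger0_norm; lra.
  apply: (squeeze_cvgr _ (cvg_cst 0) c1); apply: nearW => k.
  rewrite Rintegral_ge0/=; last by move=> x _; exact: sqr_ge0.
  rewrite (_ : \int[mu]_(x in D) _ = \int[mu]_(x in D) ((w x - u k x) ^+ 2)).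
    by have := bk k; rewrite sqi_EFin// lee_fin.
  by apply: eq_Rintegral => x _; rewrite -sqrrN opprB.
- move=> x ux; apply: wlim.
  by rewrite (_ : u ^~ x = cst 0); [exact: cvg_cst|apply/funext].
Qed.

End sqi_complete.

(** * Lebesgue measure on R^n *)

Section rV_norm.
Context (R : realType) (n : nat).
Implicit Types x : 'rV[R]_n.

Lemma coord_le_norm x i : `|x ord0 i| <= `|x|.
Proof.
rewrite [leRHS]/Num.Def.normr /= mx_normrE; apply/bigmax_geP; right => /=.
by exists (ord0, i).
Qed.

Lemma rV_norm_le x (e : R) : 0 <= e -> (forall i, `|x ord0 i| <= e) -> `|x| <= e.
Proof.
move=> e0 H; rewrite [leLHS]/Num.Def.normr /= mx_normrE; apply/bigmax_leP; split => // -[i j] _ /=.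
by rewrite ord1.
Qed.

Lemma rV_norm_lt x (e : R) : 0 < e -> (forall i, `|x ord0 i| < e) -> `|x| < e.
Proof.
move=> e0 H; rewrite [ltLHS]/Num.Def.normr /= mx_normrE; apply/bigmax_ltP; split => // -[i j] _ /=.
by rewrite ord1.
Qed.

Lemma coord_continuous_rV i : continuous (fun x => x ord0 i : R).
Proof. exact: coord_continuous. Qed.

(** The sigma-algebra is generated by the coordinates, so U is exhausted by the countably many cubes
    with rational centre and radius 1 / (m + 1) that it contains. *)
Lemma open_measurable_rV (U : set 'rV[R]_n) : open U -> measurable U.
Proof.
move=> oU.
pose box (p : 'rV[rat]_n * nat) : set 'rV[R]_n :=
  [set y | forall i, `|y ord0 i - ratr (p.1 ord0 i)| < p.2.+1%:R^-1].
have mbox p : measurable (box p).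
  rewrite (_ : box p = \bigcap_(i in [set: 'I_n])
      ((fun x : 'rV[R]_n => x ord0 i) @^-1` ball (ratr (p.1 ord0 i) : R) p.2.+1%:R^-1)); last first.
    apply/seteqP; split => x /= h i; first by move=> _; rewrite /= /ball /= distrC; exact: h.
    by have := h i Logic.I; rewrite /= /ball /= distrC.
  apply: fin_bigcap_measurable; first exact: finite_finset.
  move=> i _; rewrite -[X in measurable X]setTI.
  apply: measurable_coord => //; exact: measurable_ball.
rewrite (_ : U = \bigcup_(p : 'rV[rat]_n * nat) (if `[< box p `<=` U >] then box p else set0)).
  apply: countable_bigcupT_measurable => [|p]; first exact: countableP.
  by case: asboolP.
apply/seteqP; split => [x Ux|x [p _]]; last by case: asboolP => // + px; exact.
have /nbhs_ballP[e /= e0 xeU] := open_nbhs_nbhs (conj oU Ux).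
pose m := Num.bound (2 / e).
have me : 2 * m.+1%:R^-1 < e.
  rewrite ltr_pdivrMr// mulrC -ltr_pdivrMr//.
  by apply: (lt_le_trans (archi_boundP _)); rewrite ?divr_ge0 ?(ltW e0)// ler_nat leqnSn.
have q_ i : exists q : rat, `|x ord0 i - ratr q| < m.+1%:R^-1.
  have /rat_in_itvoo[q] : x ord0 i - m.+1%:R^-1 < x ord0 i + m.+1%:R^-1.
    by rewrite ltrD2l gt0_cp ?invr_gt0.
  by rewrite in_itv/= => /andP[q1 q2]; exists q; rewrite ltr_norml; apply/andP; move: q1 q2; set w := _^-1 => q1 q2; split; lra.
have [q qx] := choice q_.
exists (\row_i q i, m) => //; case: asboolP => [_ i|]; first by rewrite mxE.
case=> y /= Hy; apply: xeU; rewrite -ball_normE /=.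
apply: rV_norm_lt => // i; rewrite !mxE.
have := Hy i; have := qx i; rewrite mxE => h1 h2.
rewrite (_ : x ord0 i - y ord0 i = (x ord0 i - ratr (q i)) - (y ord0 i - ratr (q i))); last by ring.
by apply: (le_lt_trans (ler_normB _ _)); move: h1 h2 me; set w := _^-1; lra.
Qed.

Lemma closed_measurable_rV (U : set 'rV[R]_n) : closed U -> measurable U.
Proof.
by move=> cU; rewrite -(setCK U); apply: measurableC; apply: open_measurable_rV; exact: closed_openC.
Qed.

Lemma continuous_measurable_rV (f : 'rV[R]_n -> R) : continuous f -> measurable_fun setT f.
Proof.
move=> cf; apply: (measurability _ (RGenOpens.measurableE R)).
move=> _ [_ [a [b ->] <-]]; rewrite setTI; apply: open_measurable_rV.
by move/continuousP : cf; apply; exact: interval_open.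
Qed.

End rV_norm.

Section lebesgue_rV_integral.
Variable R : realType.
Local Notation leb := (@lebesgue_measure R).

Lemma lebesgue_translation (a : R) (A : set R) : measurable A ->
  leb ((fun x => x + a) @^-1` A) = leb A.
Proof.
have ma : measurable_fun [set: measurableTypeR R] (fun x => x + a : measurableTypeR R).
  by apply: measurable_funD.
pose m := measure_function_pushforward__canonical__measure_function_Measure leb ma.
have H : forall X, ocitv X -> leb X = m X; last first.
  by move=> mA; rewrite (lebesgue_measure_unique H mA).
move=> _ [[b c] _ <-].
rewrite /m/= /pushforward (_ : _ @^-1` _ = `]b - a, c - a]%classic); last first.
  by apply/seteqP; split=> x /=; rewrite !in_itv/= => /andP[h1 h2]; apply/andP; split; lra.
rewrite !lebesgue_measure_itv/= !lte_fin ltrD2r; case: ifP => // _.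
by rewrite -!EFinB; congr EFin; ring.
Qed.

Lemma ge0_integral_translation1 (f : R -> \bar R) (a : R) :
  measurable_fun setT f -> (forall x, 0 <= f x)%E ->
  (\int[leb]_x f (x + a)%R = \int[leb]_x f x)%E.
Proof.
move=> mf f0.
have ma : measurable_fun [set: measurableTypeR R] (fun x => x + a : measurableTypeR R).
  by apply: measurable_funD.
have := @ge0_integral_pushforward _ _ _ _ R _ ma leb setT f measurableT mf (fun x _ => f0 x).
rewrite preimage_setT => <-.
by apply: eq_measure_integral => A mA _; rewrite -[RHS](lebesgue_translation a).
Qed.

Variable n : nat.
Local Notation mu := (@lebesgue_rV R n).
Local Notation mu1 := (@lebesgue_rV R n.+1).

Lemma ge0_integral_rV_cons (f : 'rV[R]_n.+1 -> \bar R) :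
  measurable_fun setT f -> (forall x, 0 <= f x)%E ->
  (\int[mu1]_x f x = \int[leb]_s \int[mu]_y f (rV_cons (s, y)))%E.
Proof.
move=> mf f0.
pose lm : {measure set (measurableTypeR R * 'rV[R]_n) -> \bar R} := (leb \x mu)%E.
have mc : measurable_fun [set: measurableTypeR R * 'rV[R]_n] (@rV_cons R n).
  exact: measurable_rV_cons.
rewrite -(@fubini_tonelli1 _ _ (measurableTypeR R) 'rV[R]_n R leb mu (f \o @rV_cons R n)).
- have := @ge0_integral_pushforward _ _ _ _ R _ mc lm setT f measurableT mf (fun x _ => f0 x).
  by rewrite preimage_setT => <-; exact: eq_measure_integral.
- exact: measurableT_comp.
- by move=> x /=.
Qed.

End lebesgue_rV_integral.

(** Induction on the dimension: [lebesgue_rV] is an iterated product, and Tonelli splits the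
    translation into one of the first coordinate and one of the others. *)
Lemma ge0_integral_translation (R : realType) (n : nat) (f : 'rV[R]_n -> \bar R) (a : 'rV[R]_n) :
  measurable_fun setT f -> (forall x, 0 <= f x)%E ->
  (\int[lebesgue_rV]_x f (x + a)%R = \int[lebesgue_rV]_x f x)%E.
Proof.
elim: n f a => [|n IH] f a mf f0.
  by apply: eq_integral => x _; congr f; apply/rowP => -[].
pose a' : 'rV[R]_n := \row_j a ord0 (lift ord0 j).
have mcons s : measurable_fun setT (fun y : 'rV[R]_n => f (rV_cons (s, y))).
  apply: measurableT_comp => //; apply: measurable_fun_rVP => i.
  under eq_fun do rewrite mxE; case: unliftP => [j _|_] /=; last exact: measurable_cst.
  exact: measurable_coord.
have mtr : measurable_fun setT (fun x : 'rV[R]_n.+1 => f (x + a)).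
  apply: measurableT_comp => //; apply: measurable_fun_rVP => i.
  under eq_fun do rewrite mxE; apply: measurable_funD => //; exact: measurable_coord.
rewrite !ge0_integral_rV_cons//.
have E s y : rV_cons (s, y) + a = rV_cons (s + a ord0 ord0, y + a').
  apply/rowP => i; rewrite !mxE; case: unliftP => [j ->|->] //=.
  by rewrite !mxE.
under eq_integral do under eq_integral do rewrite E.
under eq_integral do rewrite (IH (fun y => f (rV_cons (_, y))))//.
apply: (@ge0_integral_translation1 R (fun s => \int[lebesgue_rV]_y f (rV_cons (s, y)))%E).
  apply: (@measurable_fun_fubini_tonelli_F _ _ (measurableTypeR R) 'rV[R]_n R lebesgue_rV
    (f \o @rV_cons R n)); last by move=> x /=.
  by apply: measurableT_comp => //; exact: measurable_rV_cons.
by move=> s; apply: integral_ge0.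
Qed.

(** Half-open, so that the translates by multiples of [h] tile the space without overlap. *)
Definition rV_box (R : realType) (n : nat) (b : 'rV[R]_n) (h : R) : set 'rV[R]_n :=
  [set x | forall i, b ord0 i <= x ord0 i < b ord0 i + h].

Lemma measurable_rV_box (R : realType) (n : nat) (b : 'rV[R]_n) (h : R) :
  measurable (rV_box b h).
Proof.
rewrite (_ : rV_box b h = \bigcap_(i in [set: 'I_n])
    ((fun x : 'rV[R]_n => x ord0 i) @^-1` `[b ord0 i, b ord0 i + h[)); last first.
  apply/seteqP; split => x /= H i; first by move=> _; rewrite /= in_itv/=; exact: H.
  by have := H i Logic.I; rewrite /= in_itv.
apply: fin_bigcap_measurable; first exact: finite_finset.
move=> i _; rewrite -[X in measurable X]setTI.
by apply: measurable_coord.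
Qed.

Lemma lebesgue_rV_box (R : realType) (n : nat) (b : 'rV[R]_n) (h : R) : 0 < h ->
  lebesgue_rV (rV_box b h) = (h ^+ n)%:E.
Proof.
move=> h0; elim: n b => [|n IH] b.
  by rewrite /= diracE mem_set// => -[].
pose b' : 'rV[R]_n := \row_j b ord0 (lift ord0 j).
rewrite /= (_ : _ @^-1` _ = `[b ord0 ord0, b ord0 ord0 + h[ `*` rV_box b' h); last first.
  apply/seteqP; split => -[s y] /=.
  - move=> H; split; first by have := H ord0; rewrite mxE unlift_none in_itv.
    by move=> j; have := H (lift ord0 j); rewrite !mxE liftK.
  - move=> [H1 H2] i; rewrite mxE; case: unliftP => [j ->|->].
      by have := H2 j; rewrite mxE.
    by move: H1; rewrite /= in_itv.
have mI : measurable (`[b ord0 ord0, b ord0 ord0 + h[ : set (measurableTypeR R)).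
  exact: measurable_itv.
rewrite (product_measure1E lebesgue_measure lebesgue_rV mI (measurable_rV_box _ _)).
rewrite [X in (X * _)%E](lebesgue_measure_itv `[b ord0 ord0, b ord0 ord0 + h[) /= lte_fin.
by rewrite ltrDl h0 IH -EFinB -EFinM addrAC subrr add0r exprS.
Qed.

Lemma bounded_lebesgue_rV_lty (R : realType) (n : nat) (A : set 'rV[R]_n) (M : R) :
  measurable A -> (forall x, A x -> forall i, `|x ord0 i| <= M) ->
  (lebesgue_rV A < +oo)%E.
Proof.
move=> mA HA.
apply: (@le_lt_trans _ _ (lebesgue_rV (rV_box (const_mx (- (`|M| + 1)) : 'rV[R]_n) (2 * (`|M| + 1))))).
  apply: le_measure; rewrite ?inE//; first exact: measurable_rV_box.
  move=> x Ax i; rewrite mxE; have := HA _ Ax i; rewrite ler_norml => /andP[h1 h2].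
  by have hM := ler_norm M; apply/andP; split; lra.
by rewrite lebesgue_rV_box ?ltry// mulr_gt0// ltr_wpDl.
Qed.

Lemma open_lebesgue_rV_gt0 (R : realType) (n : nat) (U : set 'rV[R]_n) :
  open U -> U !=set0 -> (0 < lebesgue_rV U)%E.
Proof.
move=> oU [x Ux].
have /nbhs_ballP[e /= e0 xeU] := open_nbhs_nbhs (conj oU Ux).
apply: (@lt_le_trans _ _ (lebesgue_rV (rV_box x (e / 2)))).
  by rewrite lebesgue_rV_box ?divr_gt0// lte_fin exprn_gt0// divr_gt0.
apply: le_measure; rewrite ?inE//; [exact: measurable_rV_box|exact: open_measurable_rV|].
move=> y Hy; apply: xeU; rewrite -ball_normE /=; apply: rV_norm_lt => // i.
by rewrite !mxE ltr_norml; have /andP[h1 h2] := Hy i; apply/andP; split; lra.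
Qed.

Lemma Rintegral_translation (R : realType) (n : nat) (f : 'rV[R]_n -> R) (a : 'rV[R]_n) :
  measurable_fun setT f ->
  \int[lebesgue_rV]_x f (x + a) = \int[lebesgue_rV]_x f x.
Proof.
move=> mf; rewrite /Rintegral [in LHS]integralE [in RHS]integralE.
have mE : measurable_fun setT (EFin \o f) by exact/measurable_EFinP.
rewrite -(@ge0_integral_translation R n (EFin \o f)^\+%E a); last 2 first.
- exact: measurable_funepos.
- by move=> x; exact: funepos_ge0.
rewrite -(@ge0_integral_translation R n (EFin \o f)^\-%E a)//; last exact: measurable_funeneg.
by congr (fine (_ - _)); apply: eq_integral => x _; rewrite ?funeposE ?funenegE.
Qed.

(** * Smooth functions *)

Section smooth.
Context (R : realType) (V : normedModType R).
Implicit Types f g : V -> R.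

Lemma Cinfty_continuous f : Cinfty f -> continuous f.
Proof. by move=> /(_ 0%N)[]. Qed.

Lemma Cinfty_derivable f x v : Cinfty f -> derivable f x v.
Proof. by move=> /(_ 1%N)[_ /(_ v)[]]. Qed.

Lemma Cinfty_derive f v : Cinfty f -> Cinfty ('D_v f).
Proof. by move=> cf k; have [_ /(_ v)[]] := cf k.+1. Qed.

(** [Ck] quantifies over a new direction at every order, so smoothness is proved for a whole class
    at once: it suffices that the class consists of continuous functions and is stable under every
    ['D_v]. *)
Lemma Cinfty_coind (S : (V -> R) -> Prop) :
  (forall f, S f -> continuous f /\
     forall v, (forall x, derivable f x v) /\ S ('D_v f)) ->
  forall f, S f -> Cinfty f.
Proof.
move=> HS f Sf k; elim: k f Sf => [|k IH] f Sf /=; have [cf df] := HS _ Sf; split => //.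
by move=> v; have [dv Sv] := df v; split => //; exact: IH.
Qed.

Lemma Cinfty_cst (c : R) : Cinfty (fun _ : V => c).
Proof.
apply: (@Cinfty_coind (fun f => exists c, f = fun=> c)); last by exists c.
move=> _ [a ->]; split; first by move=> x; exact: cvg_cst.
move=> v; split; first by move=> x; exact: derivable_cst.
by exists 0; apply/funext => x; exact: derive_cst.
Qed.

(** An enlargement for the coinduction: by the sum and product rules, derivatives of members of S
    need only be polynomial expressions in members of S. *)
Inductive ring_closure (S : (V -> R) -> Prop) : (V -> R) -> Prop :=
| ring_closure_base f : S f -> ring_closure S f
| ring_closure_add f g : ring_closure S f -> ring_closure S g ->
    ring_closure S (fun x => f x + g x)
| ring_closure_mul f g : ring_closure S f -> ring_closure S g ->
    ring_closure S (fun x => f x * g x).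

Lemma Cinfty_ring_closure (S : (V -> R) -> Prop) :
  (forall f, S f -> continuous f /\
     forall v, (forall x, derivable f x v) /\ ring_closure S ('D_v f)) ->
  forall f, ring_closure S f -> Cinfty f.
Proof.
move=> HS; apply: Cinfty_coind => f; elim => {f}[f /HS[cf df]//|f g _ [cf df] _ [cg dg]|].
  split=> [x|v]; first by apply: cvgD; [exact: cf|exact: cg].
  have [df1 df2] := df v; have [dg1 dg2] := dg v.
  split=> [x|]; first by apply: derivableD; [exact: df1|exact: dg1].
  rewrite (_ : 'D_v _ = fun x => 'D_v f x + 'D_v g x); first exact: ring_closure_add.
  by apply/funext => x; rewrite deriveD; [|exact: df1|exact: dg1].
move=> f g Sf [cf df] Sg [cg dg].
split=> [x|v]; first by apply: cvgM; [exact: cf|exact: cg].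
have [df1 df2] := df v; have [dg1 dg2] := dg v.
split=> [x|]; first by apply: derivableM; [exact: df1|exact: dg1].
rewrite (_ : 'D_v _ = fun x => f x * 'D_v g x + g x * 'D_v f x).
  by apply: ring_closure_add; apply: ring_closure_mul.
by apply/funext => x; rewrite deriveM; [|exact: df1|exact: dg1].
Qed.

Lemma ring_closure_Cinfty f : ring_closure (@Cinfty R V) f -> Cinfty f.
Proof.
apply: Cinfty_ring_closure => {}f cf; split; first exact: Cinfty_continuous.
by move=> v; split=> [x|]; [exact: Cinfty_derivable|constructor; exact: Cinfty_derive].
Qed.

Lemma CinftyD f g : Cinfty f -> Cinfty g -> Cinfty (fun x => f x + g x).
Proof. by move=> cf cg; apply: ring_closure_Cinfty; do 2 constructor. Qed.

Lemma CinftyM f g : Cinfty f -> Cinfty g -> Cinfty (fun x => f x * g x).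
Proof.
by move=> cf cg; apply: ring_closure_Cinfty; apply: ring_closure_mul; constructor.
Qed.

Lemma CinftyB f g : Cinfty f -> Cinfty g -> Cinfty (fun x => f x - g x).
Proof.
move=> cf cg; rewrite (_ : (fun x => _) = fun x => f x + (-1) * g x).
  by apply: CinftyD => //; apply: CinftyM => //; exact: Cinfty_cst.
by apply/funext => x; rewrite mulN1r.
Qed.

Lemma Cinfty_prod (I : Type) (s : seq I) (F : I -> V -> R) :
  (forall i, Cinfty (F i)) -> Cinfty (fun x => \prod_(i <- s) F i x).
Proof.
move=> cF; elim: s => [|i s IH].
  by under eq_fun do rewrite big_nil; exact: Cinfty_cst.
by under eq_fun do rewrite big_cons; exact: CinftyM.
Qed.

End smooth.

Section affine_comp.
Context (R : realType) (V W : normedModType R) (L L0 : V -> W).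
Hypotheses (cL : continuous L)
  (LE : forall (s : R) v x, L (s *: v + x) = s *: L0 v + L x).
Implicit Type f : W -> R.

Lemma derivable_affine_comp f x v : derivable f (L x) (L0 v) -> derivable (f \o L) x v.
Proof. by rewrite /derivable /=; under [in X in _ -> X]eq_fun do rewrite LE. Qed.

Lemma derive_affine_comp f x v : 'D_v (f \o L) x = 'D_(L0 v) f (L x).
Proof. by rewrite /derive /=; under eq_fun do rewrite LE. Qed.

Lemma Cinfty_affine_comp f : Cinfty f -> Cinfty (f \o L).
Proof.
move=> cf; apply: (@Cinfty_coind _ _ (fun h => exists2 g, Cinfty g & h = g \o L)); last by exists f.
move=> _ [g cg ->]; split.
  by move=> x; apply: continuous_comp; [exact: cL|exact: Cinfty_continuous].
move=> v; split=> [x|]; first by apply: derivable_affine_comp; exact: Cinfty_derivable.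
exists ('D_(L0 v) g); first exact: Cinfty_derive.
by apply/funext => x; exact: derive_affine_comp.
Qed.

End affine_comp.

Section smooth1.
Context (R : realType).
Implicit Types f g h : R -> R.

Lemma is_derive_dir f (x v d : R) : is_derive x 1 f d -> is_derive x v f (v * d).
Proof.
move=> [df <-]; have dfx : differentiable f x by exact/derivable1_diffP.
apply: DeriveDef; first exact: diff_derivable.
rewrite !deriveE// -[in LHS](mulr1 v) -[v * 1]/(v *: (1 : R)).
by rewrite linearZ.
Qed.

Lemma Cinfty1 (S : (R -> R) -> Prop) :
  (forall f, S f -> exists2 g, ring_closure (fun h => S h \/ Cinfty h) g &
     forall x : R, is_derive x 1 f (g x)) ->
  forall f, S f -> Cinfty f.
Proof.
move=> HS f Sf; apply: (@Cinfty_ring_closure _ _ (fun h => S h \/ Cinfty h)); last first.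
  by constructor; left.
move=> {Sf}f [Sf|cf]; last first.
  split; first exact: Cinfty_continuous.
  move=> v; split => [x|]; first exact: Cinfty_derivable.
  by constructor; right; exact: Cinfty_derive.
have [g Sg fg] := HS _ Sf; split.
  move=> x; apply: differentiable_continuous; apply/derivable1_diffP.
  by have [] := fg x.
move=> v; split => [x|]; first by have [] := is_derive_dir v (fg x).
rewrite (_ : 'D_v f = fun x => v * g x).
  by apply: ring_closure_mul => //; constructor; right; exact: Cinfty_cst.
by apply/funext => x; have [] := is_derive_dir v (fg x).
Qed.

Lemma Cinfty_derive1 f (g : R -> R) : Cinfty g -> (forall x : R, is_derive x 1 f (g x)) -> Cinfty f.
Proof.
move=> cg fg; apply: (@Cinfty1 (eq f)) => // _ <-; exists g => //.
by constructor; right.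
Qed.

Lemma Cinfty_id : Cinfty (@id R).
Proof.
exact: (Cinfty_derive1 (Cinfty_cst _ 1) (fun x => is_derive_id x 1)).
Qed.

Lemma Cinfty_is_derive f (x : R) : Cinfty f -> is_derive x 1 f ('D_1 f x).
Proof. by move=> cf; apply: derivableP; exact: Cinfty_derivable. Qed.

Lemma Cinfty_inv f : Cinfty f -> (forall x, f x != 0) -> Cinfty (fun x => (f x)^-1).
Proof.
move=> cf f0; apply: (@Cinfty1 (eq (fun x => (f x)^-1))) => // _ <-.
exists (fun x => (- 'D_1 f x) * ((f x)^-1 * (f x)^-1)).
  apply: ring_closure_mul.
    constructor; right; rewrite (_ : (fun x => _) = fun x => 0 - 'D_1 f x).
      by apply: CinftyB; [exact: Cinfty_cst|exact: Cinfty_derive].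
    by apply/funext => x; rewrite sub0r.
  by apply: ring_closure_mul; constructor; left.
move=> x; have dfx := Cinfty_is_derive x cf.
apply: (is_derive_eq (is_deriveV (f0 x) dfx)).
rewrite /GRing.scale /= expr2 invfM; ring.
Qed.

End smooth1.

(** * Bump functions *)

Section bump.
Context (R : realType).

Lemma pow_expRN_bound (k : nat) : exists2 C : R, 0 <= C &
  forall y : R, 0 <= y -> y ^+ k * expR (- y) <= C.
Proof.
case: k => [|k].
  by exists 1 => // y y0; rewrite expr0 mul1r expR_le1 oppr_le0.
exists k.+1`!%:R => // y y0; have := expR_ge1Dxn k y0.
rewrite expRN ler_pdivrMr ?expR_gt0// => H.
rewrite mulrC -ler_pdivrMr ?ltr0n ?fact_gt0//; apply: le_trans H.
by rewrite lerDr.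
Qed.

Lemma poly_expRN_bound (p : {poly R}) : exists2 C : R, 0 <= C &
  forall y : R, 0 <= y -> `|p.[y]| * expR (- y) <= C.
Proof.
have [C HC] := choice (fun k => let: ex_intro2 C C0 H := pow_expRN_bound k in
  ex_intro (fun C => 0 <= C /\ forall y : R, 0 <= y -> y ^+ k * expR (- y) <= C) C (conj C0 H)).
exists (\sum_(i < size p) `|p`_i| * C i).
  by apply: sumr_ge0 => i _; rewrite mulr_ge0//; case: (HC i).
move=> y y0; rewrite horner_coef.
apply: le_trans (ler_wpM2r (expR_ge0 _) (ler_norm_sum _ _ _)) _.
rewrite mulr_suml; apply: ler_sum => i _.
rewrite normrM normrX (ger0_norm y0) -mulrA ler_wpM2l//.
by case: (HC i) => _; apply.
Qed.

(** The polynomial in 1 / x makes the family of flat functions stable under differentiation. *)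
Definition flat_fun (p : {poly R}) (x : R) : R :=
  if 0 < x then p.[x^-1] * expR (- x^-1) else 0.

Lemma is_derive_flat_fun p (x : R) :
  is_derive x 1 (flat_fun p) (flat_fun ((p - p^`()) * 'X ^+ 2) x).
Proof.
have [x0|x0|->] := ltgtP x 0.
- rewrite {2}/flat_fun ltNge (ltW x0)/=.
  apply: (@near_eq_is_derive _ _ _ (cst 0)).
    near=> y; rewrite /flat_fun ltNge (_ : y <= 0)//.
    by apply: ltW; near: y; exact: lt_nbhsl.
- rewrite {2}/flat_fun x0.
  apply: (@near_eq_is_derive _ _ _ (fun x : R => p.[x^-1] * expR (- x^-1))).
    near=> y; rewrite /flat_fun (_ : 0 < y)//.
    by near: y; exact: lt_nbhsr.
  have xN : x != 0 by rewrite gt_eqF.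
  have di : is_derive x 1 (fun y : R => y^-1) (- x ^- 2).
    by apply: (is_derive_eq (@is_deriveV R id x 1 1 xN _)); rewrite /GRing.scale /= mulr1.
  have dp : is_derive x 1 (fun y : R => p.[y^-1]) (p^`().[x^-1] * (- x ^- 2)).
    exact: (@is_derive1_comp R (horner p) (fun y => y^-1)).
  have dn : is_derive x 1 (fun y : R => - y^-1) (x ^- 2).
    by apply: (is_derive_eq (is_deriveN di)); rewrite opprK.
  have de : is_derive x 1 (fun y : R => expR (- y^-1)) (expR (- x^-1) * x ^- 2).
    exact: (@is_derive1_comp R expR (fun y => - y^-1)).
  apply: (is_derive_eq (is_deriveM dp de)).
  rewrite hornerM hornerXn hornerD hornerN exprVn /GRing.scale /=.
  set e := expR _; set w := x ^- 2; set a := p.[_]; set b := p^`().[_].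
  ring.
have q0 : flat_fun p 0 = 0 by rewrite /flat_fun ltxx.
have r0 : flat_fun ((p - p^`()) * 'X^2) 0 = 0 by rewrite /flat_fun ltxx.
(* With y = 1 / h the difference quotient y p(y) exp(- y) at 0 equals h times y^2 p(y) exp(- y),
   hence the two extra powers: the quotient is O(h). *)
have [C C0 HC] := poly_expRN_bound (p * 'X ^+ 2).
have lim0 : h^-1 *: ((flat_fun p \o shift 0) (h *: 1) - flat_fun p 0) @[h --> 0^'] --> (0 : R).
  apply: norm_cvg0.
  have c0 : C * `|h| @[h --> (0 : R)^'] --> (0 : R).
    rewrite -[X in _ --> X](mulr0 C); apply: cvgM; first exact: cvg_cst.
    rewrite -[X in _ --> X](@normr0 R R); apply: cvg_norm.
    exact: cvg_within.
  apply: (squeeze_cvgr _ (cvg_cst 0) c0); near=> h.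
  rewrite normr_ge0/= q0 subr0 addr0 /GRing.scale /= mulr1 /flat_fun.
  case: ifPn => h0; last by rewrite mulr0 normr0 mulr_ge0.
  have := HC h^-1; rewrite invr_ge0 (ltW h0) => /(_ isT).
  rewrite !hornerE !normrM => H.
  rewrite (ger0_norm (expR_ge0 _)) (gtr0_norm h0) -ler_pdivrMr//.
  apply: le_trans H; rewrite le_eqVlt; apply/orP; left; apply/eqP.
  by rewrite (@ger0_norm _ h^-1) ?invr_ge0 ?(ltW h0)//; set w := h^-1; set e := expR _; ring.
rewrite r0; apply: DeriveDef; first by apply/cvg_ex; exists 0.
exact: cvg_lim lim0.
Unshelve. all: by end_near. Qed.

Lemma Cinfty_flat_fun p : Cinfty (flat_fun p).
Proof.
apply: (@Cinfty1 _ (fun f => exists p, f = flat_fun p)); last by exists p.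
move=> _ [q ->]; exists (flat_fun ((q - q^`()) * 'X ^+ 2)).
  by constructor; left; eexists.
by move=> x; exact: is_derive_flat_fun.
Qed.

Definition flat (x : R) : R := flat_fun 1 x.

Lemma flat_gt0 x : 0 < x -> 0 < flat x.
Proof. by move=> x0; rewrite /flat /flat_fun x0 hornerC mul1r expR_gt0. Qed.

Lemma flat_eq0 x : x <= 0 -> flat x = 0.
Proof. by move=> x0; rewrite /flat /flat_fun ltNge x0. Qed.

Lemma flat_ge0 x : 0 <= flat x.
Proof. by have [/flat_gt0/ltW//|/flat_eq0->] := ltP 0 x. Qed.

Lemma Cinfty_flat_affine (a b : R) : Cinfty (fun x : R => flat (a * x + b)).
Proof.
apply: (@Cinfty_affine_comp R R R (fun x => a * x + b) (fun v => a * v)).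
- move=> x; apply: cvgD; last exact: cvg_cst.
  by apply: cvgM; [exact: cvg_cst|exact: cvg_id].
- by move=> s v x; rewrite /GRing.scale /=; ring.
- exact: Cinfty_flat_fun.
Qed.

Lemma bump_exists (p h : R) : 0 < h -> exists b : R -> R,
  [/\ Cinfty b, b p != 0 & forall x, h <= `|x - p| -> b x = 0].
Proof.
move=> h0; exists (fun x => flat (1 * x + (h - p)) * flat (- 1 * x + (h + p))); split.
- by apply: CinftyM; exact: Cinfty_flat_affine.
- by rewrite mulf_neq0// gt_eqF// flat_gt0//; lra.
- move=> x; rewrite ler_normr => /orP[xp|xp].
    by rewrite (@flat_eq0 (- 1 * x + (h + p))) ?mulr0//; lra.
  by rewrite flat_eq0 ?mul0r//; lra.
Qed.

Lemma cutoff_exists (M : R) : exists chi : R -> R,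
  [/\ Cinfty chi, forall x, `|x| <= M -> chi x = 1 & forall x, M + 1 <= `|x| -> chi x = 0].
Proof.
(* With y = a x + b this is the smooth step flat(y) / (flat(y) + flat(1 - y)), which is 0 for y <= 0
   and 1 for y >= 1. The cutoff is the product of a rising and a falling one. *)
pose s (a b x : R) := flat (a * x + b) * (flat (a * x + b) + flat (- a * x + (1 - b)))^-1.
have den a b x : flat (a * x + b) + flat (- a * x + (1 - b)) != 0.
  rewrite gt_eqF//; have [H|H] := ltP 0 (a * x + b).
    by rewrite ltr_pwDl ?flat_gt0 ?flat_ge0.
  by rewrite ltr_wpDl ?flat_ge0// flat_gt0//; lra.
have cs a b : Cinfty (s a b).
  apply: CinftyM; first exact: Cinfty_flat_affine.
  by apply: Cinfty_inv => //; apply: CinftyD; exact: Cinfty_flat_affine.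
have s1 a b x : 1 <= a * x + b -> s a b x = 1.
  move=> H; have := den a b x; rewrite /s (@flat_eq0 (- a * x + _)); last by lra.
  by rewrite addr0 => ?; rewrite divff.
have s0 a b x : a * x + b <= 0 -> s a b x = 0.
  by move=> H; rewrite /s flat_eq0// mul0r.
exists (fun x => s 1 (M + 1) x * s (- 1) (M + 1) x); split.
- by apply: CinftyM.
- by move=> x; rewrite ler_norml => /andP[h1 h2]; rewrite !s1 ?mulr1//; lra.
- move=> x; rewrite ler_normr => /orP[h|h]; last by rewrite s0 ?mul0r//; lra.
  by rewrite (@s0 (-1)) ?mulr0//; lra.
Qed.

End bump.

(** * Test functions *)

Section test_function_theory.
Context (R : realType) (V : normedModType R) (U : set V).
Implicit Types f g phi psi : V -> R.

Lemma test_Cinfty phi : test_function U phi -> Cinfty phi.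
Proof. by case. Qed.

Lemma test_function_support phi psi : test_function U phi -> Cinfty psi ->
  [set x | psi x != 0] `<=` closure [set x | phi x != 0] -> test_function U psi.
Proof.
move=> [cphi kphi sphi] cpsi sub.
have sub' : closure [set x | psi x != 0] `<=` closure [set x | phi x != 0].
  by rewrite closureE; apply: smallest_sub => //; exact: closed_closure.
split => //; last exact: subset_trans sphi.
by apply: subclosed_compact kphi sub'; exact: closed_closure.
Qed.

Lemma test_function_derive phi v : test_function U phi -> test_function U ('D_v phi).
Proof.
move=> tphi; apply: (test_function_support tphi).
  by apply: Cinfty_derive; exact: test_Cinfty tphi.
move=> x /=; apply: contraPP => nx; apply/negP; rewrite negbK; apply/eqP.
have onx : nbhs x (~` closure [set x | phi x != 0]).
  by apply: open_nbhs_nbhs; split => //; exact: closed_openC (@closed_closure _ _).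
rewrite (@near_eq_derive _ _ _ _ (cst 0)) ?derive_cst//.
move: onx; apply: filterS => y ny; apply/eqP; apply: contrapT => /negP py.
by apply: ny; exact: subset_closure.
Qed.

Lemma test_functionM g phi : Cinfty g -> test_function U phi ->
  test_function U (fun x => g x * phi x).
Proof.
move=> cg tphi; apply: (test_function_support tphi).
  by apply: CinftyM => //; exact: test_Cinfty tphi.
move=> x /= gx; apply: subset_closure => /=.
by apply: contra_neq gx => ->; rewrite mulr0.
Qed.

Lemma test_functionMr g phi : test_function U phi -> Cinfty g ->
  test_function U (fun x => phi x * g x).
Proof.
move=> tphi cg; have := test_functionM cg tphi.
by congr test_function; apply/funext => x; exact: mulrC.
Qed.

Lemma test_function_sqr phi : test_function U phi -> test_function U (fun x => phi x ^+ 2).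
Proof.
move=> tphi; have := test_functionMr tphi (test_Cinfty tphi).
by congr test_function; apply/funext => x; rewrite expr2.
Qed.

Lemma test_functionZ (c : R) phi : test_function U phi -> test_function U (fun x => c * phi x).
Proof. by apply: test_functionM; exact: Cinfty_cst. Qed.

Lemma test_functionD phi psi : test_function U phi -> test_function U psi ->
  test_function U (fun x => phi x + psi x).
Proof.
move=> [c1 k1 s1] [c2 k2 s2].
have sub : closure [set x | phi x + psi x != 0] `<=`
    closure [set x | phi x != 0] `|` closure [set x | psi x != 0].
  rewrite -closureU closureE; apply: smallest_sub; first exact: closed_closure.
  move=> x /= h; apply: subset_closure => /=.
  apply/orP; move: h; apply: contraR; rewrite negb_or !negbK => /andP[/eqP-> /eqP->].
  by rewrite addr0.
split; first exact: CinftyD.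
- apply: subclosed_compact sub; first exact: closed_closure.
  exact: compactU.
- by move=> x /sub[/s1|/s2].
Qed.

Lemma test_functionB phi psi : test_function U phi -> test_function U psi ->
  test_function U (fun x => phi x - psi x).
Proof.
move=> t1 t2; rewrite (_ : (fun x => _) = fun x => phi x + (-1) * psi x).
  by apply: test_functionD => //; exact: test_functionZ.
by apply/funext => x; rewrite mulN1r.
Qed.

Lemma test_function_outside phi x : test_function U phi -> ~ U x -> phi x = 0.
Proof.
move=> [_ _ sphi] Ux; apply/eqP; apply: contrapT => /negP px.
by apply: Ux; apply: sphi; exact: subset_closure.
Qed.

Lemma test_function_bounded phi : test_function U phi -> exists C : R, forall x, `|phi x| <= C.
Proof.
move=> [cphi kphi _].
have /compact_bounded[M [_ HM]] : compact (phi @` closure [set x | phi x != 0]).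
  apply: continuous_compact => //; apply: continuous_subspaceT.
  exact: Cinfty_continuous.
exists (`|M| + 1) => x; have [->|px] := eqVneq (phi x) 0; first by rewrite normr0.
apply: (HM (`|M| + 1)); first by rewrite ltr_pwDr// ler_norm.
by exists x => //; exact: subset_closure.
Qed.

Lemma test_function_bounded_support phi : test_function U phi ->
  exists2 M : R, 0 <= M & forall x, phi x != 0 -> `|x| <= M.
Proof.
move=> [cphi kphi _]; have [M [_ HM]] := compact_bounded kphi.
exists (`|M| + 1) => // x px; apply: HM; last exact: subset_closure.
by rewrite ltr_pwDr// ler_norm.
Qed.

End test_function_theory.

Lemma test_functionS (R : realType) (V : normedModType R) (U U' : set V) (phi : V -> R) :
  U `<=` U' -> test_function U phi -> test_function U' phi.
Proof. by move=> UU' [c k s]; split => //; exact: subset_trans UU'. Qed.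

Section integrable_fun.
Context d (T : measurableType d) (R : realType) (mu : {measure set T -> \bar R}).
Variables (D : set T).
Hypothesis mD : measurable D.
Implicit Types f g : T -> R.

Lemma integrable_funD f g : mu.-integrable D (EFin \o f) -> mu.-integrable D (EFin \o g) ->
  mu.-integrable D (EFin \o (fun x => f x + g x)).
Proof. by move=> fi gi; exact: (integrableD mD fi gi). Qed.

Lemma integrable_funB f g : mu.-integrable D (EFin \o f) -> mu.-integrable D (EFin \o g) ->
  mu.-integrable D (EFin \o (fun x => f x - g x)).
Proof. by move=> fi gi; exact: (integrableB mD fi gi). Qed.

Lemma integrable_funZ (c : R) f : mu.-integrable D (EFin \o f) ->
  mu.-integrable D (EFin \o (fun x => c * f x)).
Proof. by move=> fi; exact: (integrableZl mD c fi). Qed.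

End integrable_fun.

Lemma Rintegral_support d (T : measurableType d) (R : realType)
    (mu : {measure set T -> \bar R}) (D : set T) (f : T -> R) :
  (forall x, ~ D x -> f x = 0) -> \int[mu]_(x in D) f x = \int[mu]_x f x.
Proof.
move=> f0; rewrite Rintegral_mkcond; congr (Rintegral mu setT _); apply/funext => x.
by rewrite patchE; case: ifPn => // /negP; rewrite inE => /f0.
Qed.

Section test_function_integral.
Context (R : realType) (n : nat).
Local Notation mu := (@lebesgue_rV R n).
Implicit Types (f g phi psi : 'rV[R]_n -> R) (U D : set 'rV[R]_n).

Lemma lebesgue_rV_cube_lty (k : nat) : (mu (rV_cube k) < +oo)%E.
Proof.
apply: (@bounded_lebesgue_rV_lty R n (rV_cube k) k%:R); first exact: measurable_rV_cube.
by move=> x Hx i; rewrite ler_norml; have := Hx i; rewrite in_itv.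
Qed.

Lemma norm_le_rV_cube (x : 'rV[R]_n) (M : R) : `|x| <= M -> rV_cube (Num.bound M) x.
Proof.
move=> xM i; rewrite /= in_itv/= -ler_norml.
apply: le_trans (coord_le_norm _ _) _; apply: (le_trans xM).
by apply: ltW; apply: archi_boundP; exact: le_trans xM.
Qed.

Lemma bounded_support_integrable f D (C M : R) : measurable_fun setT f -> measurable D ->
  (forall x, `|f x| <= C) -> (forall x, f x != 0 -> `|x| <= M) ->
  mu.-integrable D (EFin \o f).
Proof.
move=> mf mD fC fM; apply: (@integrableS _ _ _ _ setT) => //.
have mc := @measurable_rV_cube R n (Num.bound M).
have : mu.-integrable (rV_cube (Num.bound M)) (EFin \o f).
  apply: bounded_integrable => //; first exact: lebesgue_rV_cube_lty.
    exact: measurable_funTS.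
  by exists C => x _.
rewrite (integrable_mkcond _ mc) (_ : (EFin \o f) \_ _ = EFin \o f)//.
apply/funext => x; rewrite patchE; case: ifPn => // /negP; rewrite inE => nx /=.
have [->//|/fM xM] := eqVneq (f x) 0; exfalso; apply: nx; exact: norm_le_rV_cube.
Qed.

Lemma test_function_integrable U phi D : test_function U phi -> measurable D ->
  mu.-integrable D (EFin \o phi).
Proof.
move=> tphi mD; have [C HC] := test_function_bounded tphi.
have [M _ HM] := test_function_bounded_support tphi.
apply: (@bounded_support_integrable _ _ C M) => //.
by apply: continuous_measurable_rV; apply: Cinfty_continuous; exact: test_Cinfty tphi.
Qed.

Lemma continuous_line (e x : 'rV[R]_n) : continuous (fun s : R => s *: e + x).
Proof.
by move=> s; apply: cvgD; [apply: cvgZr_tmp; exact: cvg_id|exact: cvg_cst].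
Qed.

Lemma continuous_on_line f (e x : 'rV[R]_n) : continuous f ->
  continuous (fun s : R => f (s *: e + x)).
Proof. by move=> cf s; apply: continuous_comp; [exact: continuous_line|exact: cf]. Qed.

Lemma is_derive_line f (e x : 'rV[R]_n) (s : R) : Cinfty f ->
  is_derive s 1 (fun s => f (s *: e + x)) ('D_e f (s *: e + x)).
Proof.
move=> cf.
have LE (r v y : R) : (r *: v + y) *: e + x = r *: (v *: e) + (y *: e + x).
  by rewrite scalerDl scalerA addrA.
apply: DeriveDef.
  apply: (@derivable_affine_comp R R _ (fun s => s *: e + x) (fun s => s *: e) LE f).
  exact: Cinfty_derivable.
by rewrite -[LHS]/('D_1 (f \o (fun s => s *: e + x)) s) (derive_affine_comp LE) scale1r.
Qed.

(** The difference quotients have integral 0 by translation invariance, and they converge boundedly,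
    with supports in a common cube, to the derivative. Integration by parts in every dimension rests
    on this. *)
Lemma Rintegral_derive0 U phi (e : 'rV[R]_n) : test_function U phi ->
  \int[mu]_x 'D_e phi x = 0.
Proof.
move=> tphi; have cphi := test_Cinfty tphi.
have tD := test_function_derive e tphi.
have [C HC] := test_function_bounded tD.
have [M M0 HM] := test_function_bounded_support tphi.
pose h (k : nat) : R := k.+1%:R^-1.
have h0 k : 0 < h k by rewrite invr_gt0.
have h1 k : h k <= 1 by rewrite invf_le1// ler1n.
pose g k x := (h k)^-1 * (phi (h k *: e + x) - phi x).
have mphi : measurable_fun setT phi.
  by apply: continuous_measurable_rV; exact: Cinfty_continuous.
have mshift k : measurable_fun setT (fun x => phi (h k *: e + x)).
  apply: continuous_measurable_rV => x.
  apply: (@continuous_comp _ _ _ (fun y => h k *: e + y) phi); last exact: Cinfty_continuous.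
  exact: (cvgD (cvg_cst _) cvg_id).
have mg k : measurable_fun setT (g k).
  by apply: measurable_funM => //; exact: measurable_funB.
have gC k x : `|g k x| <= C.
  have [c _] := @MVT_segment R (fun s => phi (s *: e + x)) (fun s => 'D_e phi (s *: e + x))
    0 (h k) (ltW (h0 k)) (fun s _ => is_derive_line e x s cphi)
    (continuous_subspaceT (@continuous_on_line phi e x (Cinfty_continuous cphi))).
  rewrite scale0r add0r subr0 /g => ->.
  by rewrite mulrC mulfK ?gt_eqF.
have gM k x : g k x != 0 -> `|x| <= M + `|e|.
  move=> gx; have [p0|/HM pM] := eqVneq (phi x) 0; last by rewrite (le_trans pM)// lerDl.
  have : phi (h k *: e + x) != 0.
    by apply: contra_neq gx => p1; rewrite /g p0 p1 subrr mulr0.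
  move/HM => pM.
  have -> : x = (h k *: e + x) - h k *: e by rewrite addrAC subrr add0r.
  apply: le_trans (ler_normB _ _) _; apply: lerD => //.
  by rewrite normrZ ger0_norm ?(ltW (h0 k))// ler_piMl.
have ig k : mu.-integrable setT (EFin \o g k).
  exact: (bounded_support_integrable (mg k) measurableT (gC k) (gM k)).
have iphi : mu.-integrable setT (EFin \o phi) by exact: test_function_integrable tphi _.
have ish k : mu.-integrable setT (EFin \o (fun x => phi (h k *: e + x))).
  have [C' HC'] := test_function_bounded tphi.
  apply: (@bounded_support_integrable _ _ C' (M + `|e|)) => // x /HM pM.
  have -> : x = (h k *: e + x) - h k *: e by rewrite addrAC subrr add0r.
  apply: le_trans (ler_normB _ _) _; apply: lerD => //.
  by rewrite normrZ ger0_norm ?(ltW (h0 k))// ler_piMl.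
have Ig k : \int[mu]_x g k x = 0.
  rewrite RintegralZl//; last exact: integrable_funB.
  rewrite RintegralB// [X in _ * (X - _)](_ : _ = \int[mu]_x phi x) ?subrr ?mulr0//.
  rewrite -[RHS](Rintegral_translation (h k *: e))//.
  by apply: eq_Rintegral => x _; rewrite addrC.
have gcvg x : g ^~ x @ \oo --> 'D_e phi x.
  have h0' : h k @[k --> \oo] --> (0 : R)^'.
    move=> P HP; have {}HP : \forall y \near (0 : R), y != 0 -> P y := HP.
    have [N _ HN] := @cvg_harmonic R _ HP; exists N => // k Nk.
    by apply: HN => //=; rewrite gt_eqF// h0.
  exact: (cvg_comp _ _ h0' (Cinfty_derivable (x := x) (v := e) cphi)).
(* The dominating function: the mean value theorem bounds the quotients by C, and steps at most 1
   keep their supports within distance [|e|] of that of phi. *)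
have gi : mu.-integrable setT (fun x => (C * \1_(rV_cube (Num.bound (M + `|e|))) x)%:E).
  have mc := @measurable_rV_cube R n (Num.bound (M + `|e|)).
  apply: (@bounded_support_integrable _ _ `|C| (Num.bound (M + `|e|))%:R) => //.
  - by apply: measurable_funM => //; exact: measurable_indic.
  - by move=> x; rewrite normrM ler_piMr// indicE; case: (_ \in _); rewrite ?normr1 ?normr0.
  - move=> x; rewrite indicE; case: (boolP (_ \in _)) => [/set_mem Hx _|_].
      by apply: rV_norm_le => // i; rewrite ler_norml; have := Hx i; rewrite in_itv.
    by rewrite mulr0 eqxx.
have := @dominated_convergence _ _ _ mu setT measurableT (fun k => EFin \o g k)
  (EFin \o 'D_e phi) _ _ _ _ gi.
move=> [].
- by move=> k; apply/measurable_EFinP.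
- apply/measurable_EFinP; apply: continuous_measurable_rV; apply: Cinfty_continuous.
  exact: test_Cinfty tD.
- by apply: aeW => x _; apply: cvg_EFin; [exact: nearW|exact: gcvg].
- apply: aeW => x k _ /=; rewrite lee_fin.
  have [->|/[dup] gx /gM xM] := eqVneq (g k x) 0.
    by rewrite normr0 mulr_ge0// (le_trans (normr_ge0 _) (HC x)).
  by rewrite indicE mem_set ?mulr1//; exact: norm_le_rV_cube.
move=> _ _; have Ek k : (\int[mu]_x (EFin \o g k) x = 0)%E.
  by rewrite -(fineK (integrable_fin_num measurableT (ig k))) [fine _](Ig k).
rewrite (_ : [sequence _]_ _ = cst 0%E); last exact/funext.
move=> H; rewrite /Rintegral; have <- := cvg_lim (@ereal_hausdorff R) H.
by rewrite lim_cst.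
Qed.

Lemma partial_by_parts U phi g i D : test_function U phi -> Cinfty g -> measurable D ->
  U `<=` D ->
  \int[mu]_(x in D) (g x * partial i phi x) = - \int[mu]_(x in D) (partial i g x * phi x).
Proof.
move=> tphi cg mD UD; pose e : 'rV[R]_n := delta_mx ord0 i.
have cphi := test_Cinfty tphi.
have H0 := Rintegral_derive0 e (test_functionM cg tphi).
have E x : 'D_e (fun x => g x * phi x) x = g x * partial i phi x + partial i g x * phi x.
  by rewrite deriveM; [rewrite /GRing.scale/= [X in _ + X]mulrC|exact: Cinfty_derivable..].
have t1 : test_function U (fun x => g x * partial i phi x).
  by apply: test_functionM => //; exact: test_function_derive.
have t2 : test_function U (fun x => partial i g x * phi x).
  by apply: test_functionM => //; exact: Cinfty_derive.
have out psi : test_function U psi -> forall x, ~ D x -> psi x = 0.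
  by move=> tpsi x nDx; apply: (test_function_outside tpsi) => /UD.
apply/eqP; rewrite -subr_eq0 opprK.
rewrite (Rintegral_support _ (out _ t1)) (Rintegral_support _ (out _ t2)).
rewrite -RintegralD//; [|exact: test_function_integrable t1 _|exact: test_function_integrable t2 _].
by rewrite -H0; apply/eqP; apply: eq_Rintegral => x _; rewrite -E.
Qed.

End test_function_integral.

(** * Rellich compactness *)

Section translation_bound.
Context (R : realType) (n : nat).
Local Notation mu := (@lebesgue_rV R n).
Local Notation leb := (@lebesgue_measure R).
Implicit Types (phi : 'rV[R]_n -> R) (U : set 'rV[R]_n).

(** The increment is the integral of the derivative along the segment, and Cauchy-Schwarz against
    the constant 1 costs the length tau. *)
Lemma sqr_increment_le U phi (e x : 'rV[R]_n) (tau : R) : test_function U phi -> 0 <= tau ->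
  (((phi (tau *: e + x) - phi x) ^+ 2)%:E <=
   tau%:E * \int[leb]_(s in `[0%R, tau]) (('D_e phi (s *: e + x)) ^+ 2)%:E)%E.
Proof.
move=> tphi; rewrite le_eqVlt => /predU1P[<-|tau0].
  by rewrite scale0r add0r subrr expr0n mul0e.
have cphi := test_Cinfty tphi; have tD := test_function_derive e tphi.
have [C HC] := test_function_bounded tD.
pose g (s : R) : R := 'D_e phi (s *: e + x).
have cg : continuous g by exact: (@continuous_on_line R n ('D_e phi) e x (Cinfty_continuous (test_Cinfty tD))).
have mI : measurable (`[0, tau] : set (measurableTypeR R)) by exact: measurable_itv.
have mg : measurable_fun (`[0, tau] : set (measurableTypeR R)) g.
  by apply: measurable_funTS; exact: continuous_measurable_fun.
have lI : leb `[0%R, tau] = tau%:E.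
  by rewrite lebesgue_measure_itv/= lte_fin tau0 -EFinB subr0.
have Ifin : (leb `[0%R, tau] < +oo)%E by rewrite lI ltry.
have sg : sqi leb `[0, tau] g by apply: sqi_bounded => //; exists C => s _; exact: HC.
have s1 : sqi leb `[0, tau] (cst 1) by apply: sqi_bounded => //; exists 1 => s _; rewrite normr1.
have := sqi_cauchy_schwarz mI s1 sg.
have -> : \int[leb]_(s in `[0%R, tau]) (cst 1 s ^+ 2) = tau.
  under eq_Rintegral do rewrite /= expr1n.
  by rewrite Rintegral_cst// mul1r [X in fine X]lI.
have -> : \int[leb]_(s in `[0%R, tau]) (cst 1 s * g s) = phi (tau *: e + x) - phi x.
  under eq_Rintegral do rewrite /= mul1r.
  rewrite /Rintegral (@continuous_FTC2 _ g (fun s => phi (s *: e + x)))//.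
  - by rewrite scale0r add0r.
  - exact: continuous_subspaceT.
  - have cl := @continuous_on_line R n phi e x (Cinfty_continuous cphi).
    split.
    + by move=> s _; have [] := is_derive_line e x s cphi.
    + by apply: cvg_at_right_filter; exact: cl.
    + by apply: cvg_at_left_filter; exact: cl.
  - by move=> s _; rewrite derive1E; have [_ ->] := is_derive_line e x s cphi.
by rewrite sqi_EFin// -EFinM lee_fin.
Qed.

(** Integrates [sqr_increment_le] over x. After Tonelli the inner integral does not depend on s, by
    translation invariance, so the segment contributes a second factor tau. *)
Lemma translation_bound_ge0 U phi (e : 'rV[R]_n) (tau : R) : test_function U phi -> 0 <= tau ->
  (\int[mu]_x ((phi (tau *: e + x) - phi x) ^+ 2)%:E <=
   (tau ^+ 2)%:E * \int[mu]_x (('D_e phi x) ^+ 2)%:E)%E.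
Proof.
move=> tphi tau0.
have cphi := test_Cinfty tphi; have tD := test_function_derive e tphi.
pose g (x : 'rV[R]_n) : R := 'D_e phi x.
have cg : continuous g by exact: Cinfty_continuous (test_Cinfty tD).
have mg : measurable_fun setT g by exact: continuous_measurable_rV.
have mline (s : R) : measurable_fun setT (fun x : 'rV[R]_n => s *: e + x).
  apply: measurable_fun_rVP => i; under eq_fun do rewrite !mxE.
  by apply: measurable_funD => //; exact: measurable_coord.
have mjoint : measurable_fun setT (fun p : 'rV[R]_n * measurableTypeR R => p.2 *: e + p.1).
  apply: measurable_fun_rVP => i; under eq_fun do rewrite !mxE.
  apply: measurable_funD; last exact: (measurableT_comp (@measurable_coord R n i)).
  by apply: measurable_funM => //; exact: measurable_snd.
pose F (p : 'rV[R]_n * measurableTypeR R) : \bar R :=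
  ((g (p.2 *: e + p.1)) ^+ 2 * \1_(`[0%R, tau] : set R) p.2)%:E.
have mI : measurable (`[0, tau] : set (measurableTypeR R)) by exact: measurable_itv.
have mF : measurable_fun setT F.
  apply/measurable_EFinP; apply: measurable_funM.
    by apply: measurable_funX; exact: (measurableT_comp mg).
  by apply: (measurableT_comp (measurable_indic mI)); exact: measurable_snd.
have F0 p : (0 <= F p)%E by rewrite lee_fin mulr_ge0// sqr_ge0.
apply: (@le_trans _ _ (\int[mu]_x (tau%:E * \int[leb]_s F (x, s)))%E).
  apply: ge0_le_integral => //.
  - by move=> x _; rewrite lee_fin sqr_ge0.
  - apply/measurable_EFinP; apply: measurable_funX; apply: measurable_funB.
      by apply: (measurableT_comp _ (mline tau)); apply: continuous_measurable_rV; exact: Cinfty_continuous.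
    by apply: continuous_measurable_rV; exact: Cinfty_continuous.
  - apply: measurable_funeM.
    exact: (@measurable_fun_fubini_tonelli_F _ _ 'rV[R]_n (measurableTypeR R) R leb F).
  - move=> x _; rewrite (le_trans (sqr_increment_le e x tphi tau0))// lee_wpmul2l//.
    rewrite integral_mkcond le_eqVlt; apply/orP; left; apply/eqP.
    apply: eq_integral => s _; rewrite /F /= indicE patchE; case: ifPn => _.
      by rewrite mulr1.
    by rewrite mulr0.
rewrite ge0_integralZl//; last 2 first.
- exact: (@measurable_fun_fubini_tonelli_F _ _ 'rV[R]_n (measurableTypeR R) R leb F).
- by move=> x _; exact: integral_ge0.
rewrite (@fubini_tonelli _ _ 'rV[R]_n (measurableTypeR R) R mu leb F)//.
have -> : (\int[leb]_s \int[mu]_x F (x, s) =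
    \int[leb]_s ((\int[mu]_x ((g x) ^+ 2)%:E) * (\1_(`[0%R, tau] : set R) s)%:E))%E.
  apply: eq_integral => s _; rewrite /F /=.
  under eq_integral do rewrite EFinM.
  have mgs : measurable_fun setT (fun x => ((g (s *: e + x)) ^+ 2)%:E).
    by apply/measurable_EFinP; apply: measurable_funX; exact: (measurableT_comp mg (mline s)).
  rewrite (ge0_integralZr mu measurableT mgs); last 2 first.
  - by move=> x _; rewrite lee_fin sqr_ge0.
  - by rewrite lee_fin.
  have -> : (\int[mu]_x ((g (s *: e + x)) ^+ 2)%:E = \int[mu]_x ((g x) ^+ 2)%:E)%E; last by [].
  rewrite -[RHS](@ge0_integral_translation R n (fun x => ((g x) ^+ 2)%:E) (s *: e)).
  - by apply: eq_integral => x _; rewrite addrC.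
  - by apply/measurable_EFinP; exact: measurable_funX.
  - by move=> x; rewrite lee_fin sqr_ge0.
have I0 : (0 <= \int[mu]_x ((g x) ^+ 2)%:E)%E.
  by apply: integral_ge0 => x _; rewrite lee_fin sqr_ge0.
rewrite ge0_integralZl//.
- have lI : leb `[0%R, tau] = tau%:E.
    rewrite lebesgue_measure_itv/= lte_fin; move: tau0; rewrite le_eqVlt => /predU1P[<-|->].
      by rewrite ltxx.
    by rewrite -EFinB subr0.
  rewrite integral_indic// setIT [X in (_ * (_ * X))%E]lI.
  by rewrite [X in (_ * X)%E]muleC muleA -EFinM -expr2.
- by apply/measurable_EFinP; exact: measurable_indic.
Qed.

End translation_bound.

Section rellich.
Context (R : realType) (n : nat).
Local Notation mu := (@lebesgue_rV R n).
Implicit Types (phi : 'rV[R]_n -> R) (U : set 'rV[R]_n).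

Lemma test_function_sqi U phi (D : set 'rV[R]_n) : test_function U phi -> measurable D -> sqi mu D phi.
Proof.
move=> tphi mD.
have mphi : measurable_fun setT phi.
  by apply: continuous_measurable_rV; exact: Cinfty_continuous (test_Cinfty tphi).
split; first exact: measurable_funTS.
have /integrableP[_] := test_function_integrable (test_functionM (test_Cinfty tphi) tphi) mD.
apply: le_lt_trans; rewrite le_eqVlt; apply/orP; left; apply/eqP.
by apply: eq_integral => x _; rewrite /= -expr2 ger0_norm ?sqr_ge0.
Qed.

Lemma measurable_translation (a : 'rV[R]_n) : measurable_fun setT (fun x : 'rV[R]_n => a + x).
Proof.
apply: measurable_fun_rVP => i; under eq_fun do rewrite !mxE.
by apply: measurable_funD => //; exact: measurable_coord.
Qed.

Lemma ge0_integral_translationl (f : 'rV[R]_n -> \bar R) (a : 'rV[R]_n) :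
  measurable_fun setT f -> (forall x, 0 <= f x)%E ->
  (\int[mu]_x f (a + x)%R = \int[mu]_x f x)%E.
Proof.
move=> mf f0; rewrite -[RHS](ge0_integral_translation a mf f0).
by apply: eq_integral => x _; rewrite addrC.
Qed.

Definition osc phi (z : 'rV[R]_n) : \bar R := (\int[mu]_x ((phi (z + x) - phi x) ^+ 2)%:E)%E.

Lemma measurable_increment phi (z : 'rV[R]_n) : measurable_fun setT phi ->
  measurable_fun setT (fun x => ((phi (z + x) - phi x) ^+ 2)%:E).
Proof.
move=> mphi; apply/measurable_EFinP; apply: measurable_funX; apply: measurable_funB => //.
exact: (measurableT_comp mphi (measurable_translation z)).
Qed.

Lemma oscN phi z : measurable_fun setT phi -> osc phi (- z) = osc phi z.
Proof.
move=> mphi; rewrite /osc -[RHS](ge0_integral_translationl (- z)) //.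
- by apply: eq_integral => x _; rewrite addNKr -sqrrN opprB addrC.
- exact: measurable_increment.
- by move=> x; rewrite lee_fin sqr_ge0.
Qed.

Definition dirichlet phi (i : 'I_n) : R := \int[mu]_x (partial i phi x ^+ 2).

Lemma dirichlet_ge0 phi i : 0 <= dirichlet phi i.
Proof. by apply: Rintegral_ge0 => x _; exact: sqr_ge0. Qed.

Lemma osc_line_le U phi i (t : R) : test_function U phi ->
  (osc phi (t *: delta_mx ord0 i) <= (t ^+ 2 * dirichlet phi i)%:E)%E.
Proof.
move=> tphi; have mphi : measurable_fun setT phi.
  by apply: continuous_measurable_rV; exact: Cinfty_continuous (test_Cinfty tphi).
have tD : test_function U (partial i phi) by exact: test_function_derive.
have -> : osc phi (t *: delta_mx ord0 i) = osc phi (`|t| *: delta_mx ord0 i).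
  by case: (ger0P t) => // _; rewrite scaleNr oscN.
rewrite -(real_normK (num_real t)) EFinM -sqi_EFin//; last exact: test_function_sqi tD _.
by have := translation_bound_ge0 (delta_mx ord0 i) tphi (normr_ge0 t).
Qed.

(** The translation is made one coordinate at a time, and each splitting of a square into two costs
    a factor 2, whence 2^n. *)
Lemma osc_le U phi (z : 'rV[R]_n) (h : R) : test_function U phi ->
  (forall i, `|z ord0 i| <= h) ->
  (osc phi z <= (2 ^+ n * (h ^+ 2 * \sum_i dirichlet phi i))%:E)%E.
Proof.
move=> tphi zh; have mphi : measurable_fun setT phi.
  by apply: continuous_measurable_rV; exact: Cinfty_continuous (test_Cinfty tphi).
rewrite (row_sum_delta z).
suff H (s : seq 'I_n) : (osc phi (\sum_(i <- s) z ord0 i *: delta_mx ord0 i) <=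
    (2 ^+ size s * (h ^+ 2 * \sum_(i <- s) dirichlet phi i))%:E)%E.
  by have := H (index_enum 'I_n); rewrite (_ : size _ = n)// -sum1_size sum_nat_const card_ord muln1.
elim: s => [|i s IH].
  rewrite !big_nil mulr0 mulr0 /osc integral0_eq// => x _.
  by rewrite add0r subrr expr0n.
rewrite !big_cons /=; set v := \sum_(j <- s) _ in IH *; set w := _ *: delta_mx _ _.
have mw : measurable_fun setT (fun x => ((phi (w + (v + x)) - phi (v + x)) ^+ 2)%:E).
  by have := measurableT_comp (measurable_increment w mphi) (measurable_translation v).
have mv := measurable_increment v mphi.
apply: (@le_trans _ _ (2%:E * osc phi w + 2%:E * osc phi v)%E).
  have -> : osc phi w = (\int[mu]_x ((phi (w + (v + x)) - phi (v + x)) ^+ 2)%:E)%E.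
    rewrite /osc -(ge0_integral_translationl v)//; first exact: measurable_increment.
    by move=> x; rewrite lee_fin sqr_ge0.
  rewrite /osc -!ge0_integralZl//; try by move=> x _; rewrite lee_fin sqr_ge0.
  rewrite -ge0_integralD//; try by [exact: measurable_funeM|move=> x _; rewrite -EFinM lee_fin mulr_ge0 ?sqr_ge0].
  apply: ge0_le_integral => //.
  - by move=> x _; rewrite lee_fin sqr_ge0.
  - exact: measurable_increment.
  - by apply: emeasurable_funD; exact: measurable_funeM.
  - move=> x _; rewrite -!EFinM -EFinD lee_fin addrA.
    set a := phi (w + v + x); set b := phi (v + x); set c := phi x.
    have := sqr_ge0 ((a - b) - (b - c)).
    have -> : (a - c) ^+ 2 = 2 * (a - b) ^+ 2 + 2 * (b - c) ^+ 2 - ((a - b) - (b - c)) ^+ 2 by ring.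
    by move=> ?; rewrite gerBl.
apply: (@le_trans _ _ (2%:E * (h ^+ 2 * dirichlet phi i)%:E +
    2%:E * (2 ^+ size s * (h ^+ 2 * \sum_(j <- s) dirichlet phi j))%:E)%E).
  apply: leeD; apply: lee_wpmul2l => //.
  apply: (le_trans (osc_line_le i (z ord0 i) tphi)); rewrite lee_fin.
  apply: ler_wpM2r; first exact: dirichlet_ge0.
  rewrite -(real_normK (num_real (z ord0 i))).
  by rewrite lerXn2r ?nnegrE ?normr_ge0// (le_trans (normr_ge0 _) (zh i)).
rewrite -!EFinM -EFinD lee_fin (exprS 2).
set A := h ^+ 2; set d := dirichlet phi i; set S := \sum_(j <- s) _.
have A0 : 0 <= A by exact: sqr_ge0.
have d0 : 0 <= d by exact: dirichlet_ge0.
have p1 : 1 <= 2 ^+ size s :> R by rewrite exprn_ege1// ler1n.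
have : 0 <= A * d * (2 ^+ size s - 1) by apply: mulr_ge0; [exact: mulr_ge0|rewrite subr_ge0].
set p := 2 ^+ size s; nra.
Qed.

(** * A Poincare inequality on a grid of cells *)

Section cells.
Variables (K : R) (N : nat).
Hypotheses (K0 : 0 < K) (N0 : (0 < N)%N).
Let h : R := 2 * K / N%:R.

Let h0 : 0 < h. Proof. by rewrite /h divr_gt0 ?mulr_gt0 ?ltr0n. Qed.

Definition cell (c : {ffun 'I_n -> 'I_N}) : set 'rV[R]_n :=
  rV_box (\row_i (- K + (c i)%:R * h)) h.

Lemma cell_cover (x : 'rV[R]_n) : (forall i, - K <= x ord0 i < K) -> exists c, cell c x.
Proof.
move=> Hx.
have y0 i : 0 <= (x ord0 i + K) / h.
  by have /andP[h1 _] := Hx i; rewrite divr_ge0 ?(ltW h0)//; lra.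
have lt i : (Num.truncn ((x ord0 i + K) / h) < N)%N.
  have /andP[h1 _] := truncn_itv (y0 i).
  rewrite -(ltr_nat R); apply: (le_lt_trans h1).
  rewrite ltr_pdivrMr// /h mulrC divfK ?gt_eqF ?ltr0n//.
  by have /andP[_ h2] := Hx i; lra.
exists [ffun i => Ordinal (lt i)] => i; rewrite mxE ffunE /=.
have /andP[] := truncn_itv (y0 i); rewrite ler_pdivlMr// ltr_pdivrMr//.
have -> k : k.+1%:R * h = k%:R * h + h by rewrite -natr1 mulrDl mul1r.
move=> h1 h2; apply/andP; split; lra.
Qed.

Lemma cell_inj c c' x : cell c x -> cell c' x -> c = c'.
Proof.
suff H (d d' : {ffun 'I_n -> 'I_N}) i : cell d x -> cell d' x -> (d i <= d' i)%N.
  move=> cx c'x; apply/ffunP => i; apply/val_inj/eqP => /=.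
  by rewrite eqn_leq !H.
move=> /(_ i) /[!mxE] /andP[h1 _] /(_ i) /[!mxE] /andP[_ h2].
rewrite -ltnS -(ltr_nat R) -(ltr_pM2r h0).
have -> k : k.+1%:R * h = k%:R * h + h by rewrite -natr1 mulrDl mul1r.
by move: h1 h2; set a := _ * h; set b := _ * h; lra.
Qed.

Lemma cell_dist c (x y : 'rV[R]_n) : cell c x -> cell c y ->
  rV_box (const_mx (- h)) (2 * h) (y - x).
Proof.
move=> cx cy i; rewrite !mxE; have := cx i; have := cy i; rewrite mxE.
by set a := _ * h => /andP[h1 h2] /andP[h3 h4]; apply/andP; split; lra.
Qed.

Lemma measurable_cell c : measurable (cell c).
Proof. exact: measurable_rV_box. Qed.

Lemma lebesgue_cell c : mu (cell c) = (h ^+ n)%:E.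
Proof. exact: lebesgue_rV_box. Qed.

Lemma ge0_sum_cells (f : 'rV[R]_n -> \bar R) : measurable_fun setT f -> (forall x, 0 <= f x)%E ->
  (\sum_c \int[mu]_(x in cell c) f x <= \int[mu]_x f x)%E.
Proof.
move=> mf f0; rewrite -ge0_integral_bigsetU//.
- apply: ge0_subset_integral => //; apply: bigsetU_measurable => c _; exact: measurable_cell.
- exact: measurable_cell.
- exact: index_enum_uniq.
- by move=> c c' _ _ [x [cx c'x]]; exact: cell_inj cx c'x.
- exact: measurable_funTS.
Qed.

Lemma ge0_sum_cells_eq (f : 'rV[R]_n -> \bar R) : measurable_fun setT f -> (forall x, 0 <= f x)%E ->
  (forall x, f x != 0%E -> forall i, - K <= x ord0 i < K) ->
  (\sum_c \int[mu]_(x in cell c) f x = \int[mu]_x f x)%E.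
Proof.
move=> mf f0 fK; rewrite -ge0_integral_bigsetU//.
- rewrite integral_mkcond; apply: eq_integral => x _; rewrite patchE; case: ifPn => //.
  move=> nx; apply/eqP; apply: contraNT nx; rewrite eq_sym => /fK /cell_cover[c cx].
  by rewrite inE -bigcup_seq; exists c => //=; exact: mem_index_enum.
- exact: measurable_cell.
- exact: index_enum_uniq.
- by move=> c c' _ _ [x [cx c'x]]; exact: cell_inj cx c'x.
- exact: measurable_funTS.
Qed.

(** On a cell C of volume h^n, the double integral of (phi(y) - phi(x))^2 is twice h^n times the
    integral of phi^2, minus twice the squared integral of phi. Two points of a cell differ by a
    vector of a box of side 2 h, so the sum over the cells is at most the integral of [osc] over
    that box, where [osc_le] applies; 2^n (2 h)^n gives 4^n h^n. *)
Lemma poincare_cells U phi : test_function U phi ->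
  (forall x, phi x != 0 -> forall i, - K <= x ord0 i < K) ->
  h ^+ n * \int[mu]_x (phi x ^+ 2) <=
    \sum_c (\int[mu]_(x in cell c) phi x) ^+ 2 +
    4 ^+ n * h ^+ n * (h ^+ 2 * \sum_i dirichlet phi i).
Proof.
move=> tphi phiK.
have mphi : measurable_fun setT phi.
  by apply: continuous_measurable_rV; exact: Cinfty_continuous (test_Cinfty tphi).
pose B : set 'rV[R]_n := rV_box (const_mx (- h)) (2 * h).
have mB : measurable B by exact: measurable_rV_box.
have h2 : 0 < 2 * h by rewrite mulr_gt0.
(* The second variable is the shift y - x rather than y, so that exchanging the integrals yields
   [osc] of the shift. *)
pose F (p : 'rV[R]_n * 'rV[R]_n) : \bar R := (\1_B p.2 * (phi (p.2 + p.1) - phi p.1) ^+ 2)%:E.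
have madd : measurable_fun setT (fun p : 'rV[R]_n * 'rV[R]_n => p.2 + p.1).
  apply: measurable_fun_rVP => i; under eq_fun do rewrite !mxE.
  by apply: measurable_funD; exact: (measurableT_comp (@measurable_coord R n i)).
have mF : measurable_fun setT F.
  apply/measurable_EFinP; apply: measurable_funM.
    by apply: (measurableT_comp (measurable_indic mB)); exact: measurable_snd.
  apply: measurable_funX; apply: measurable_funB; first exact: (measurableT_comp mphi).
  by apply: (measurableT_comp mphi); exact: measurable_fst.
have F0 p : (0 <= F p)%E by rewrite lee_fin mulr_ge0// sqr_ge0.
pose W x : \bar R := (\int[mu]_z F (x, z))%E.
have mW : measurable_fun setT W.
  exact: (@measurable_fun_fubini_tonelli_F _ _ 'rV[R]_n 'rV[R]_n R mu F).
have W0 x : (0 <= W x)%E by exact: integral_ge0.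
set D := h ^+ 2 * \sum_i dirichlet phi i.
have D0 : 0 <= D by rewrite mulr_ge0 ?sqr_ge0// sumr_ge0// => i _; exact: dirichlet_ge0.
have IW : (\int[mu]_x W x <= (2 ^+ n * D * (2 * h) ^+ n)%:E)%E.
  rewrite /W (@fubini_tonelli _ _ 'rV[R]_n 'rV[R]_n R mu mu F)//.
  apply: (@le_trans _ _ (\int[mu]_z ((2 ^+ n * D)%:E * (\1_B z)%:E))%E).
    apply: ge0_le_integral => //.
    - by move=> z _; exact: integral_ge0.
    - exact: (@measurable_fun_fubini_tonelli_G _ _ 'rV[R]_n 'rV[R]_n R mu F).
    - by apply: measurable_funeM; apply/measurable_EFinP; exact: measurable_indic.
    - move=> z _; rewrite /F /= indicE; case: (boolP (z \in B)) => [/set_mem zB|_].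
        rewrite mule1; under eq_integral do rewrite mul1r.
        apply: (osc_le tphi) => i; have := zB i; rewrite mxE => /andP[z1 z2].
        by rewrite ler_norml; apply/andP; split; lra.
      by rewrite mule0; under eq_integral do rewrite mul0r; rewrite integral0.
  rewrite ge0_integralZl//.
  - by rewrite integral_indic// setIT [X in (_ * X)%E]lebesgue_rV_box// -EFinM.
  - by apply/measurable_EFinP; exact: measurable_indic.
  - by rewrite lee_fin mulr_ge0// exprn_ge0.
pose A c := \int[mu]_(x in cell c) phi x.
pose S c := \int[mu]_(x in cell c) (phi x ^+ 2).
have mc c := measurable_cell c.
have iphi c : mu.-integrable (cell c) (EFin \o phi) by exact: test_function_integrable tphi _.
have iphi2 c : mu.-integrable (cell c) (EFin \o (fun x => phi x ^+ 2)).
  by apply: sqi_sqr_integrable => //; exact: test_function_sqi tphi _.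
have icst c (k : R) : mu.-integrable (cell c) (EFin \o (fun=> k)).
  apply: bounded_integrable => //; first by rewrite [ltLHS]lebesgue_cell ltry.
  by exists `|k|.
have Icst c (k : R) : \int[mu]_(x in cell c) k = k * h ^+ n.
  by rewrite Rintegral_cst// [X in fine X]lebesgue_cell.
have inner c x : \int[mu]_(y in cell c) ((phi y - phi x) ^+ 2) =
    h ^+ n * phi x ^+ 2 - 2 * A c * phi x + S c.
  have -> : \int[mu]_(y in cell c) ((phi y - phi x) ^+ 2) =
      \int[mu]_(y in cell c) ((phi y ^+ 2 - (2 * phi x) * phi y) + phi x ^+ 2).
    by apply: eq_Rintegral => y _; ring.
  rewrite RintegralD//; last by apply: integrable_funB => //; exact: integrable_funZ.
  rewrite RintegralB//; last exact: integrable_funZ.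
  by rewrite RintegralZl// Icst /A /S; ring.
have sqd c x : sqi mu (cell c) (fun y => phi y - phi x).
  apply: (@sqiB _ _ _ _ _ (mc c) phi (fun=> phi x)); first exact: test_function_sqi tphi _.
  apply: sqi_bounded => //; first by rewrite [ltLHS]lebesgue_cell ltry.
  by exists `|phi x|.
have innerW c x : cell c x -> ((h ^+ n * phi x ^+ 2 - 2 * A c * phi x + S c)%:E <= W x)%E.
  move=> cx; rewrite -inner -sqi_EFin//.
  pose G y : \bar R := (\1_B (y - x) * (phi y - phi x) ^+ 2)%:E.
  have mG : measurable_fun setT G.
    apply/measurable_EFinP; apply: measurable_funM.
      apply: (measurableT_comp (measurable_indic mB)).
      by rewrite (_ : (fun y => y - x) = (fun y => - x + y)); [exact: measurable_translation|apply/funext => y; rewrite addrC].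
    by apply: measurable_funX; exact: measurable_funB.
  have G0 y : (0 <= G y)%E by rewrite lee_fin mulr_ge0// sqr_ge0.
  have -> : W x = (\int[mu]_y G y)%E.
    rewrite -(ge0_integral_translation x mG G0); apply: eq_integral => z _.
    by rewrite /G addrK.
  apply: (@le_trans _ _ (\int[mu]_(y in cell c) G y)%E); last first.
    by apply: ge0_subset_integral.
  apply: ge0_le_integral => //.
  - by move=> y _; rewrite lee_fin sqr_ge0.
  - by apply/measurable_EFinP; apply: measurable_funX; have [] := sqd c x.
  - exact: measurable_funTS.
  - by move=> y cy; rewrite lee_fin indicE mem_set ?mul1r//; exact: cell_dist cy.
have outer c : ((2 * h ^+ n * S c - 2 * A c ^+ 2)%:E <= \int[mu]_(x in cell c) W x)%E.
  have i1 : mu.-integrable (cell c)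
      (EFin \o (fun x => h ^+ n * phi x ^+ 2 - 2 * A c * phi x + S c)).
    by apply: integrable_funD => //; apply: integrable_funB => //; exact: integrable_funZ.
  have -> : (2 * h ^+ n * S c - 2 * A c ^+ 2)%:E =
      (\int[mu]_(x in cell c) (h ^+ n * phi x ^+ 2 - 2 * A c * phi x + S c)%:E)%E.
    rewrite -[RHS](fineK (integrable_fin_num (mc c) i1)) -[fine _]/(Rintegral _ _ _).
    congr EFin; rewrite RintegralD//; last first.
      by apply: integrable_funB => //; exact: integrable_funZ.
    rewrite RintegralB//; try exact: integrable_funZ.
    by rewrite !RintegralZl// Icst -/(A c) -/(S c); ring.
  apply: ge0_le_integral => //.
  - by move=> x cx; rewrite -inner lee_fin; apply: Rintegral_ge0 => y _; exact: sqr_ge0.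
  - by case/integrableP : i1.
  - exact: measurable_funTS.
  - exact: innerW.
have sumS : \sum_c S c = \int[mu]_x (phi x ^+ 2).
  apply: EFin_inj; rewrite -sumEFin -sqi_EFin//; last exact: test_function_sqi tphi _.
  rewrite -(ge0_sum_cells_eq (f := fun x => ((phi x) ^+ 2)%:E)).
  - by apply: eq_bigr => c _; rewrite sqi_EFin//; exact: test_function_sqi tphi _.
  - by apply/measurable_EFinP; exact: measurable_funX.
  - by move=> x; rewrite lee_fin sqr_ge0.
  - move=> x; rewrite eqe => px; apply: phiK; move: px; apply: contra_neq => ->.
    by rewrite expr0n.
have tot : 2 * h ^+ n * \int[mu]_x (phi x ^+ 2) - 2 * \sum_c A c ^+ 2 <= 2 ^+ n * D * (2 * h) ^+ n.
  rewrite -lee_fin; apply: le_trans IW; apply: le_trans (ge0_sum_cells mW W0).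
  rewrite -sumS !mulr_sumr -sumrB -sumEFin; apply: lee_sum => c _; exact: outer.
have E4 : 2 ^+ n * D * (2 * h) ^+ n = 4 ^+ n * h ^+ n * D.
  have -> : (4 : R) = 2 * 2 by ring.
  by rewrite !exprMn; ring.
move: tot; rewrite E4 -/(A _).
have : 0 <= 4 ^+ n * h ^+ n * D by apply: mulr_ge0 => //; apply: mulr_ge0; apply: exprn_ge0 => //; exact: ltW.
set X := 4 ^+ n * _ * _; rewrite /A; set Y := \sum_c _; set Z := h ^+ n.
set I := \int[mu]_x _; nra.
Qed.

End cells.

End rellich.

(** The image ultrafilter contains a compact segment, hence has a cluster point p. If the set where
    a is e-close to p were not in G, its complement would be, against the choice of p. *)
Lemma ultra_bounded_cauchy (R : realType) (T : Type) (G : set_system T) (a : T -> R) (M : R) :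
  UltraFilter G -> G [set x | `|a x| <= M] -> forall e : R, 0 < e ->
  exists2 p : R, True & G [set x | `|a x - p| < e].
Proof.
move=> UG GM e e0; have FG : ProperFilter G by exact: ultra_proper.
have [p [_ clp]] : `[- M, M]%classic `&` cluster (a @ G) !=set0.
  apply: (@segment_compact R (- M) M (a @ G) _).
  rewrite /fmap/=; apply: filterS GM => x /=; by rewrite ler_norml in_itv.
exists p => //; have [//|H] := in_ultra_setVsetC [set x | `|a x - p| < e] UG.
have [y [/= Hy py]] : [set y | ~ `|y - p| < e] `&` ball p e !=set0.
  by apply: clp => //; exact: nbhsx_ballx.
by exfalso; apply: Hy; rewrite distrC.
Qed.

Section rellich_compactness.
Context (R : realType) (n : nat).
Local Notation mu := (@lebesgue_rV R n).
Implicit Types (phi psi : 'rV[R]_n -> R) (U : set 'rV[R]_n).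

Lemma dirichletB_le U phi psi i : test_function U phi -> test_function U psi ->
  dirichlet (fun x => phi x - psi x) i <= 2 * (dirichlet phi i + dirichlet psi i).
Proof.
move=> t1 t2.
have td (phi' : 'rV[R]_n -> R) : test_function U phi' ->
    mu.-integrable setT (EFin \o (fun x => partial i phi' x ^+ 2)).
  move=> t; apply: sqi_sqr_integrable => //; apply: (@test_function_sqi R n U) => //.
  exact: test_function_derive.
rewrite /dirichlet -RintegralD//; [|exact: td|exact: td].
rewrite -RintegralZl//; last by apply: integrable_funD => //; exact: td.
apply: le_Rintegral => //.
- by apply: td; exact: test_functionB.
- by apply: integrable_funZ => //; apply: integrable_funD => //; exact: td.
move=> x _; rewrite /partial deriveB; [|exact: Cinfty_derivable (test_Cinfty t1)|exact: Cinfty_derivable (test_Cinfty t2)].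
set a := 'D_ _ phi x; set b := 'D_ _ psi x.
have := sqr_ge0 (a + b); have -> : 2 * (a ^+ 2 + b ^+ 2) = (a - b) ^+ 2 + (a + b) ^+ 2 by ring.
by move=> ?; rewrite lerDl.
Qed.

(* Along an ultrafilter the averages over the finitely many cells converge, so
   Rellich's theorem needs no extraction of subsequences. *)
Lemma rellich_ultra U (K M : R) (G : set_system ('rV[R]_n -> R)) : 0 < K -> 0 <= M ->
  (forall x, U x -> forall i, - K <= x ord0 i < K) -> UltraFilter G ->
  G [set phi | [/\ test_function U phi, \int[mu]_x (phi x ^+ 2) <= M &
                  \sum_i dirichlet phi i <= M]] ->
  forall delta : R, 0 < delta -> exists2 A, G A & forall phi psi, A phi -> A psi ->
    \int[mu]_x ((phi x - psi x) ^+ 2) <= delta.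
Proof.
move=> K0 M0 UK UG; set A0 := [set phi | _] => GA0 delta delta0.
have FG : ProperFilter G by exact: ultra_proper.
(* Here 4 M bounds the Dirichlet sum of a difference, so that 4^n h^2 (4 M) = (P - 1) / N^2 <= P /
   N. The choice of N makes this at most delta / 2; the summand 1 keeps P positive. *)
pose P : R := 4 ^+ n * (4 * M) * (2 * K) ^+ 2 + 1.
have P0 : 0 < P.
  by rewrite ltr_wpDl// mulr_ge0 ?sqr_ge0// mulr_ge0 ?exprn_ge0// mulr_ge0.
pose N := (Num.bound (2 * P / delta)).+1.
have N0 : (0 < N)%N by [].
pose h : R := 2 * K / N%:R.
have h0 : 0 < h by rewrite divr_gt0 ?mulr_gt0 ?ltr0n.
have hP : 4 ^+ n * (h ^+ 2 * (4 * M)) <= delta / 2.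
  apply: (@le_trans _ _ (P / N%:R)).
    have -> : 4 ^+ n * (h ^+ 2 * (4 * M)) = (P - 1) / N%:R / N%:R.
      have NR : N%:R != 0 :> R by rewrite pnatr_eq0.
      by rewrite /P /h addrK; move: NR; set m := N%:R => NR; set k := 4 ^+ n; field.
    rewrite ler_pdivrMr ?ltr0n// ler_pdivrMr ?ltr0n//.
    rewrite divfK ?pnatr_eq0//.
    have N1 : 1 <= N%:R :> R by rewrite ler1n.
    by apply: (@le_trans _ _ P); [lra|rewrite ler_peMr// ltW].
  rewrite ler_pdivrMr ?ltr0n// mulrAC ler_pdivlMr// mulrC -ler_pdivrMl//.
  rewrite mulrC; apply: (@le_trans _ _ (Num.bound (2 * P / delta))%:R); last by rewrite ler_nat leqnSn.
  have -> : delta^-1 * (P * 2) = 2 * P / delta by rewrite mulrC (mulrC P).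
  by apply: ltW; apply: archi_boundP; rewrite divr_ge0 ?(ltW delta0)// mulr_ge0// ltW.
pose C : {ffun 'I_n -> 'I_N} -> set 'rV[R]_n := @cell R n K N.
(* [eta2] is the share of each cell when delta / 2 times h^n is divided among fewer than L cells.
   The minimum with 1 in [eta] gives eta^2 <= eta <= eta2, and averages that are eta / 2 close to a
   common value differ by at most eta. *)
pose L : R := #|{ffun 'I_n -> 'I_N}|%:R + 1.
have L0 : 0 < L by rewrite ltr_wpDl.
have hn0 : 0 < h ^+ n by rewrite exprn_gt0.
pose eta2 : R := delta / 2 * h ^+ n / L.
have eta20 : 0 < eta2 by rewrite !divr_gt0 ?mulr_gt0 ?divr_gt0.
pose eta := Num.min 1 eta2.
have eta0 : 0 < eta by rewrite lt_min ltr01.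
have etaE : eta ^+ 2 <= eta2.
  have e1 : eta <= 1 by rewrite ge_min lexx.
  have e2 : eta <= eta2 by rewrite ge_min lexx orbT.
  by rewrite expr2; apply: le_trans e2; rewrite ler_piMr// ltW.
have mC c : measurable (C c) by exact: measurable_rV_box.
have avg_le phi c : A0 phi -> `|\int[mu]_(x in C c) phi x| <= h ^+ n * M + 1.
  move=> [tphi Mphi _].
  have s1 : sqi mu (C c) (cst 1).
    apply: sqi_bounded => //; first by rewrite [ltLHS](lebesgue_cell K0 N0) ltry.
    by exists 1 => x _; rewrite normr1.
  have := sqi_cauchy_schwarz (mC c) s1 (test_function_sqi tphi (mC c)).
  have -> : \int[mu]_(x in C c) (cst 1 x ^+ 2) = h ^+ n.
    under eq_Rintegral do rewrite /= expr1n.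
    by rewrite Rintegral_cst// mul1r [X in fine X](lebesgue_cell K0 N0).
  have -> : \int[mu]_(x in C c) (cst 1 x * phi x) = \int[mu]_(x in C c) phi x.
    by apply: eq_Rintegral => x _; rewrite mul1r.
  have S1 : \int[mu]_(x in C c) (phi x ^+ 2) <= M.
    apply: le_trans Mphi; rewrite -lee_fin -!sqi_EFin//; try exact: test_function_sqi tphi _.
    apply: ge0_subset_integral => //.
    - apply/measurable_EFinP; apply: measurable_funX; apply: continuous_measurable_rV.
      exact: Cinfty_continuous (test_Cinfty tphi).
    - by move=> x _; rewrite lee_fin sqr_ge0.
  set a := \int[mu]_(x in C c) phi x => H.
  have {}H : `|a| ^+ 2 <= h ^+ n * M.
    by rewrite real_normK ?num_real//; apply: (le_trans H); rewrite ler_wpM2l// ltW.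
  have := sqr_ge0 (`|a| - 1); rewrite sqrrB; move: H; set b := `|a| ^+ 2.
  have := normr_ge0 a; rewrite /b; set s := `|a|; nra.
have near_c c : exists p : R, G [set phi | `|\int[mu]_(x in C c) phi x - p| < eta / 2].
  have e2 : 0 < eta / 2 by rewrite divr_gt0.
  have GC : G [set phi | `|\int[mu]_(x in C c) phi x| <= h ^+ n * M + 1].
    by apply: filterS GA0 => phi Aphi; exact: avg_le.
  by have [p _ Gp] := ultra_bounded_cauchy UG GC e2; exists p.
have [p Gp] := choice near_c.
exists (A0 `&` [set phi | forall c, `|\int[mu]_(x in C c) phi x - p c| < eta / 2]).
  by apply: filterI => //; apply: filter_forall => c; exact: Gp.
move=> phi psi [[t1 _ D1] p1] [[t2 _ D2] p2].
have t12 := test_functionB t1 t2.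
have := poincare_cells K0 N0 t12.
rewrite -/h; set I := \int[mu]_x _ => H; have {}H := H _.
have {H} : h ^+ n * I <= \sum_(c : {ffun 'I_n -> 'I_N}) (\int[mu]_(x in C c) (phi x - psi x)) ^+ 2 +
   4 ^+ n * h ^+ n * (h ^+ 2 * \sum_i dirichlet (fun x => phi x - psi x) i).
  apply: H => x; apply: contra_neqP => nUx.
  by apply: (test_function_outside t12) => Ux; apply: nUx; exact: UK.
have S1 : \sum_(c : {ffun 'I_n -> 'I_N}) (\int[mu]_(x in C c) (phi x - psi x)) ^+ 2 <= delta / 2 * h ^+ n.
  apply: (@le_trans _ _ (\sum_(c : {ffun 'I_n -> 'I_N}) eta2)).
    apply: ler_sum => c _; apply: le_trans etaE.
    rewrite RintegralB//; [|exact: test_function_integrable t1 _|exact: test_function_integrable t2 _].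
    have := p1 c; have := p2 c; set a := \int[mu]_(x in C c) phi x; set b := \int[mu]_(x in C c) psi x.
    move=> hb ha; rewrite -(real_normK (num_real (a - b))) lerXn2r ?nnegrE ?(ltW eta0)//.
    have -> : a - b = (a - p c) - (b - p c) by ring.
    by apply: (le_trans (ler_normB _ _)); rewrite (splitr eta); apply: lerD; exact: ltW.
  rewrite sumr_const -(mulr_natl eta2).
  apply: (@le_trans _ _ (L * eta2)); first by rewrite ler_wpM2r ?(ltW eta20)// lerDl.
  by rewrite mulrC divfK// gt_eqF.
have S2 : \sum_i dirichlet (fun x => phi x - psi x) i <= 4 * M.
  apply: (@le_trans _ _ (\sum_i 2 * (dirichlet phi i + dirichlet psi i))).
    by apply: ler_sum => i _; exact: dirichletB_le t1 t2.
  rewrite -mulr_sumr big_split /= (_ : 4 * M = 2 * (M + M)); last by ring.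
  by apply: ler_wpM2l; [exact: ler0n|exact: (lerD D1 D2)].
move=> H; rewrite -(ler_pM2l hn0); apply: (le_trans H).
have S3 : 4 ^+ n * h ^+ n * (h ^+ 2 * \sum_i dirichlet (fun x => phi x - psi x) i) <=
    h ^+ n * (delta / 2).
  rewrite mulrAC mulrC; apply: ler_wpM2l; first exact: ltW.
  apply: le_trans hP; apply: ler_wpM2l; first by rewrite exprn_ge0.
  by apply: ler_wpM2l => //; exact: sqr_ge0.
have -> : h ^+ n * delta = delta / 2 * h ^+ n + h ^+ n * (delta / 2) by set w := h ^+ n; field.
exact: (lerD S1 S3).
Qed.

End rellich_compactness.

(** * Symmetric bilinear forms on a class of functions *)

Section quadratic_form.
Context (R : realType) (T : Type) (S : set (T -> R)) (b : (T -> R) -> (T -> R) -> R).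
Hypotheses (SD : forall f g, S f -> S g -> S (fun x => f x + g x))
  (SZ : forall c f, S f -> S (fun x => c * f x))
  (bC : forall f g, S f -> S g -> b f g = b g f)
  (bD : forall f g k, S f -> S g -> S k -> b (fun x => f x + g x) k = b f k + b g k)
  (bZ : forall c f k, S f -> S k -> b (fun x => c * f x) k = c * b f k).

Lemma quadratic_expand f g (t : R) : S f -> S g ->
  b (fun x => f x + t * g x) (fun x => f x + t * g x) = b f f + 2 * t * b f g + t ^+ 2 * b g g.
Proof.
move=> Sf Sg; have Stg := SZ t Sg; have Sftg := SD Sf Stg.
rewrite bD// [b f _]bC// [b (fun x => t * g x) _]bC// !bD// !bZ// (bC Sf Stg) !bZ//.
rewrite (bC Sg Stg) bZ// (bC Sg Sf); ring.
Qed.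

Lemma quadratic_sub f g : S f -> S g ->
  b (fun x => f x - g x) (fun x => f x - g x) = b f f - 2 * b f g + b g g.
Proof.
move=> Sf Sg; rewrite (_ : (fun x => f x - g x) = (fun x => f x + (- 1) * g x)).
  by rewrite quadratic_expand//; ring.
by apply/funext => x; rewrite mulN1r.
Qed.

Lemma quadratic_add f g : S f -> S g ->
  b (fun x => f x + g x) (fun x => f x + g x) = b f f + 2 * b f g + b g g.
Proof.
move=> Sf Sg; rewrite (_ : (fun x => f x + g x) = (fun x => f x + 1 * g x)).
  by rewrite quadratic_expand//; ring.
by apply/funext => x; rewrite mul1r.
Qed.

Lemma quadratic_cauchy_schwarz f g : (forall k, S k -> 0 <= b k k) -> S f -> S g ->
  b f g ^+ 2 <= b f f * b g g.
Proof.
move=> b0 Sf Sg; apply: discr_le0; first exact: b0.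
by move=> t; rewrite -quadratic_expand//; apply: b0; apply: SD => //; exact: SZ.
Qed.

End quadratic_form.

(** * Ground states *)

(** A product of one-variable bumps is supported in a cube around p, and a cube is a ball of the sup
    norm. *)
Lemma test_bump (R : realType) (n : nat) (U : set 'rV[R]_n) (p : 'rV[R]_n) : open U -> U p ->
  exists2 phi, test_function U phi & phi p != 0.
Proof.
move=> oU Up; have /nbhs_ballP[e /= e0 peU] := open_nbhs_nbhs (conj oU Up).
pose h := e / 2; have h0 : 0 < h by rewrite divr_gt0.
have [b Hb] := choice (fun i => bump_exists (p ord0 i) h0).
pose phi (x : 'rV[R]_n) := \prod_(i < n) b i (x ord0 i).
pose B : set 'rV[R]_n := [set x | forall i, `|x ord0 i - p ord0 i| <= h].
have clB : closed B.
  rewrite (_ : B = \bigcap_(i in [set: 'I_n])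
      ((fun x : 'rV[R]_n => `|x ord0 i - p ord0 i|) @^-1` [set t | t <= h])); last first.
    by apply/seteqP; split => x /= H i; [move=> _; exact: H|exact: (H i Logic.I)].
  apply: closed_bigI => i _; apply: closed_comp; last exact: closed_le.
  move=> x _; apply: (@continuous_comp _ _ _ (fun x : 'rV[R]_n => x ord0 i - p ord0 i)).
    exact: (cvgB (@coord_continuous_rV R n i x) (cvg_cst _)).
  exact: norm_continuous.
have sub : closure [set x | phi x != 0] `<=` B.
  rewrite closureE; apply: smallest_sub => //.
  move=> x /= + i; apply: contraR; rewrite -ltNge => Hi; apply/eqP.
  by rewrite /phi (bigD1 i)//=; case: (Hb i) => _ _ ->; rewrite ?mul0r// ltW.
exists phi; last first.
  by apply/prodf_neq0 => i _; case: (Hb i).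
split.
- apply: Cinfty_prod => i.
  apply: (@Cinfty_affine_comp _ _ _ (fun x : 'rV[R]_n => x ord0 i) (fun x => x ord0 i) _ _ (b i)).
  + exact: coord_continuous_rV.
  + by move=> s v x; rewrite !mxE.
  + by case: (Hb i).
- apply: bounded_closed_compact; last exact: closed_closure.
  exists (`|p| + h); split; first exact: num_real.
  move=> M pM x /sub Hx; apply: le_trans (ltW pM).
  rewrite -[x](subrK p) [leRHS]addrC; apply: le_trans (ler_normD _ _) _; rewrite lerD2r.
  by apply: rV_norm_le; [exact: ltW|move=> i; rewrite !mxE].
- move=> x /sub Hx; apply: peU; rewrite -ball_normE /=.
  apply: (@le_lt_trans _ _ h); last by rewrite /h; lra.
  by apply: rV_norm_le; [exact: ltW|move=> i; rewrite !mxE distrC].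
Qed.

(* Locked: unification would otherwise unfold integrals when comparing terms. *)
HB.lock Definition wip d (T : measurableType d) (R : realType) (mu : {measure set T -> \bar R})
  (D : set T) (h f g : T -> R) : R := \int[mu]_(x in D) (h x * (f x * g x)).

Section weighted_product.
Context d (T : measurableType d) (R : realType).
Variables (mu : {measure set T -> \bar R}) (D : set T).
Hypothesis mD : measurable D.
Implicit Types f g h : T -> R.

Definition bounded_measurable h := measurable_fun D h /\ exists C : R, forall x, D x -> `|h x| <= C.

Local Notation wip := (wip mu D).

Lemma bounded_measurableM h k : bounded_measurable h -> bounded_measurable k ->
  bounded_measurable (fun x => h x * k x).
Proof.
move=> [mh [C HC]] [mk [C' HC']]; split; first exact: measurable_funM.
by exists (C * C') => x Dx; rewrite normrM ler_pM// ?HC ?HC'.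
Qed.

Lemma wip_integrable h f g : bounded_measurable h -> sqi mu D f -> sqi mu D g ->
  mu.-integrable D (EFin \o (fun x => h x * (f x * g x))).
Proof.
move=> [mh bh] sf sg; have := sqi_mul mD (sqiM_bounded mD sf mh bh) sg.
by apply: eq_integrable => // x _ /=; rewrite mulrA.
Qed.

Lemma wipC h f g : wip h f g = wip h g f.
Proof. by rewrite wip.unlock; apply: eq_Rintegral => x _; rewrite (mulrC (f x)). Qed.

Lemma wipDl h f1 f2 g : bounded_measurable h -> sqi mu D f1 -> sqi mu D f2 -> sqi mu D g ->
  wip h (fun x => f1 x + f2 x) g = wip h f1 g + wip h f2 g.
Proof.
move=> bh s1 s2 sg; rewrite wip.unlock -RintegralD//; try exact: wip_integrable.
by apply: eq_Rintegral => x _; ring.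
Qed.

Lemma wipZl h (c : R) f g : bounded_measurable h -> sqi mu D f -> sqi mu D g ->
  wip h (fun x => c * f x) g = c * wip h f g.
Proof.
move=> bh sf sg; rewrite wip.unlock -RintegralZl//; last exact: wip_integrable.
by apply: eq_Rintegral => x _; ring.
Qed.

Lemma wip_le h k f : bounded_measurable h -> bounded_measurable k -> sqi mu D f ->
  (forall x, D x -> h x <= k x) -> wip h f f <= wip k f f.
Proof.
move=> bh bk sf hk; rewrite wip.unlock; apply: le_Rintegral => //; try exact: wip_integrable.
by move=> x Dx; rewrite -expr2 ler_wpM2r ?sqr_ge0 ?hk.
Qed.

Lemma wip_cst (c : R) f : sqi mu D f -> wip (fun=> c) f f = c * \int[mu]_(x in D) (f x ^+ 2).
Proof.
move=> sf; rewrite wip.unlock -RintegralZl//; last exact: sqi_sqr_integrable.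
Qed.

Lemma bounded_measurable_cst (c : R) : bounded_measurable (fun=> c).
Proof. by split => //; exists `|c|. Qed.

Lemma cvg_wip h u f g : bounded_measurable h -> (forall k, sqi mu D (u k)) -> sqi mu D f ->
  sqi mu D g -> cvg_sqi mu D u f -> wip h (u k) g @[k --> \oo] --> wip h f g.
Proof.
move=> [mh bh] su sf sg uf.
have E (k : T -> R) : wip h k g = \int[mu]_(x in D) (k x * (h x * g x)).
  by rewrite wip.unlock; apply: eq_Rintegral => x _; ring.
rewrite E (_ : (fun k => _) = fun k => \int[mu]_(x in D) (u k x * (h x * g x))).
  by apply: cvg_sqi_mul => //; exact: sqiM_bounded.
by apply/funext => k; rewrite E.
Qed.

Lemma wip_scale (c : R) h f : bounded_measurable h -> sqi mu D f ->
  wip (fun x => c * h x) f f = c * wip h f f.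
Proof.
move=> bh sf; rewrite wip.unlock -RintegralZl//; last exact: wip_integrable.
by apply: eq_Rintegral => x _; rewrite [RHS]mulrA.
Qed.

End weighted_product.
Arguments bounded_measurable {d T R} D h.

Section partial_linear.
Context (R : realType) (n : nat).
Implicit Types phi psi : 'rV[R]_n -> R.

Lemma partialD phi psi i : Cinfty phi -> Cinfty psi ->
  partial i (fun x => phi x + psi x) = (fun x => partial i phi x + partial i psi x).
Proof. by move=> c1 c2; apply/funext => x; rewrite /partial deriveD//; exact: Cinfty_derivable. Qed.

Lemma partialZ (c : R) phi i : Cinfty phi ->
  partial i (fun x => c * phi x) = (fun x => c * partial i phi x).
Proof.
by move=> c1; apply/funext => x; rewrite /partial deriveZ//; exact: Cinfty_derivable.
Qed.

Lemma partialB phi psi i : Cinfty phi -> Cinfty psi ->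
  partial i (fun x => phi x - psi x) = (fun x => partial i phi x - partial i psi x).
Proof. by move=> c1 c2; apply/funext => x; rewrite /partial deriveB//; exact: Cinfty_derivable. Qed.

End partial_linear.

Lemma parallelogram_arith (R : realFieldType) (a b c m e E : R) :
  a <= E + e -> b <= E + e -> E * (1 + 2 * m + 1) <= a + 2 * c + b ->
  a - 2 * c + b <= 4 * e + E * (1 - 2 * m + 1).
Proof. nra. Qed.

Section ground_state.
Context (R : realType) (n : nat).
Local Notation mu := (@lebesgue_rV R n).
Variables (Omega : set 'rV[R]_n) (K : R) (r q : 'rV[R]_n -> R) (rM qM eps : R).
Hypotheses (oO : open Omega) (O0 : Omega !=set0) (K0 : 0 < K)
  (OK : forall x, Omega x -> forall i, - K <= x ord0 i < K)
  (mr : measurable_fun setT r) (r1 : forall x, Omega x -> 1 <= r x <= rM)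
  (mq : measurable_fun setT q) (qb : forall x, Omega x -> `|q x| <= qM) (eps0 : 0 < eps).
Implicit Types phi psi chi : 'rV[R]_n -> R.

Let mO : measurable Omega. Proof. exact: open_measurable_rV. Qed.

Definition mass phi psi : R := wip mu Omega r phi psi.

Definition energy phi psi : R :=
  eps * \sum_i wip mu Omega r (partial i phi) (partial i psi) -
  wip mu Omega (fun x => r x * q x) phi psi.

Let br : bounded_measurable Omega r.
Proof.
split; first exact: measurable_funTS.
exists rM => x Ox; have /andP[h1 h2] := r1 Ox.
by rewrite ger0_norm// (le_trans _ h1).
Qed.

Let bq : bounded_measurable Omega q.
Proof. by split; [exact: measurable_funTS|exists qM]. Qed.

Let brq : bounded_measurable Omega (fun x => r x * q x).
Proof. exact: bounded_measurableM. Qed.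

Let tsqi phi : test_function Omega phi -> sqi mu Omega phi.
Proof. by move=> t; exact: test_function_sqi t mO. Qed.

Let tpart phi i : test_function Omega phi -> test_function Omega (partial i phi).
Proof. exact: test_function_derive. Qed.

Let tpsqi phi i : test_function Omega phi -> sqi mu Omega (partial i phi).
Proof. by move=> t; apply: tsqi; exact: tpart. Qed.

Lemma mass_sym phi psi : mass phi psi = mass psi phi.
Proof. exact: wipC. Qed.

Lemma energy_sym phi psi : energy phi psi = energy psi phi.
Proof.
apply: (f_equal2 (fun a c => eps * a - c)); last exact: wipC.
by apply: eq_bigr => i _; exact: wipC.
Qed.

Lemma massD phi psi chi : test_function Omega phi -> test_function Omega psi ->
  test_function Omega chi -> mass (fun x => phi x + psi x) chi = mass phi chi + mass psi chi.
Proof. by move=> t1 t2 t3; apply: wipDl => //; exact: tsqi. Qed.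

Lemma massZ (c : R) phi chi : test_function Omega phi ->
  test_function Omega chi -> mass (fun x => c * phi x) chi = c * mass phi chi.
Proof. by move=> t1 t3; apply: wipZl => //; exact: tsqi. Qed.

Lemma energyD phi psi chi : test_function Omega phi -> test_function Omega psi ->
  test_function Omega chi -> energy (fun x => phi x + psi x) chi = energy phi chi + energy psi chi.
Proof.
move=> t1 t2 t3.
have E i : wip mu Omega r (partial i (fun x => phi x + psi x)) (partial i chi) =
    wip mu Omega r (partial i phi) (partial i chi) + wip mu Omega r (partial i psi) (partial i chi).
  by rewrite (partialD i (test_Cinfty t1) (test_Cinfty t2)); apply: wipDl => //; exact: tpsqi.
rewrite /energy (eq_bigr _ (fun i _ => E i)) big_split /=.
rewrite (wipDl mO brq (tsqi t1) (tsqi t2) (tsqi t3)).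
set a := \sum_i _; set b := \sum_i _; set c := wip _ _ _ _ _; set d := wip _ _ _ _ _; ring.
Qed.

Lemma energyZ (c : R) phi chi : test_function Omega phi ->
  test_function Omega chi -> energy (fun x => c * phi x) chi = c * energy phi chi.
Proof.
move=> t1 t3.
have E i : wip mu Omega r (partial i (fun x => c * phi x)) (partial i chi) =
    c * wip mu Omega r (partial i phi) (partial i chi).
  by rewrite (partialZ c i (test_Cinfty t1)); apply: wipZl => //; exact: tpsqi.
rewrite /energy (eq_bigr _ (fun i _ => E i)) -mulr_sumr.
rewrite (wipZl mO c brq (tsqi t1) (tsqi t3)).
set a := \sum_i _; set d := wip _ _ _ _ _; ring.
Qed.

Lemma sqr_le_mass phi : test_function Omega phi -> \int[mu]_(x in Omega) (phi x ^+ 2) <= mass phi phi.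
Proof.
move=> t; rewrite -[leLHS]mul1r -wip_cst//; last exact: tsqi.
apply: wip_le => //; [exact: bounded_measurable_cst|exact: tsqi|].
by move=> x /r1/andP[].
Qed.

Lemma mass_le_sqr phi : test_function Omega phi -> mass phi phi <= rM * \int[mu]_(x in Omega) (phi x ^+ 2).
Proof.
move=> t; rewrite -wip_cst//; last exact: tsqi.
apply: wip_le => //; [exact: bounded_measurable_cst|exact: tsqi|].
by move=> x /r1/andP[].
Qed.

Lemma mass_ge0 phi : test_function Omega phi -> 0 <= mass phi phi.
Proof.
by move=> t; apply: le_trans (sqr_le_mass t); apply: Rintegral_ge0 => x _; exact: sqr_ge0.
Qed.

Lemma potential_le_mass phi : test_function Omega phi ->
  `|wip mu Omega (fun x => r x * q x) phi phi| <= qM * mass phi phi.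
Proof.
move=> t; have s := tsqi t.
have bz c : bounded_measurable Omega (fun x => c * r x).
  by apply: bounded_measurableM => //; exact: bounded_measurable_cst.
have E c : wip mu Omega (fun x => c * r x) phi phi = c * mass phi phi by exact: wip_scale.
have qx x : Omega x -> - qM * r x <= r x * q x <= qM * r x.
  move=> Ox; have /andP[h1 _] := r1 Ox; have := qb Ox; rewrite ler_norml => /andP[q1 q2].
  have r0 : 0 <= r x by rewrite (le_trans _ h1).
  by rewrite (mulrC (- qM)) (mulrC qM) !ler_wpM2l.
rewrite ler_norml -mulNr -(E (- qM)) -(E qM).
by apply/andP; split; apply: wip_le => // x /qx/andP[].
Qed.

Lemma dirichlet_le_energy phi : test_function Omega phi ->
  eps * \sum_i \int[mu]_(x in Omega) (partial i phi x ^+ 2) <= energy phi phi + qM * mass phi phi.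
Proof.
move=> t; have := potential_le_mass t; rewrite ler_norml => /andP[_ H].
rewrite /energy; set V := wip _ _ (fun x => r x * q x) _ _ in H *.
rewrite -addrA -[leLHS]addr0; apply: lerD; last by rewrite addrC subr_ge0.
rewrite ler_wpM2l ?(ltW eps0)//; apply: ler_sum => i _.
exact: (sqr_le_mass (tpart i t)).
Qed.

Lemma mass_gt0 phi p : test_function Omega phi -> phi p != 0 -> 0 < mass phi phi.
Proof.
move=> t pN; apply: lt_le_trans (sqr_le_mass t).
have cphi := Cinfty_continuous (test_Cinfty t).
pose c := phi p ^+ 2 / 2.
have p0 : 0 < phi p ^+ 2 by rewrite exprn_even_gt0.
have c0 : 0 < c by rewrite divr_gt0.
pose U : set 'rV[R]_n := (fun x => phi x ^+ 2) @^-1` [set y | c < y].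
have oU : open U.
  apply: open_comp; last exact: open_gt.
  by move=> x _; exact: (cvgM (cphi x) (cphi x)).
have Up : U p by rewrite /U /= /c; lra.
have mU := open_measurable_rV oU.
have UO : U `<=` Omega.
  move=> x Ux; apply: contrapT => nO; move: Ux; rewrite /U /= (test_function_outside t nO) expr0n /=.
  by move/(lt_trans c0); rewrite ltxx.
rewrite -lte_fin -sqi_EFin//; last exact: tsqi.
apply: (@lt_le_trans _ _ (\int[mu]_(x in U) c%:E)%E).
  rewrite integral_cst// mule_gt0//; apply: open_lebesgue_rV_gt0 => //; by exists p.
have mphi : measurable_fun setT phi by exact: continuous_measurable_rV.
apply: (@le_trans _ _ (\int[mu]_(x in U) ((phi x) ^+ 2)%:E)%E).
  apply: ge0_le_integral => //.
  - by move=> x _; rewrite lee_fin ltW.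
  - by apply/measurable_EFinP; apply: measurable_funX; exact: measurable_funTS.
  - by move=> x Ux; rewrite lee_fin ltW.
apply: ge0_subset_integral => //.
- by apply/measurable_EFinP; apply: measurable_funX; exact: measurable_funTS.
- by move=> x _; rewrite lee_fin sqr_ge0.
Qed.

Let test_add phi psi : test_function Omega phi -> test_function Omega psi ->
  test_function Omega (fun x => phi x + psi x).
Proof. exact: test_functionD. Qed.

Let test_scale (c : R) phi : test_function Omega phi -> test_function Omega (fun x => c * phi x).
Proof. exact: test_functionZ. Qed.

(** On functions of mass 1 the energy is at least - qM, and a rescaled bump shows that there are
    such functions. Homogeneity carries the bound from mass 1 to all test functions, the zero
    function being treated apart. *)
Lemma energy_inf : exists E : R,
  (forall psi, test_function Omega psi -> E * mass psi psi <= energy psi psi) /\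
  (forall delta : R, 0 < delta -> exists phi, [/\ test_function Omega phi, mass phi phi = 1 &
     energy phi phi <= E + delta]).
Proof.
pose S := [set e : R | exists phi, [/\ test_function Omega phi, mass phi phi = 1 & energy phi phi = e]].
have norm phi p : test_function Omega phi -> phi p != 0 -> exists c : R, 0 < c /\
    c ^+ 2 * mass phi phi = 1.
  move=> t pN; have m0 := mass_gt0 t pN.
  exists (Num.sqrt (mass phi phi))^-1; split; first by rewrite invr_gt0 sqrtr_gt0.
  by rewrite exprVn sqr_sqrtr ?(ltW m0)// mulVf// gt_eqF.
have scale (c : R) phi (t : test_function Omega phi) :
    (mass (fun x => c * phi x) (fun x => c * phi x) = c ^+ 2 * mass phi phi) *
    (energy (fun x => c * phi x) (fun x => c * phi x) = c ^+ 2 * energy phi phi).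
  have tc := test_scale c t.
  rewrite massZ// energyZ// mass_sym energy_sym massZ// energyZ//.
  by rewrite !mulrA -expr2.
have [p Op] := O0; have [phi0 t0 p0] := test_bump oO Op.
have [c0 [c0p c0E]] := norm _ _ t0 p0.
have Slb : lbound S (- qM).
  move=> _ [phi [t m1 <-]]; have := dirichlet_le_energy t; rewrite m1 mulr1.
  move=> H; rewrite -subr_ge0 opprK; apply: le_trans H.
  rewrite mulr_ge0 ?(ltW eps0)// sumr_ge0// => i _; apply: Rintegral_ge0 => x _.
  exact: sqr_ge0.
have Sinf : has_inf S.
  split; last by exists (- qM).
  exists (energy (fun x => c0 * phi0 x) (fun x => c0 * phi0 x)).
  exists (fun x => c0 * phi0 x); split => //; first exact: test_scale.
  by rewrite scale.
exists (inf S); split.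
  move=> psi t; have [[x px]|psi0] := pselect (exists x, psi x != 0).
    have [c [c1 cE]] := norm _ _ t px.
    have : inf S <= energy (fun x => c * psi x) (fun x => c * psi x).
      apply: inf_lbound; first by exists (- qM).
      by exists (fun x => c * psi x); split => //; [exact: test_scale|rewrite scale].
    rewrite scale// -[X in X <= _]mulr1 -cE => H.
    by rewrite -(@ler_pM2l _ (c ^+ 2)) ?exprn_gt0// mulrCA.
  have psiE : psi = (fun x => 0 * psi x).
    apply/funext => x; rewrite mul0r; apply/eqP; apply: contrapT => /negP h.
    by apply: psi0; exists x.
  by rewrite psiE !scale// expr0n !mul0r mulr0.
move=> delta d0; have [_ [phi [t m1 <-]] lt] := inf_adherent d0 Sinf.
by exists phi; split => //; exact: ltW.
Qed.

(** By the parallelogram identity the energy of the difference is at most 4 (E + e) minus the energy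
    of the sum, which is at least E times its mass; the same identity for the masses, with total 4,
    concludes. This turns L2 convergence of a minimizing sequence into convergence of its
    gradients. *)
Lemma energy_mass_parallelogram (E e : R) phi psi :
  (forall chi, test_function Omega chi -> E * mass chi chi <= energy chi chi) ->
  test_function Omega phi -> test_function Omega psi ->
  mass phi phi = 1 -> mass psi psi = 1 -> energy phi phi <= E + e -> energy psi psi <= E + e ->
  energy (fun x => phi x - psi x) (fun x => phi x - psi x) <=
    4 * e + E * mass (fun x => phi x - psi x) (fun x => phi x - psi x).
Proof.
move=> HE t1 t2 m1 m2 e1 e2; have := HE _ (test_functionD t1 t2).
rewrite (quadratic_sub test_add test_scale (fun f g _ _ => energy_sym f g) energyD energyZ)//.
rewrite (quadratic_sub test_add test_scale (fun f g _ _ => mass_sym f g) massD massZ)//.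
rewrite (quadratic_add test_add test_scale (fun f g _ _ => energy_sym f g) energyD energyZ)//.
rewrite (quadratic_add test_add test_scale (fun f g _ _ => mass_sym f g) massD massZ)//.
rewrite m1 m2; exact: parallelogram_arith.
Qed.

Lemma Rintegral_test_sqr phi : test_function Omega phi ->
  \int[mu]_(x in Omega) (phi x ^+ 2) = \int[mu]_x (phi x ^+ 2).
Proof.
move=> t; apply: Rintegral_support => x nO.
by rewrite (test_function_outside t nO) expr0n.
Qed.

Lemma dirichlet_test phi i : test_function Omega phi ->
  dirichlet phi i = \int[mu]_(x in Omega) (partial i phi x ^+ 2).
Proof. by move=> t; rewrite Rintegral_test_sqr//; exact: tpart. Qed.

(** The almost minimizers generate a filter, and an ultrafilter finer than it contains, by Rellich,
    sets of arbitrarily small L2 diameter, from which the sequence is picked. The rate 4^-k is the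
    one that [sqi_complete] asks for. *)
Lemma minimizing_sequence (E : R) :
  (forall psi, test_function Omega psi -> E * mass psi psi <= energy psi psi) ->
  (forall delta : R, 0 < delta -> exists phi, [/\ test_function Omega phi, mass phi phi = 1 &
     energy phi phi <= E + delta]) ->
  exists phi : nat -> 'rV[R]_n -> R, forall k, [/\ test_function Omega (phi k),
    mass (phi k) (phi k) = 1, energy (phi k) (phi k) <= E + 4^-1 ^+ k,
    energy (phi k.+1) (phi k.+1) <= E + 4^-1 ^+ k &
    \int[mu]_(x in Omega) ((phi k.+1 x - phi k x) ^+ 2) <= 4^-1 ^+ k].
Proof.
move=> HE HS.
pose S (delta : R) := [set phi | [/\ test_function Omega phi, mass phi phi = 1 &
     energy phi phi <= E + delta]].
have FS : Filter (filter_from [set d : R | 0 < d] S).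
  apply: filter_from_filter; first by exists 1 => /=.
  move=> a b /= a0 b0; exists (Num.min a b); first by rewrite /= lt_min a0.
  move=> phi [t m e]; split; split => //; apply: (le_trans e); rewrite lerD2l.
    by rewrite ge_min lexx.
  by rewrite ge_min lexx orbT.
have PS : ProperFilter (filter_from [set d : R | 0 < d] S).
  by apply: filter_from_proper => d d0; have [phi ?] := HS d d0; exists phi.
have [G [UG sG]] := ultraFilterLemma PS.
have FG : ProperFilter G by exact: ultra_proper.
have GS d : 0 < d -> G (S d) by move=> d0; apply: sG; exists d.
pose M := 1 + `|(E + 1 + qM) / eps|.
have M0 : 0 <= M by rewrite addr_ge0.
have GM : G [set phi | [/\ test_function Omega phi, \int[mu]_x (phi x ^+ 2) <= M &
                  \sum_i dirichlet phi i <= M]].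
  apply: filterS (GS 1 ltr01) => phi [t m e]; split => //.
    rewrite -Rintegral_test_sqr//; apply: (le_trans (sqr_le_mass t)).
    by rewrite m lerDl.
  have := dirichlet_le_energy t; rewrite m mulr1 => H.
  have -> : \sum_i dirichlet phi i = \sum_i \int[mu]_(x in Omega) (partial i phi x ^+ 2).
    by apply: eq_bigr => i _; exact: dirichlet_test.
  apply: (@le_trans _ _ ((E + 1 + qM) / eps)).
    rewrite ler_pdivlMr// mulrC; apply: (le_trans H).
    by rewrite lerD2r.
  by apply: (le_trans (ler_norm _)); rewrite lerDr.
have p4 k : 0 < 4^-1 ^+ k :> R by rewrite exprn_gt0// invr_gt0.
have HA k : exists A, [/\ G A, A `<=` S (4^-1 ^+ k) & forall phi psi, A phi -> A psi ->
    \int[mu]_x ((phi x - psi x) ^+ 2) <= 4^-1 ^+ k].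
  have [A GA HA] := rellich_ultra K0 M0 OK UG GM (p4 k).
  exists (A `&` S (4^-1 ^+ k)); split.
  - by apply: filterI => //; exact: GS.
  - by move=> phi [].
  - by move=> phi psi [A1 _] [A2 _]; exact: HA.
have [A HA'] := choice HA.
(* Membership in all the sets up to index k puts both [phi k] and [phi k.+1] in [A k], so that their
   distance and both energies are controlled by the same 4^-k. *)
have GB k : G [set phi | forall j, (j <= k)%N -> A j phi].
  elim: k => [|k IH].
    have [GA _ _] := HA' 0%N; apply: filterS GA => phi Aphi j.
    by rewrite leqn0 => /eqP->.
  have [GA _ _] := HA' k.+1; apply: filterS2 IH GA => phi IH Aphi j.
  by rewrite leq_eqVlt => /predU1P[->//|]; rewrite ltnS; exact: IH.
have [phi Hphi] := choice (fun k => filter_ex (GB k)).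
exists phi => k; have [_ AS dA] := HA' k.
have Ak := Hphi k k (leqnn k); have Ak1 := Hphi k.+1 k (leqnSn k).
have [t1 m1 e1] := AS _ Ak; have [t2 m2 e2] := AS _ Ak1; split => //.
by rewrite (Rintegral_test_sqr (test_functionB t2 t1)); exact: dA.
Qed.

(** Functions and gradients of the minimizing sequence converge strongly. The Euler-Lagrange
    equation then comes from Cauchy-Schwarz for the nonnegative form energy - E mass, which tends to
    0 on the sequence. The sequence stays in the conclusion: later bounds are proved on it and
    passed to w. *)
Theorem ground_state : exists (E : R) (phi : nat -> 'rV[R]_n -> R) (w : 'rV[R]_n -> R)
    (G : 'I_n -> 'rV[R]_n -> R),
  [/\ forall k, [/\ test_function Omega (phi k), mass (phi k) (phi k) = 1 &
         energy (phi k) (phi k) <= E + 4^-1 ^+ k],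
      forall psi, test_function Omega psi -> E * mass psi psi <= energy psi psi,
      [/\ measurable_fun setT w, sqi mu Omega w & cvg_sqi mu Omega phi w],
      forall i, [/\ measurable_fun setT (G i), sqi mu Omega (G i) &
        cvg_sqi mu Omega (fun k => partial i (phi k)) (G i)] &
      forall chi, test_function Omega chi ->
        eps * \sum_i wip mu Omega r (G i) (partial i chi) -
        wip mu Omega (fun x => r x * q x) w chi = E * wip mu Omega r w chi].
Proof.
have [E [HE HS]] := energy_inf; have [phi Hphi] := minimizing_sequence HE HS.
have tphi k : test_function Omega (phi k) by case: (Hphi k).
have mtest psi : test_function Omega psi -> measurable_fun setT psi.
  move=> t; apply: continuous_measurable_rV; exact: Cinfty_continuous (test_Cinfty t).
have [w [mw sw cw _]] := @sqi_complete _ _ _ mu Omega mO phi 1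
  (fun k => mtest _ (tphi k)) (fun k => tsqi (tphi k))
  (fun k => ltac:(rewrite mul1r; by case: (Hphi k))).
(* The energy of a difference contributes 4 + E rM by the parallelogram bound, the recovery of the
   Dirichlet sum from the energy contributes qM rM, and rM converts L2 distances into masses. *)
pose C : R := (4 + `|E| * rM + `|qM| * rM) / eps.
have p4 k : 0 < 4^-1 ^+ k :> R by rewrite exprn_gt0// invr_gt0.
have rM0 : 0 <= rM by have [x /r1/andP[h1 h2]] := O0; rewrite (le_trans _ h2)// (le_trans _ h1).
have HG i : exists g, [/\ measurable_fun setT g, sqi mu Omega g &
        cvg_sqi mu Omega (fun k => partial i (phi k)) g].
  have bnd k : \int[mu]_(x in Omega) ((partial i (phi k.+1) x - partial i (phi k) x) ^+ 2) <=
      C * 4^-1 ^+ k.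
    have [t1 m1 e1 e2 d12] := Hphi k; have [t2 m2 _ _ _] := Hphi k.+1.
    have td := test_functionB t2 t1.
    have en := energy_mass_parallelogram HE t2 t1 m2 m1 e2 e1.
    have di := dirichlet_le_energy td.
    have ms : mass (fun x => phi k.+1 x - phi k x) (fun x => phi k.+1 x - phi k x) <= rM * 4^-1 ^+ k.
      by apply: (le_trans (mass_le_sqr td)); exact: ler_wpM2l.
    have m0 := mass_ge0 td.
    move: en di ms m0; set en := energy _ _; set m := mass _ _ => en_le di ms m0.
    have dile : \int[mu]_(x in Omega) ((partial i (phi k.+1) x - partial i (phi k) x) ^+ 2) <=
        \sum_j \int[mu]_(x in Omega) (partial j (fun x => phi k.+1 x - phi k x) x ^+ 2).
      rewrite (bigD1 i)//= (partialB i (test_Cinfty t2) (test_Cinfty t1)) lerDl.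
      by apply: sumr_ge0 => j _; apply: Rintegral_ge0 => x _; exact: sqr_ge0.
    apply: (le_trans dile); rewrite /C mulrAC ler_pdivlMr// mulrC; apply: (le_trans di).
    have E1 : E * m <= `|E| * (rM * 4^-1 ^+ k).
      by apply: (le_trans (ler_wpM2r m0 (ler_norm E))); rewrite ler_wpM2l.
    have q1 : qM * m <= `|qM| * (rM * 4^-1 ^+ k).
      by apply: (le_trans (ler_wpM2r m0 (ler_norm qM))); rewrite ler_wpM2l.
    have -> : (4 + `|E| * rM + `|qM| * rM) * 4^-1 ^+ k =
        4 * 4^-1 ^+ k + `|E| * (rM * 4^-1 ^+ k) + `|qM| * (rM * 4^-1 ^+ k).
      by set p := 4^-1 ^+ k; ring.
    apply: lerD q1; apply: (le_trans en_le); exact: lerD.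
  have [g [mg sg cg _]] := @sqi_complete _ _ _ mu Omega mO (fun k => partial i (phi k)) C
    (fun k => mtest _ (tpart i (tphi k))) (fun k => tpsqi i (tphi k)) bnd.
  by exists g.
have [G HG'] := choice HG.
exists E, phi, w, G; split => //; first by move=> k; case: (Hphi k).
move=> chi tchi.
(* This form is nonnegative on test functions because E is the infimum, and it is at most 4^-k at
   [phi k]. *)
pose B f g := energy f g - E * mass f g.
have BD f g k : test_function Omega f -> test_function Omega g -> test_function Omega k ->
    B (fun x => f x + g x) k = B f k + B g k.
  by move=> *; rewrite /B energyD// massD//; ring.
have BZ c f k : test_function Omega f -> test_function Omega k ->
    B (fun x => c * f x) k = c * B f k.
  by move=> *; rewrite /B energyZ// massZ//; ring.
have B0 f : test_function Omega f -> 0 <= B f f by move=> t; rewrite subr_ge0; exact: HE.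
have BC f g : test_function Omega f -> test_function Omega g -> B f g = B g f.
  by move=> _ _; rewrite /B energy_sym mass_sym.
have Blim : B (phi k) chi @[k --> \oo] --> (eps * \sum_i wip mu Omega r (G i) (partial i chi) -
        wip mu Omega (fun x => r x * q x) w chi) - E * wip mu Omega r w chi.
  apply: cvgB; last first.
    apply: cvgM; first exact: cvg_cst.
    by apply: (cvg_wip mO) => // [k|]; exact: tsqi.
  apply: cvgB; last by apply: (cvg_wip mO) => // [k|]; exact: tsqi.
  apply: cvgM; first exact: cvg_cst.
  apply: cvg_big => // [|i _]; first exact: add_continuous.
  have [_ sG cG] := HG' i.
  by apply: (cvg_wip mO) => // [k|]; exact: tpsqi.
have B0lim : B (phi k) chi @[k --> \oo] --> (0 : R).
  apply: norm_cvg0.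
  have c0 : Num.sqrt (4^-1 ^+ k * B chi chi) @[k --> \oo] --> (0 : R).
    rewrite -[X in _ --> X](@sqrtr0 R).
    apply: (continuous_cvg _ (@sqrt_continuous R _)).
    rewrite -(mul0r (B chi chi)); apply: cvgM; last exact: cvg_cst.
    by apply: cvg_expr; rewrite ger0_norm ?invr_ge0// invf_lt1 ?ltr1n.
  apply: (squeeze_cvgr _ (cvg_cst 0) c0); apply: nearW => k.
  rewrite normr_ge0/= -sqrtr_sqr ler_wsqrtr//.
  apply: (le_trans (quadratic_cauchy_schwarz test_add test_scale BC BD BZ B0 (tphi k) tchi)).
  apply: ler_wpM2r; first exact: B0.
  by rewrite /B; have [_ -> e _ _] := Hphi k; rewrite mulr1 lerBlDl.
apply/eqP; rewrite -subr_eq0; apply/eqP.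
exact: (cvg_unique (@Rhausdorff R) Blim B0lim).
Qed.

End ground_state.

(** * Weak solutions *)

Section H10_limit.
Context (R : realType) (n : nat).
Local Notation mu := (@lebesgue_rV R n).
Variables (Omega : set 'rV[R]_n) (oO : open Omega).

Let mO : measurable Omega. Proof. exact: open_measurable_rV. Qed.

Lemma cvg_sqi_L2sq (u : nat -> 'rV[R]_n -> R) f : (forall k, sqi mu Omega (u k)) ->
  sqi mu Omega f -> cvg_sqi mu Omega u f -> L2sq Omega (u k \- f) @[k --> \oo] --> 0%E.
Proof.
move=> su sf uf.
rewrite (_ : (fun k => L2sq Omega (u k \- f)) =
    fun k => (\int[mu]_(x in Omega) ((u k x - f x) ^+ 2))%:E).
  by apply: cvg_EFin; [exact: nearW|exact: uf].
by apply/funext => k; rewrite -sqi_EFin//; exact: sqiB.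
Qed.

(** The weak derivative formula is integration by parts for the approximating test functions, both
    sides of which pass to the L2 limit. *)
Lemma H10_limit (phi : nat -> 'rV[R]_n -> R) (w : 'rV[R]_n -> R) (G : 'I_n -> 'rV[R]_n -> R) :
  (forall k, test_function Omega (phi k)) -> sqi mu Omega w -> cvg_sqi mu Omega phi w ->
  (forall i, sqi mu Omega (G i) /\ cvg_sqi mu Omega (fun k => partial i (phi k)) (G i)) ->
  H10 Omega w (fun x => \row_i G i x).
Proof.
move=> tphi sw cw HG.
have stest psi : test_function Omega psi -> sqi mu Omega psi.
  by move=> t; exact: test_function_sqi t mO.
have GE i : (fun x => (\row_j G j x) ord0 i) = G i by apply/funext => x; rewrite mxE.
split; last first.
  exists phi; split => //; first by apply: cvg_sqi_L2sq => // k; exact: stest.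
  move=> i; rewrite GE; have [sG cG] := HG i.
  by apply: cvg_sqi_L2sq => // k; apply: stest; exact: test_function_derive.
split => // i; rewrite GE; have [sG cG] := HG i; split => //.
move=> psi tpsi.
have tD : test_function Omega (partial i psi) by exact: test_function_derive.
have c1 := cvg_sqi_mul mO (fun k => stest _ (tphi k)) sw (stest _ tD) cw.
have c2 := cvg_sqi_mul mO (fun k => stest _ (test_function_derive (delta_mx ord0 i) (tphi k)))
  sG (stest _ tpsi) cG.
apply: (cvg_unique (@Rhausdorff R) c1).
rewrite (_ : (fun k => _) = fun k => - \int[mu]_(x in Omega) (partial i (phi k) x * psi x)).
  by apply: cvgN; exact: c2.
apply/funext => k; apply: (partial_by_parts i tpsi (test_Cinfty (tphi k)) mO).
by [].
Qed.

End H10_limit.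

Section weighted_eigenfunction.
Context (R : realType) (n : nat).
Local Notation mu := (@lebesgue_rV R n).
Variables (Omega : set 'rV[R]_n) (f q : 'rV[R]_n -> R) (eps : R).
Hypotheses (oO : open Omega) (Ofin : (mu Omega < +oo)%E) (eps0 : 0 < eps) (cf : Cinfty f).

Let mO : measurable Omega. Proof. exact: open_measurable_rV. Qed.

Let r (x : 'rV[R]_n) := expR (f x / eps).

(* Testing against [psi / r] turns the weighted, symmetric equation into the
   divergence free form of the operator. *)
Lemma eigenfunction_unweighted (E : R) (w : 'rV[R]_n -> R) (G : 'I_n -> 'rV[R]_n -> R) :
  sqi mu Omega w -> (forall i, sqi mu Omega (G i)) -> bounded_measurable Omega q ->
  Cinfty (fun x => expR (- (f x / eps))) ->
  (forall i x, partial i (fun x => expR (- (f x / eps))) x =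
     - expR (- (f x / eps)) * (partial i f x / eps)) ->
  (forall chi, test_function Omega chi ->
        eps * \sum_i wip mu Omega r (G i) (partial i chi) -
        wip mu Omega (fun x => r x * q x) w chi = E * wip mu Omega r w chi) ->
  forall psi, test_function Omega psi ->
    \int[mu]_(x in Omega) (- (dot (grad f x) (\row_i G i x) * psi x) - q x * w x * psi x
       + eps * dot (\row_i G i x) (\row_i partial i psi x)) =
    E * \int[mu]_(x in Omega) (w x * psi x).
Proof.
move=> sw sG bq cr' pr' weq psi tpsi.
pose r' x := expR (- (f x / eps)).
have rr' x : r x * r' x = 1 by rewrite /r /r' expRN mulfV// gt_eqF// expR_gt0.
have tchi : test_function Omega (fun x => r' x * psi x) by exact: test_functionM.
have cpsi := test_Cinfty tpsi.
have stest chi : test_function Omega chi -> sqi mu Omega chi.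
  by move=> t; exact: test_function_sqi t mO.
(* The derivative that falls on 1 / r carries a factor 1 / eps, which cancels the eps in front of
   the gradient term and produces the drift. *)
have pchi i x : partial i (fun x => r' x * psi x) x =
    r' x * (partial i psi x - psi x * (partial i f x / eps)).
  rewrite /partial deriveM; [|exact: Cinfty_derivable..].
  by have := pr' i x; rewrite /partial => ->; rewrite /GRing.scale/= /r'; set z := expR _; ring.
have bone : bounded_measurable Omega (fun=> 1 : R) by exact: bounded_measurable_cst.
have tpf i : test_function Omega (fun x => partial i f x * psi x).
  by apply: test_functionM => //; exact: Cinfty_derive.
have tpp i : test_function Omega (partial i psi) by exact: test_function_derive.
have iprod (h k : 'rV[R]_n -> R) : sqi mu Omega h -> test_function Omega k ->
    mu.-integrable Omega (EFin \o (fun x => h x * k x)).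
  by move=> sh tk; apply: sqi_mul => //; exact: stest.
have := weq _ tchi; rewrite wip.unlock.
have -> : \int[mu]_(x in Omega) (r x * (w x * (r' x * psi x))) = \int[mu]_(x in Omega) (w x * psi x).
  by apply: eq_Rintegral => x _; rewrite -[RHS]mul1r -(rr' x); ring.
move=> <-.
have -> : \int[mu]_(x in Omega) (r x * q x * (w x * (r' x * psi x))) =
    \int[mu]_(x in Omega) (q x * w x * psi x).
  by apply: eq_Rintegral => x _; rewrite -[RHS]mul1r -(rr' x); ring.
have iqw : mu.-integrable Omega (EFin \o (fun x => q x * w x * psi x)).
  by apply: iprod => //; case: bq => mq bq; exact: sqiM_bounded.
have E1 i : \int[mu]_(x in Omega) (r x * (G i x * partial i (fun x => r' x * psi x) x)) =
    \int[mu]_(x in Omega) (G i x * partial i psi x) -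
    eps^-1 * \int[mu]_(x in Omega) (G i x * (partial i f x * psi x)).
  rewrite -RintegralZl//; last exact: iprod.
  rewrite -RintegralB//; [|exact: iprod|by apply: integrable_funZ => //; exact: iprod].
  by apply: eq_Rintegral => x _; rewrite pchi -[RHS]mul1r -(rr' x); ring.
under eq_bigr do rewrite E1.
have isum (I : Type) (s : seq I) (F : I -> 'rV[R]_n -> R) :
    (forall i, mu.-integrable Omega (EFin \o F i)) ->
    mu.-integrable Omega (EFin \o (fun x => \sum_(i <- s) F i x)) /\
    \int[mu]_(x in Omega) (\sum_(i <- s) F i x) = \sum_(i <- s) \int[mu]_(x in Omega) F i x.
  move=> iF; elim: s => [|i s [IH1 IH2]].
    split; last first.
      by rewrite big_nil; under eq_Rintegral do rewrite big_nil; rewrite Rintegral_cst// mul0r.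
    rewrite (_ : (fun x => _) = fun=> 0); last by apply/funext => x; rewrite big_nil.
    exact: integrable0.
  rewrite (_ : (fun x => _) = fun x => F i x + \sum_(j <- s) F j x); last first.
    by apply/funext => x; rewrite big_cons.
  split; first exact: integrable_funD.
  by rewrite RintegralD// big_cons IH2.
have [i1 I1] := isum _ (index_enum 'I_n) _ (fun i => iprod _ _ (sG i) (tpp i)).
have [i2 I2] := isum _ (index_enum 'I_n) _ (fun i => iprod _ _ (sG i) (tpf i)).
rewrite (_ : \int[mu]_(x in Omega) _ = \int[mu]_(x in Omega)
   ((- 1 * (\sum_i G i x * (partial i f x * psi x)) - q x * w x * psi x)
    + eps * \sum_i (G i x * partial i psi x))); last first.
  apply: eq_Rintegral => x _; rewrite /dot mulr_suml mulN1r.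
  congr (- _ - _ + _ * _); apply: eq_bigr => i _; rewrite !mxE//; ring.
rewrite RintegralD//; [|by apply: integrable_funB => //; exact: integrable_funZ|exact: integrable_funZ].
rewrite RintegralB//; last exact: integrable_funZ.
rewrite !RintegralZl// I1 I2 sumrB -mulr_sumr.
set a := \sum_i _; set b := \sum_i _; set c := \int[mu]_(x in _) _.
by field; rewrite gt_eqF.
Qed.

End weighted_eigenfunction.

(** * Solutions with separated variables *)

Section separable_solution.
Context (R : realType) (n : nat).
Local Notation mu := (@lebesgue_rV R n).
Local Notation leb := (@lebesgue_measure R).
Variables (Omega : set 'rV[R]_n) (T E : R).
Hypotheses (oO : open Omega) (T0 : 0 < T).
Implicit Type phi : R * 'rV[R]_n -> R.

Let mO : measurable Omega. Proof. exact: open_measurable_rV. Qed.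

Let damp (t : R) : R := expR (- E * t).

Lemma slice_affine (t : R) : continuous (fun x : 'rV[R]_n => (t, x)).
Proof. by move=> x; exact: (cvg_pair (cvg_cst t) (@cvg_id _ (nbhs x))). Qed.

Lemma slice_affineE (t s : R) (v x : 'rV[R]_n) :
  ((t, s *: v + x) : R * 'rV[R]_n) = s *: ((0, v) : R * 'rV[R]_n) + (t, x).
Proof. by congr (_, _); rewrite /= scaler0 add0r. Qed.

Lemma slice_partial phi (t : R) (x : 'rV[R]_n) i :
  partial i (fun y => phi (t, y)) x = 'D_(0, delta_mx ord0 i) phi (t, x).
Proof. exact: (@derive_affine_comp R _ _ (fun y => (t, y)) (fun v => (0, v)) (slice_affineE t) phi). Qed.

Lemma slice_test phi (t : R) : test_function (`]0, T[ `*` Omega) phi ->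
  test_function Omega (fun x => phi (t, x)).
Proof.
move=> tphi; have [cphi kphi sphi] := tphi.
have sub : closure [set x | phi (t, x) != 0] `<=`
    (fun x => (t, x)) @^-1` closure [set p | phi p != 0].
  rewrite closureE; apply: smallest_sub.
    by apply: closed_comp; [move=> x _; exact: slice_affine|exact: closed_closure].
  by move=> x /= px; exact: subset_closure.
split.
- exact: (@Cinfty_affine_comp R _ _ (fun y => (t, y)) (fun v => (0, v)) (@slice_affine t) (slice_affineE t)).
- have [M _ HM] := test_function_bounded_support tphi.
  apply: bounded_closed_compact; last exact: closed_closure.
  exists M; split; first exact: num_real.
  move=> M' MM' x Hx.
  have : [set y : 'rV[R]_n | `|y| <= M] x.
    move: x Hx; rewrite closureE; apply: smallest_sub.
      apply: (@closed_comp _ _ (fun y : 'rV[R]_n => `|y|) [set z | z <= M]); last exact: closed_le.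
      by move=> y _; exact: norm_continuous.
    move=> y /= py; apply: le_trans (HM _ py).
    by rewrite /Num.norm/= le_max lexx orbT.
  by move=> /= xM; apply: (le_trans xM); exact: ltW.
- by move=> x /sub /sphi [].
Qed.

Lemma line_time_derive phi (t : R) (x : 'rV[R]_n) : Cinfty phi ->
  is_derive t 1 (fun s => phi (s, x)) (time_partial phi t x).
Proof.
move=> cphi.
have LE (s v y : R) : ((s *: v + y, x) : R * 'rV[R]_n) = s *: ((v, 0) : R * 'rV[R]_n) + (y, x).
  by congr (_, _); rewrite /= scaler0 add0r.
apply: DeriveDef.
  by apply: (@derivable_affine_comp R _ _ (fun s => (s, x)) (fun v => (v, 0)) LE phi); exact: Cinfty_derivable.
exact: (@derive_affine_comp R _ _ (fun s => (s, x)) (fun v => (v, 0)) LE phi).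
Qed.

Let damp_derive (t : R) : is_derive t 1 damp (- E * damp t).
Proof.
have d1 : is_derive t 1 (fun s : R => - E * s) (- E).
  by have := is_deriveZ (- E) (is_derive_id t (1 : R)); rewrite /GRing.scale/= mulr1; apply.
have := @is_derive1_comp R expR (fun s => - E * s) t _ _ (is_derive_expR _) d1.
by move=> h; apply: (is_derive_eq h); rewrite mulrC.
Qed.

Let damp_continuous : continuous damp.
Proof.
by move=> t; apply: differentiable_continuous; apply/derivable1_diffP; have [] := damp_derive t.
Qed.

(* The integrand is minus the time derivative of [damp * phi]. *)
Lemma time_integral0 phi (x : 'rV[R]_n) : test_function (`]0, T[ `*` Omega) phi ->
  (\int[leb]_t (damp t * (- time_partial phi t x + E * phi (t, x)))%:E = 0)%E.
Proof.
move=> tphi; have cphi := test_Cinfty tphi.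
have tD := test_function_derive ((1, 0) : R * 'rV[R]_n) tphi.
pose g (t : R) : R := damp t * (- time_partial phi t x + E * phi (t, x)).
have out (t : R) : ~ (t \in `]0, T[) -> phi (t, x) = 0 /\ time_partial phi t x = 0.
  move=> nt; split; [apply: (test_function_outside tphi)|apply: (test_function_outside tD)];
  by move=> [] /=; rewrite ?inE.
have cline : continuous (fun t : R => (t, x)).
  by move=> t; exact: (cvg_pair (@cvg_id _ (nbhs t)) (cvg_cst x)).
have cD := Cinfty_continuous (test_Cinfty tD).
have c1 : continuous (fun t : R => time_partial phi t x).
  by move=> t; exact: (continuous_comp (cline t) (cD (t, x))).
have c2 : continuous (fun t : R => phi (t, x)).
  by move=> t; exact: (continuous_comp (cline t) (Cinfty_continuous cphi (x := (t, x)))).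
have cg : continuous g.
  move=> t; apply: cvgM; first exact: damp_continuous.
  apply: cvgD; first by apply: cvgN; exact: c1.
  by apply: cvgM; [exact: cvg_cst|exact: c2].
have -> : (\int[leb]_t (g t)%:E = \int[leb]_(t in `[0%R, T]) (g t)%:E)%E.
  rewrite [RHS]integral_mkcond; apply: eq_integral => t _; rewrite patchE; case: ifPn => //.
  move=> nt; rewrite /g; have [|-> ->] := out t; last by rewrite oppr0 mulr0 addr0 mulr0.
  move=> ot; move/negP: nt; apply; rewrite inE /=.
  by apply: subset_itv_oo_cc.
pose k (t : R) := - (damp t * phi (t, x)).
have dk (t : R) : is_derive t 1 k (g t).
  have h := is_deriveN (is_deriveM (damp_derive t) (line_time_derive t x cphi)).
  by apply: (is_derive_eq h); rewrite /g /GRing.scale/=; ring.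
have ck : continuous k.
  by move=> t; apply: differentiable_continuous; apply/derivable1_diffP; have [] := dk t.
rewrite (@continuous_FTC2 _ g k)//.
- rewrite /k; have [-> _] : phi (T, x) = 0 /\ time_partial phi T x = 0 by apply: out; rewrite in_itv/= ltxx andbF.
  have [-> _] : phi (0, x) = 0 /\ time_partial phi 0 x = 0 by apply: out; rewrite in_itv/= ltxx.
  by rewrite !mulr0 oppr0 -EFinB subrr.
- exact: continuous_subspaceT.
- split.
  + by move=> t _; have [] := dk t.
  + by apply: cvg_at_right_filter; exact: ck.
  + by apply: cvg_at_left_filter; exact: ck.
- by move=> t _; rewrite derive1E; have [_ ->] := dk t.
Qed.

(** The weak formulation integrates over time last. Fubini moves the time integral inside, where
    [time_integral0] makes it vanish for each x. *)
Lemma space_time_integral0 phi (w : 'rV[R]_n -> R) : (mu Omega < +oo)%E ->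
  measurable_fun setT w -> sqi mu Omega w ->
  test_function (`]0, T[ `*` Omega) phi ->
  \int[leb]_(t in `]0, T[) \int[mu]_(x in Omega)
    (w x * (damp t * (- time_partial phi t x + E * phi (t, x)))) = 0.
Proof.
move=> Ofin mw sw tphi; have cphi := test_Cinfty tphi.
have tD := test_function_derive ((1, 0) : R * 'rV[R]_n) tphi.
have [C1 HC1] := test_function_bounded tphi.
have [C2 HC2] := test_function_bounded tD.
have C10 : 0 <= C1 by exact: le_trans (normr_ge0 _) (HC1 (0, 0)).
have C20 : 0 <= C2 by exact: le_trans (normr_ge0 _) (HC2 (0, 0)).
pose h (p : R * 'rV[R]_n) : R := damp p.1 * (- 'D_(1, 0) phi p + E * phi p).
have out p : ~ (`]0, T[ `*` Omega) p -> h p = 0.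
  move=> np; rewrite /h (test_function_outside tphi np) (test_function_outside tD np).
  by rewrite oppr0 mulr0 addr0 mulr0.
pose C := expR (`|E| * T) * (C2 + `|E| * C1).
have hC p : `|h p| <= C * \1_(`]0, T[%classic : set R) p.1.
  have [pin|/out->] := pselect ((`]0, T[ `*` Omega) p); last first.
    by rewrite normr0 mulr_ge0// mulr_ge0 ?expR_ge0// addr_ge0// mulr_ge0.
  have [p1 p2] := pin; rewrite indicE mem_set// mulr1 /h normrM ger0_norm ?expR_ge0//.
  apply: ler_pM => //; first exact: expR_ge0.
    rewrite ler_expR; apply: (le_trans (ler_norm _)); rewrite normrM normrN ler_wpM2l//.
    by move: p1; rewrite /= in_itv/= => /andP[a b]; rewrite gtr0_norm// ltW.
  apply: (le_trans (ler_normD _ _)); rewrite normrN normrM; apply: lerD; first exact: HC2.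
  by rewrite ler_wpM2l.
(* Measurability for the product sigma-algebra is obtained from the space of dimension n + 1, where
   open sets are known to be measurable, through [rV_cons]. *)
have mcont (g : R * 'rV[R]_n -> R) : Cinfty g ->
    measurable_fun [set: measurableTypeR R * 'rV[R]_n] g.
  move=> cg.
  have ctail : continuous (fun y : 'rV[R]_n.+1 => \row_j y ord0 (lift ord0 j) : 'rV[R]_n).
    move=> y A /nbhs_ballP[e /= e0 He]; apply/nbhs_ballP; exists e => // z.
    rewrite -ball_normE /= => yz; apply: He; rewrite -ball_normE /=.
    apply: rV_norm_lt => // j; rewrite !mxE.
    by apply: le_lt_trans yz; rewrite (le_trans _ (coord_le_norm _ (lift ord0 j)))// !mxE.
  have ctup : continuous (fun y : 'rV[R]_n.+1 => g (y ord0 ord0, \row_j y ord0 (lift ord0 j))).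
    move=> y; apply: (@continuous_comp _ _ _ (fun y : 'rV[R]_n.+1 =>
      (y ord0 ord0, \row_j y ord0 (lift ord0 j)) : R * 'rV[R]_n) g); last exact: Cinfty_continuous.
    exact: (cvg_pair (@coord_continuous_rV R n.+1 ord0 y) (ctail y)).
  have := measurableT_comp (continuous_measurable_rV ctup) (@measurable_rV_cons R n).
  apply: eq_measurable_fun => -[t x] _ /=; congr g; congr (_, _).
    by rewrite mxE unlift_none.
  by apply/rowP => j; rewrite !mxE liftK.
have mh : measurable_fun [set: measurableTypeR R * 'rV[R]_n] h.
  apply: measurable_funM.
    apply: (measurableT_comp (continuous_measurable_fun damp_continuous)); exact: measurable_fst.
  apply: measurable_funD; first by apply: measurable_funN; apply: mcont; exact: test_Cinfty tD.
  by apply: measurable_funM => //; exact: mcont.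
pose F (p : measurableTypeR R * 'rV[R]_n) : \bar R := (w p.2 * h p)%:E.
have mF : measurable_fun setT F.
  apply/measurable_EFinP; apply: measurable_funM => //.
  by apply: (measurableT_comp mw); exact: measurable_snd.
have iw : mu.-integrable Omega (EFin \o w).
  have s1 : sqi mu Omega (fun=> 1 : R) by apply: sqi_bounded => //; exists 1 => x _; rewrite normr1.
  have := sqi_mul mO sw s1; apply: eq_integrable => // x _ /=; by rewrite mulr1.
have iw' : mu.-integrable setT (EFin \o (w \_ Omega)).
  move: iw; rewrite (integrable_mkcond _ mO); apply: eq_integrable => // x _ /=.
  by rewrite !patchE; case: ifP.
have Fbound t x : `|w x * h (t, x)| <= (C * \1_(`]0, T[%classic : set R) t) * `|(w \_ Omega) x|.
  have [Ox|nO] := pselect (Omega x); last first.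
    rewrite (out (t, x)); last by case.
    by rewrite mulr0 normr0; apply: mulr_ge0 => //; exact: le_trans (normr_ge0 _) (hC (t, x)).
  by rewrite patchE mem_set// normrM mulrC ler_wpM2r// (hC (t, x)).
have mwO : measurable_fun setT (w \_ Omega).
  by case/integrableP : iw' => /measurable_EFinP.
have iC : leb.-integrable setT (fun t => (C * \1_(`]0%R, T[ : set R) t)%:E).
  exact: (integrableZl measurableT C (integrable_indic_itv 0 T false true)).
(* The dominating function separates the variables: it is bounded in time on a finite interval, and
   integrable in space because w is square integrable on a set of finite measure. *)
have iF : (leb \x mu)%E.-integrable setT F.
  apply/integrable12ltyP => //.
  have mA : measurable_fun setT (abse \o F) by exact: measurableT_comp.
  have A0 p : (0 <= (abse \o F) p)%E by exact: abse_ge0.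
  apply: (@le_lt_trans _ _ (\int[leb]_t ((C * \1_(`]0%R, T[ : set R) t)%:E *
     \int[mu]_x `|(EFin \o (w \_ Omega)) x|))%E).
    apply: ge0_le_integral => //.
    - by move=> t _; exact: integral_ge0.
    - exact: (@measurable_fun_fubini_tonelli_F _ _ (measurableTypeR R) 'rV[R]_n R mu (abse \o F)).
    - by apply: emeasurable_funM => //; apply/measurable_EFinP; apply: measurable_funM.
    - move=> t _; rewrite -ge0_integralZl//.
      + apply: ge0_le_integral => //.
        * apply: measurableT_comp => //; apply/measurable_EFinP; apply: measurable_funM => //.
          exact: (measurable_fun_pair2 t mh).
        * by apply: measurable_funeM; apply: measurableT_comp => //; apply/measurable_EFinP.
        * by move=> x _; rewrite /F /= lee_fin; exact: Fbound.
      + by apply: measurableT_comp => //; apply/measurable_EFinP.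
      + by rewrite lee_fin (le_trans (normr_ge0 _) (hC (t, 0))).
  have iC0 (t : R) : (0 <= (C * \1_(`]0%R, T[ : set R) t)%:E)%E.
    by rewrite lee_fin (le_trans (normr_ge0 _) (hC (t, 0))).
  rewrite ge0_integralZr//.
  - rewrite lte_mul_pinfty//.
    + exact: integral_ge0.
    + exact: (integrable_fin_num measurableT iC).
    + by case/integrableP : iw'.
  - by apply/measurable_EFinP; apply: measurable_funM => //; exact: measurable_indic.
  - exact: integral_ge0.
have it x : leb.-integrable setT (fun t => (h (t, x))%:E).
  apply: le_integrable iC => //.
    by apply/measurable_EFinP; exact: (measurable_fun_pair1 x mh).
  move=> t _; rewrite /= lee_fin; apply: (le_trans (hC (t, x))); exact: ler_norm.
have Ft t : mu.-integrable setT (EFin \o (fun x => w x * h (t, x))).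
  have iCw := integrable_funZ measurableT (C * \1_(`]0, T[%classic : set R) t) (integrable_norm iw').
  apply: le_integrable iCw => //.
    by apply/measurable_EFinP; apply: measurable_funM => //; exact: (measurable_fun_pair2 t mh).
  by move=> x _; rewrite /= lee_fin; apply: (le_trans (Fbound t x)); exact: ler_norm.
have inner t : \int[mu]_(x in Omega) (w x * (damp t * (- time_partial phi t x + E * phi (t, x)))) =
    \int[mu]_x (w x * h (t, x)).
  by rewrite -[RHS](@Rintegral_support _ _ _ mu Omega)// => x nO; rewrite out ?mulr0// => -[].
have outer0 t : ~ `]0, T[%classic t -> \int[mu]_x (w x * h (t, x)) = 0.
  move=> nt; have E0 x : w x * h (t, x) = 0 by rewrite out ?mulr0// => -[].
  by under eq_Rintegral do rewrite E0; rewrite Rintegral_cst// mul0r.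
transitivity (\int[leb]_(t in `]0, T[) \int[mu]_x (w x * h (t, x))).
  by apply: eq_Rintegral => t _; exact: inner.
rewrite (Rintegral_support leb outer0).
rewrite /Rintegral.
have -> : (\int[leb]_t (fine (\int[mu]_x (w x * h (t, x))%:E))%:E = \int[leb]_t \int[mu]_x F (t, x))%E.
  by apply: eq_integral => t _; rewrite fineK//; exact: (integrable_fin_num measurableT (Ft t)).
rewrite (Fubini iF) integral0_eq// => x _.
rewrite /F /=; under eq_integral do rewrite EFinM.
by rewrite (integralZl measurableT (it x)) (time_integral0 x tphi) mule0.
Qed.

End separable_solution.

Section weak_solution.
Context (R : realType) (n : nat).
Local Notation mu := (@lebesgue_rV R n).
Local Notation leb := (@lebesgue_measure R).
Variables (Omega : set 'rV[R]_n) (f q q1 : 'rV[R]_n -> R) (eps T E : R).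
Hypotheses (oO : open Omega) (Ofin : (mu Omega < +oo)%E) (T0 : 0 < T) (cf : Cinfty f)
  (mq : measurable_fun Omega q) (bq1 : bounded_measurable Omega q1)
  (qq1 : {ae mu, forall x, Omega x -> q x = q1 x}).
Variables (phi : nat -> 'rV[R]_n -> R) (w : 'rV[R]_n -> R) (G : 'I_n -> 'rV[R]_n -> R).
Hypotheses (tphi : forall k, test_function Omega (phi k))
  (mw : measurable_fun setT w) (sw : sqi mu Omega w) (cw : cvg_sqi mu Omega phi w)
  (HG : forall i, [/\ measurable_fun setT (G i), sqi mu Omega (G i) &
     cvg_sqi mu Omega (fun k => partial i (phi k)) (G i)])
  (weq : forall psi, test_function Omega psi ->
    \int[mu]_(x in Omega) (- (dot (grad f x) (\row_i G i x) * psi x) - q1 x * w x * psi x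
       + eps * dot (\row_i G i x) (\row_i partial i psi x)) =
    E * \int[mu]_(x in Omega) (w x * psi x)).

Let mO : measurable Omega. Proof. exact: open_measurable_rV. Qed.
Let damp (t : R) : R := expR (- E * t).
Let u t x := damp t * w x.
Let Gt t x : 'rV[R]_n := \row_i (damp t * G i x).

Let stest psi : test_function Omega psi -> sqi mu Omega psi.
Proof. by move=> t; exact: test_function_sqi t mO. Qed.

Let damp_cts : continuous damp.
Proof.
move=> t; apply: (@continuous_comp _ _ _ (fun s => - E * s) expR); last exact: continuous_expR.
by apply: cvgM; [exact: cvg_cst|exact: cvg_id].
Qed.

Let L2sq_damp (c : R) g : sqi mu Omega g ->
  L2sq Omega (fun x => c * g x) = (c ^+ 2 * \int[mu]_(x in Omega) (g x ^+ 2))%:E.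
Proof.
move=> sg; rewrite [LHS](sqi_EFin mO (sqiZ mO c sg)) -RintegralZl//; last exact: sqi_sqr_integrable.
by congr EFin; apply: eq_Rintegral => x _; rewrite exprMn.
Qed.

Let int_damp_lty (c : R) : (\int[leb]_(t in `]0%R, T[) ((damp t) ^+ 2 * c)%:E < +oo)%E.
Proof.
have mI : measurable (`]0, T[ : set (measurableTypeR R)) by exact: measurable_itv.
have lI : (leb `]0%R, T[ < +oo)%E.
  by rewrite lebesgue_measure_itv/= lte_fin T0 -EFinB ltry.
have i : leb.-integrable `]0%R, T[ (EFin \o (fun t => damp t ^+ 2 * c)).
  apply: bounded_integrable => //.
    apply: measurable_funM => //; apply: measurable_funX; apply: measurable_funTS.
    exact: continuous_measurable_fun.
  exists (expR (`|E| * T) ^+ 2 * `|c|) => t; rewrite /= in_itv/= => /andP[t0 tT].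
  rewrite normrM (ger0_norm (sqr_ge0 _)) ler_wpM2r// lerXn2r ?nnegrE ?expR_ge0//.
  rewrite ler_expR; apply: (le_trans (ler_norm _)); rewrite normrM normrN ler_wpM2l//.
  by rewrite gtr0_norm// ltW.
exact: (integrable_lty mI i).
Qed.

Let H10_damp (t : R) : H10 Omega (u t) (Gt t).
Proof.
have cz (v : nat -> 'rV[R]_n -> R) g : (forall k, sqi mu Omega (v k)) -> sqi mu Omega g ->
    cvg_sqi mu Omega v g -> cvg_sqi mu Omega (fun k x => damp t * v k x) (fun x => damp t * g x).
  move=> sv sg cv; rewrite /cvg_sqi.
  rewrite (_ : (fun k => _) = fun k => damp t ^+ 2 * \int[mu]_(x in Omega) ((v k x - g x) ^+ 2)).
    by rewrite -[X in _ --> X](mulr0 (damp t ^+ 2)); apply: cvgM; [exact: cvg_cst|exact: cv].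
  apply/funext => k; rewrite -RintegralZl//; last by apply: sqi_sqr_integrable => //; exact: sqiB.
  by apply: eq_Rintegral => x _; rewrite -exprMn mulrBr.
apply: (@H10_limit R n Omega oO (fun k x => damp t * phi k x) (u t) (fun i x => damp t * G i x)).
- by move=> k; exact: test_functionZ.
- exact: sqiZ.
- by apply: cz => // k; exact: stest.
- move=> i; have [_ sG cG] := HG i; split; first exact: sqiZ.
  rewrite (_ : (fun k => _) = fun k x => damp t * partial i (phi k) x).
    by apply: cz => // k; apply: stest; exact: test_function_derive.
  by apply/funext => k; rewrite (partialZ (damp t) i (test_Cinfty (tphi k))).
Qed.

Let dotZ (c : R) (v z : 'rV[R]_n) : dot v (c *: z) = c * dot v z.
Proof. by rewrite /dot mulr_sumr; apply: eq_bigr => i _; rewrite mxE mulrCA. Qed.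

Let dotZl (c : R) (v z : 'rV[R]_n) : dot (c *: v) z = c * dot v z.
Proof. by rewrite /dot mulr_sumr; apply: eq_bigr => i _; rewrite mxE mulrA. Qed.

Let GtE t x : Gt t x = damp t *: (\row_i G i x).
Proof. by apply/rowP => i; rewrite !mxE. Qed.

Let integrable_dot (V W : 'rV[R]_n -> 'rV[R]_n) :
  (forall i, mu.-integrable Omega (EFin \o (fun x => V x ord0 i * W x ord0 i))) ->
  mu.-integrable Omega (EFin \o (fun x => dot (V x) (W x))).
Proof.
move=> H; rewrite /dot; elim: (index_enum 'I_n) => [|i s IH].
  rewrite (_ : (EFin \o _) = cst 0%E); first exact: integrable0.
  by apply/funext => x; rewrite /= big_nil.
rewrite (_ : (fun x => _) = fun x => V x ord0 i * W x ord0 i + \sum_(j <- s) V x ord0 j * W x ord0 j).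
  exact: integrable_funD.
by apply/funext => x; rewrite big_cons.
Qed.

(** At a fixed time, [weq] for the slice of psi replaces the spatial terms by E w psi, and what
    remains is w times an exact time derivative. *)
Lemma separable_equation (psi : R * 'rV[R]_n -> R) (t : R) :
  test_function (`]0, T[ `*` Omega) psi ->
  \int[mu]_(x in Omega) (- (u t x * time_partial psi t x) - dot (grad f x) (Gt t x) * psi (t, x)
     - q x * u t x * psi (t, x) + eps * dot (Gt t x) (space_grad psi t x)) =
  \int[mu]_(x in Omega) (w x * (damp t * (- time_partial psi t x + E * psi (t, x)))).
Proof.
move=> tpsi; have ts := slice_test t tpsi.
have tts : test_function Omega (fun x => time_partial psi t x).
  exact: (slice_test t (test_function_derive ((1, 0) : R * 'rV[R]_n) tpsi)).
have iprod (h k : 'rV[R]_n -> R) : sqi mu Omega h -> test_function Omega k ->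
    mu.-integrable Omega (EFin \o (fun x => h x * k x)).
  by move=> sh tk; apply: sqi_mul => //; exact: stest.
have sgE x : space_grad psi t x = \row_i partial i (fun y => psi (t, y)) x.
  by apply/rowP => i; rewrite !mxE slice_partial.
pose B x := - (dot (grad f x) (\row_i G i x) * psi (t, x)) - q1 x * w x * psi (t, x)
       + eps * dot (\row_i G i x) (\row_i partial i (fun y => psi (t, y)) x).
have sq1w : sqi mu Omega (fun x => q1 x * w x) by case: bq1 => m1 b1; exact: sqiM_bounded.
have i1 : mu.-integrable Omega (EFin \o (fun x => dot (grad f x) (\row_i G i x) * psi (t, x))).
  have := @integrable_dot (fun x => \row_i G i x) (fun x => psi (t, x) *: grad f x) _.
  rewrite (_ : (fun x => dot _ _) = fun x => dot (grad f x) (\row_i G i x) * psi (t, x)); last first.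
    apply/funext => x; rewrite dotZ mulrC; congr (_ * _); apply: eq_bigr => i _; exact: mulrC.
  apply=> i; have [_ sG _] := HG i.
  have := iprod _ _ sG (test_functionM (Cinfty_derive (delta_mx ord0 i) cf) ts).
  by apply: eq_integrable => // x _ /=; rewrite !mxE [psi _ * _]mulrC.
have i2 := iprod _ _ sq1w ts.
have i3 : mu.-integrable Omega (EFin \o
    (fun x => dot (\row_i G i x) (\row_i partial i (fun y => psi (t, y)) x))).
  apply: integrable_dot => i; have [_ sG _] := HG i.
  have := iprod _ _ sG (test_function_derive (delta_mx ord0 i) ts).
  by apply: eq_integrable => // x _ /=; rewrite !mxE.
have i4 := iprod _ _ sw tts.
have iB : mu.-integrable Omega (EFin \o B).
  apply: integrable_funD => //; last exact: integrable_funZ.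
  apply: integrable_funB => //.
  by have := integrable_funZ mO (- 1) i1; apply: eq_integrable => // x _ /=; rewrite mulN1r.
have mq' : measurable_fun Omega (fun x => q x * w x * psi (t, x)).
  apply: measurable_funM; first by apply: measurable_funM => //; exact: measurable_funTS.
  by case: (stest ts).
have iA : mu.-integrable Omega (EFin \o (fun x => damp t * (B x - w x * time_partial psi t x))).
  by apply: integrable_funZ => //; exact: integrable_funB.
transitivity (\int[mu]_(x in Omega) (damp t * (B x - w x * time_partial psi t x))).
  have mA : measurable_fun Omega (fun x => damp t * (B x - w x * time_partial psi t x)).
    by case/integrableP : iA => /measurable_EFinP.
  (* The second summand isolates the difference between q and its bounded representative q1, which
     vanishes almost everywhere. *)
  have eA x : - (u t x * time_partial psi t x) - dot (grad f x) (Gt t x) * psi (t, x)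
     - q x * u t x * psi (t, x) + eps * dot (Gt t x) (space_grad psi t x) =
     damp t * (B x - w x * time_partial psi t x) +
     damp t * (q1 x * w x * psi (t, x) - q x * w x * psi (t, x)).
    by rewrite GtE dotZ dotZl sgE /u /B; ring.
  rewrite /Rintegral; congr fine; apply: ae_eq_integral => //.
  - apply/measurable_EFinP; under eq_fun do rewrite eA.
    apply: measurable_funD => //; apply: measurable_funM => //; apply: measurable_funB => //.
    by case/integrableP : i2 => /measurable_EFinP.
  - exact/measurable_EFinP.
  - move: qq1; apply: filterS => x + Ox; move/(_ Ox) => qx.
    by congr EFin; rewrite eA qx subrr mulr0 addr0.
rewrite RintegralZl//; last exact: integrable_funB.
rewrite RintegralB// [X in X - _](weq ts).
have i5 := iprod _ _ sw ts.
rewrite -RintegralZl// -RintegralB//; last exact: integrable_funZ.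
rewrite -RintegralZl//; last by apply: integrable_funB => //; exact: integrable_funZ.
by apply: eq_Rintegral => x _; ring.
Qed.

Lemma separable_weak_solution : weak_solution Omega f q eps T w u.
Proof.
have W0 : 0 <= \int[mu]_(x in Omega) (w x ^+ 2) by apply: Rintegral_ge0 => x _; exact: sqr_ge0.
split.
- by move=> t _; exact: (sqiZ mO (damp t) sw).
- move=> t _.
  have E1 s : L2sq Omega (u s \- u t) = ((damp s - damp t) ^+ 2 * \int[mu]_(x in Omega) (w x ^+ 2))%:E.
    rewrite -L2sq_damp// /L2sq; apply: eq_integral => x _.
    by rewrite /u /= mulrBl.
  rewrite (funext E1); apply: cvg_within_filter.
  apply: cvg_EFin; first exact: nearW.
  rewrite /= -[X in _ --> X](mul0r (\int[mu]_(x in Omega) (w x ^+ 2))).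
  apply: cvgM; last exact: cvg_cst.
  rewrite -[X in _ --> X](expr0n R 2) -(subrr (damp t)).
  by apply: cvgM; apply: cvgB; [exact: damp_cts|exact: cvg_cst|exact: damp_cts|exact: cvg_cst].
- by apply: aeW => x _; rewrite /u /damp mulr0 expR0 mul1r.
- have md : measurable_fun setT damp by exact: continuous_measurable_fun.
  exists Gt; split.
  + split.
      apply: measurable_funTS; apply: measurable_funM.
        by apply: (measurableT_comp md); exact: measurable_fst.
      by apply: (measurableT_comp mw); exact: measurable_snd.
    apply: measurable_funTS; apply: measurable_fun_rVP => i.
    under eq_fun do rewrite mxE; have [mG _ _] := HG i.
    apply: measurable_funM; first by apply: (measurableT_comp md); exact: measurable_fst.
    by apply: (measurableT_comp mG); exact: measurable_snd.
  + split.
      under eq_integral do rewrite L2sq_damp//.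
      exact: int_damp_lty.
    move=> i; have [_ sG _] := HG i.
    rewrite (_ : (fun t => _) = fun t => L2sq Omega (fun x => damp t * G i x)); last first.
      by apply/funext => t; apply: eq_integral => x _; rewrite mxE.
    under eq_integral do rewrite L2sq_damp//.
    exact: int_damp_lty.
  + by apply: aeW => t _; exact: H10_damp.
  + move=> psi tpsi.
    under eq_Rintegral do rewrite separable_equation//.
    exact: space_time_integral0.
Qed.

End weak_solution.

(** * Spectral estimates *)

Section smooth_exponential.
Context (R : realType) (n : nat).
Implicit Types f g : 'rV[R]_n -> R.

(** Restriction to a line makes the one-variable chain rule available for directional
    derivatives. *)
Lemma is_derive_on_line f (x v : 'rV[R]_n) (d : R) :
  is_derive (0 : R) 1 (fun s : R => f (s *: v + x)) d -> is_derive x v f d.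
Proof.
have E : (fun h : R => h^-1 *: (((fun s : R => f (s *: v + x)) \o shift (0 : R)) (h *: (1 : R)) -
      f ((0 : R) *: v + x))) = (fun h => h^-1 *: ((f \o shift x) (h *: v) - f x)).
  by apply/funext => h; rewrite /= scale0r add0r addr0 [h *: _]mulr1.
case; rewrite /derivable /derive E => d1 d2; exact: DeriveDef.
Qed.

Lemma is_derive_expR_comp f (x v : 'rV[R]_n) : Cinfty f ->
  is_derive x v (fun y => expR (f y)) (expR (f x) * 'D_v f x).
Proof.
move=> cf; apply: is_derive_on_line.
have h := is_derive_line v x 0 cf.
have := @is_derive1_comp R expR (fun s : R => f (s *: v + x)) 0 _ _ (is_derive_expR _) h.
by rewrite scale0r add0r.
Qed.

Lemma Cinfty_expR_comp f : Cinfty f -> Cinfty (fun x => expR (f x)).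
Proof.
move=> cf; apply: (@Cinfty_ring_closure _ _ (fun h => h = (fun x => expR (f x)) \/ Cinfty h)); last first.
  by constructor; left.
move=> h [->|ch]; last first.
  split; first exact: Cinfty_continuous.
  move=> v; split => [x|]; first exact: Cinfty_derivable.
  by constructor; right; exact: Cinfty_derive.
split.
  by move=> x; apply: continuous_comp; [exact: Cinfty_continuous|exact: continuous_expR].
move=> v; split => [x|]; first by have [] := is_derive_expR_comp x v cf.
rewrite (_ : 'D_v _ = fun x => expR (f x) * 'D_v f x).
  apply: ring_closure_mul; constructor; first by left.
  by right; exact: Cinfty_derive.
by apply/funext => x; have [] := is_derive_expR_comp x v cf.
Qed.

Lemma partialM i x f g : Cinfty f -> Cinfty g ->
  partial i (fun y => f y * g y) x = f x * partial i g x + g x * partial i f x.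
Proof.
by move=> cf cg; rewrite /partial deriveM; [|exact: Cinfty_derivable..].
Qed.

End smooth_exponential.

Lemma Rintegral_sum d (T : measurableType d) (R : realType) (mu : {measure set T -> \bar R})
  (D : set T) (I : Type) (s : seq I) (h : I -> T -> R) : measurable D ->
  (forall i, mu.-integrable D (EFin \o h i)) ->
  \int[mu]_(x in D) (\sum_(i <- s) h i x) = \sum_(i <- s) \int[mu]_(x in D) h i x.
Proof.
move=> mD ih; suff [] : mu.-integrable D (EFin \o (fun x => \sum_(i <- s) h i x)) /\
  \int[mu]_(x in D) (\sum_(i <- s) h i x) = \sum_(i <- s) \int[mu]_(x in D) h i x by [].
elim: s => [|i s [IH1 IH2]].
  have E : (fun x => \sum_(i <- [::]) h i x) = fun=> 0 by apply/funext => x; rewrite big_nil.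
  rewrite E big_nil; split; first exact: integrable0.
  by rewrite Rintegral_cst// mul0r.
have E : (fun x => \sum_(j <- i :: s) h j x) = fun x => h i x + \sum_(j <- s) h j x.
  by apply/funext => x; rewrite big_cons.
rewrite E; split; first exact: integrable_funD.
by rewrite RintegralD// IH2 big_cons.
Qed.

(** The letters stand for the weight r = exp(f / eps), for v = phi, d = its i-th derivative, and f1,
    f2 = the first and second i-th derivatives of f. Since r' = r f1 / eps, the last bracket is the
    derivative of r f1 v^2. *)
Lemma hardy_identity (R : realFieldType) (eps r v d f1 f2 : R) : 0 < eps ->
  eps * (r * (d * d)) - (4 * eps)^-1 * (r * (v * f1 * (v * f1))) =
  eps * r * (d + v * f1 / (2 * eps)) ^+ 2 + 2^-1 * (r * f2 * v ^+ 2) -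
  2^-1 * (r * (f1 / eps) * f1 * v ^+ 2 + r * f2 * v ^+ 2 + r * f1 * (2 * v * d)).
Proof. by move=> e0; field; rewrite gt_eqF. Qed.

(** Here a = exp(- f / (2 eps)), so that 1 / a^2 is the weight, and a (d - v f1 / (2 eps)) is the
    derivative of a v. The expansion has a cross term without eps; with eps < 1, everything but the
    last term is bounded independently of eps. *)
Lemma trial_energy_bound (R : realFieldType) (eps a d v f1 : R) : a != 0 -> 0 < eps -> eps < 1 ->
  eps * ((a * a)^-1 * (a * (d - v * f1 / (2 * eps)) * (a * (d - v * f1 / (2 * eps))))) <=
    (2 * d ^+ 2 + (v * f1) ^+ 2) + (4 * eps)^-1 * (v * f1) ^+ 2.
Proof.
move=> a0 e0 e1.
have -> : eps * ((a * a)^-1 * (a * (d - v * f1 / (2 * eps)) * (a * (d - v * f1 / (2 * eps))))) =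
   eps * d ^+ 2 - d * (v * f1) + (4 * eps)^-1 * (v * f1) ^+ 2.
  by field; rewrite a0 gt_eqF.
rewrite lerD2r; set b := v * f1.
have h1 : eps * d ^+ 2 <= d ^+ 2 by rewrite ler_piMl ?sqr_ge0// ltW.
have h2 := sqr_ge0 (d + b); have h3 := sqr_ge0 d; have h4 := sqr_ge0 b; rewrite sqrrD in h2.
rewrite -mulr_natl in h2; lra.
Qed.

Section spectral.
Context (R : realType) (n : nat).
Local Notation mu := (@lebesgue_rV R n).
Variables (Omega : set 'rV[R]_n) (f q : 'rV[R]_n -> R) (fM qM : R).
Hypotheses (oO : open Omega) (cf : Cinfty f) (f0 : forall x, Omega x -> 0 <= f x <= fM)
  (ff : forall i x, Omega x -> 0 <= partial i (partial i f) x)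
  (mq : measurable_fun setT q) (qb : forall x, Omega x -> `|q x| <= qM).
Implicit Types phi psi : 'rV[R]_n -> R.

Let mO : measurable Omega. Proof. exact: open_measurable_rV. Qed.

Definition weight (eps : R) (x : 'rV[R]_n) : R := expR (f x / eps).

Definition sqr_grad (x : 'rV[R]_n) : R := \sum_i (partial i f x) ^+ 2.

Lemma Cinfty_sqr_grad : Cinfty sqr_grad.
Proof.
rewrite /sqr_grad; elim: (index_enum 'I_n) => [|i s IH].
  by under eq_fun do rewrite big_nil; exact: Cinfty_cst.
have cfi := Cinfty_derive (delta_mx ord0 i) cf.
have -> : (fun x => \sum_(j <- i :: s) partial j f x ^+ 2) =
    fun x => partial i f x * partial i f x + \sum_(j <- s) partial j f x ^+ 2.
  by apply/funext => x; rewrite big_cons expr2.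
exact: (CinftyD (CinftyM cfi cfi) IH).
Qed.

Let Cscale (c : R) : Cinfty (fun x => f x * c).
Proof. by apply: CinftyM => //; exact: Cinfty_cst. Qed.

Lemma Cinfty_weight eps : Cinfty (weight eps).
Proof. exact: (Cinfty_expR_comp (Cscale eps^-1)). Qed.

Lemma partial_expR_scale (c : R) i x :
  partial i (fun y => expR (f y * c)) x = expR (f x * c) * (partial i f x * c).
Proof.
have [_ H] := is_derive_expR_comp x (delta_mx ord0 i) (Cscale c).
apply: (etrans H); congr (_ * _).
rewrite (_ : (fun y => f y * c) = fun y => c * f y); last by apply/funext => y; rewrite mulrC.
by rewrite -/(partial i _ x) (partialZ c i cf) mulrC.
Qed.

Lemma weight_bounds eps x : 0 < eps -> Omega x -> 1 <= weight eps x <= expR (fM / eps).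
Proof.
move=> e0 Ox; have /andP[h1 h2] := f0 Ox.
rewrite /weight ler_expR ler_pM2r ?invr_gt0// h2 andbT.
by rewrite -[leLHS]expR0 ler_expR divr_ge0// ltW.
Qed.

Lemma measurable_weight eps : measurable_fun setT (weight eps).
Proof. apply: continuous_measurable_rV; exact: Cinfty_continuous (Cinfty_weight eps). Qed.

(* Completing the square; the error term is half the derivative of
   [weight * partial i f * phi ^+ 2]. *)
Lemma weighted_hardy eps i phi : 0 < eps -> test_function Omega phi ->
  (4 * eps)^-1 * \int[mu]_(x in Omega) (weight eps x * (phi x * partial i f x * (phi x * partial i f x)))
   <= eps * wip mu Omega (weight eps) (partial i phi) (partial i phi).
Proof.
move=> e0 tphi; have cr := Cinfty_weight eps; have cphi := test_Cinfty tphi.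
have cfi := Cinfty_derive (delta_mx ord0 i) cf.
have tpf : test_function Omega (fun x => phi x * partial i f x) := test_functionMr tphi cfi.
pose g x := weight eps x * partial i f x * phi x ^+ 2.
have tg : test_function Omega g := test_functionM (CinftyM cr cfi) (test_function_sqr tphi).
have tdg := test_function_derive (delta_mx ord0 i) tg.
have tdphi := test_function_derive (delta_mx ord0 i) tphi.
have t1 : test_function Omega (fun x => weight eps x * (phi x * partial i f x * (phi x * partial i f x))).
  by apply: (test_functionM cr); exact: (test_functionM (test_Cinfty tpf)).
have t2 : test_function Omega (fun x => weight eps x * (partial i phi x * partial i phi x)).
  by apply: (test_functionM cr); exact: (test_functionM (test_Cinfty tdphi)).
have dg x : partial i g x = weight eps x * (partial i f x / eps) * partial i f x * phi x ^+ 2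
    + weight eps x * partial i (partial i f) x * phi x ^+ 2
    + weight eps x * partial i f x * (2 * phi x * partial i phi x).
  have h1 : is_derive x (delta_mx ord0 i) (weight eps) (weight eps x * (partial i f x / eps)).
    apply: DeriveDef; first exact: Cinfty_derivable.
    exact: partial_expR_scale.
  have h2 : is_derive x (delta_mx ord0 i) (partial i f) (partial i (partial i f) x).
    by apply: DeriveDef => //; exact: Cinfty_derivable.
  have h3 : is_derive x (delta_mx ord0 i) phi (partial i phi x).
    by apply: DeriveDef => //; exact: Cinfty_derivable.
  have := is_deriveM (is_deriveM h1 h2) (is_deriveM h3 h3).
  rewrite (_ : (weight eps * partial i f) * (phi * phi) = g); last first.
    by apply/funext => y; rewrite /g /= expr2.
  case=> _; rewrite -/(partial i g x) => ->; rewrite /GRing.scale/= !fctE.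
  by rewrite expr2; ring.
have z : \int[mu]_(x in Omega) partial i g x = 0.
  by rewrite (Rintegral_support mu (fun x => test_function_outside tdg (x := x))); exact: (Rintegral_derive0 _ tg).
have i1 := test_function_integrable t1 mO; have i2 := test_function_integrable t2 mO.
have i3 := test_function_integrable tdg mO.
rewrite wip.unlock -(RintegralZl _ _ i1)// -(RintegralZl _ _ i2)// -subr_ge0.
rewrite -(RintegralB _ (integrable_funZ mO _ i2) (integrable_funZ mO _ i1))//.
rewrite -[leLHS](mulr0 (- 2^-1)) -z -(RintegralZl _ _ i3)//.
apply: le_Rintegral => //.
- exact: integrable_funZ.
- by apply: integrable_funB => //; exact: integrable_funZ.
move=> x Ox; rewrite (hardy_identity _ _ _ _ (partial i (partial i f) x) e0).
(* Dropping the square and the convexity term, both nonnegative, leaves an exact derivative, whose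
   integral is 0. *)
rewrite -/(partial i g x) dg mulNr lerDr.
apply: addr_ge0; first by rewrite mulr_ge0 ?sqr_ge0// mulr_ge0 ?expR_ge0// ltW.
by rewrite mulr_ge0// mulr_ge0 ?sqr_ge0// mulr_ge0 ?expR_ge0// ff.
Qed.

Lemma sqr_grad_le_energy eps phi : 0 < eps -> test_function Omega phi ->
  (4 * eps)^-1 * \int[mu]_(x in Omega) (weight eps x * (sqr_grad x * phi x ^+ 2)) <=
  energy Omega (weight eps) q eps phi phi + qM * mass Omega (weight eps) phi phi.
Proof.
move=> e0 tphi; have cr := Cinfty_weight eps.
have t1 i : test_function Omega (fun x => weight eps x * (phi x * partial i f x * (phi x * partial i f x))).
  have cfi := Cinfty_derive (delta_mx ord0 i) cf.
  have tpf : test_function Omega (fun x => phi x * partial i f x) := test_functionMr tphi cfi.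
  by apply: (test_functionM cr); exact: (test_functionM (test_Cinfty tpf)).
have -> : \int[mu]_(x in Omega) (weight eps x * (sqr_grad x * phi x ^+ 2)) = \sum_i
   \int[mu]_(x in Omega) (weight eps x * (phi x * partial i f x * (phi x * partial i f x))).
  rewrite -(Rintegral_sum _ mO (fun i => test_function_integrable (t1 i) mO)).
  apply: eq_Rintegral => x _; rewrite -mulr_sumr /sqr_grad mulr_suml; congr (_ * _).
  by apply: eq_bigr => i _; rewrite !expr2; ring.
have P := potential_le_mass oO (measurable_weight eps) (fun x => weight_bounds e0 (x := x)) mq qb tphi.
move: P; rewrite ler_norml => /andP[_ P].
rewrite /energy -addrA -[leLHS]addr0; apply: lerD; last by rewrite addrC subr_ge0.
by rewrite !mulr_sumr; apply: ler_sum => i _; exact: weighted_hardy.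
Qed.

(** The factor exp(- f / (2 eps)) cancels the weight, so the mass of the trial function does not
    depend on eps. The order of the quantifiers is the point: C is chosen before eps. *)
Lemma trial_energy (U : set 'rV[R]_n) psi (B : R) : U `<=` Omega ->
  (forall x, U x -> sqr_grad x <= B) -> test_function U psi -> exists C : R,
  forall eps, 0 < eps -> eps < 1 -> exists chi, [/\ test_function Omega chi,
    mass Omega (weight eps) chi chi = \int[mu]_(x in Omega) (psi x ^+ 2) &
    energy Omega (weight eps) q eps chi chi <=
      C + (4 * eps)^-1 * (B * \int[mu]_(x in Omega) (psi x ^+ 2))].
Proof.
move=> UO gB tpsiU; have tpsi := test_functionS UO tpsiU; have cpsi := test_Cinfty tpsi.
have cfi i := Cinfty_derive (delta_mx ord0 i) cf.
have tdpsi i := test_function_derive (delta_mx ord0 i) tpsi.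
have tpf i : test_function Omega (fun x => psi x * partial i f x) := test_functionMr tpsi (cfi i).
pose k i x := 2 * partial i psi x ^+ 2 + (psi x * partial i f x) ^+ 2.
have tk i : test_function Omega (k i).
  exact: (test_functionD (test_functionZ 2 (test_function_sqr (tdpsi i))) (test_function_sqr (tpf i))).
pose S := \int[mu]_(x in Omega) (psi x ^+ 2).
exists (\sum_i \int[mu]_(x in Omega) k i x + qM * S) => eps e0 e1.
pose a x := expR (f x * - (2 * eps)^-1).
have ca : Cinfty a by exact: (Cinfty_expR_comp (Cscale _)).
have aw x : weight eps x = (a x * a x)^-1.
  rewrite /weight /a -expRD -expRN; congr expR; field; by rewrite gt_eqF.
have aV x : (a x * a x)^-1 * (a x * a x) = 1 by rewrite mulVf// mulf_neq0 ?gt_eqF ?expR_gt0.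
pose chi x := a x * psi x.
have tchi : test_function Omega chi by exact: test_functionM.
have cr := Cinfty_weight eps.
have dchi i x : partial i chi x = a x * (partial i psi x - psi x * partial i f x / (2 * eps)).
  rewrite (partialM i x ca cpsi) partial_expR_scale -/(a x).
  by ring.
have tdchi i := test_function_derive (delta_mx ord0 i) tchi.
have mE : mass Omega (weight eps) chi chi = S.
  rewrite /mass wip.unlock; apply: eq_Rintegral => x _; rewrite aw /chi.
  by rewrite [X in _ * X]mulrACA [LHS]mulrA (aV x) mul1r -expr2.
exists chi; split => //.
have P := potential_le_mass oO (measurable_weight eps) (fun x => weight_bounds e0 (x := x)) mq qb tchi.
move: P; rewrite ler_norml mE => /andP[P _].
rewrite /energy.
have t2 i : test_function Omega (fun x => weight eps x * (partial i chi x * partial i chi x)).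
  exact: (test_functionM cr (test_functionM (test_Cinfty (tdchi i)) (tdchi i))).
have tf i : test_function Omega (fun x => (psi x * partial i f x) ^+ 2) := test_function_sqr (tpf i).
have ii t (h : test_function Omega t) := test_function_integrable h mO.
have H i : eps * wip mu Omega (weight eps) (partial i chi) (partial i chi) <=
   \int[mu]_(x in Omega) k i x + (4 * eps)^-1 * \int[mu]_(x in Omega) (psi x * partial i f x) ^+ 2.
  rewrite wip.unlock -(RintegralZl _ _ (ii _ (t2 i)))// -(RintegralZl _ _ (ii _ (tf i)))//.
  rewrite -(RintegralD _ (ii _ (tk i)) (integrable_funZ mO _ (ii _ (tf i))))//.
  apply: le_Rintegral => //.
  - by apply: integrable_funZ => //; exact: ii.
  - by apply: integrable_funD => //; [exact: ii|apply: integrable_funZ => //; exact: ii].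
  move=> x _; rewrite aw dchi; by apply: trial_energy_bound; rewrite // gt_eqF// expR_gt0.
have G : \sum_i \int[mu]_(x in Omega) (psi x * partial i f x) ^+ 2 <= B * S.
  rewrite -(Rintegral_sum _ mO (fun i => ii _ (tf i))) /S -(RintegralZl _ _ (ii _ (test_function_sqr tpsi)))//.
  apply: le_Rintegral => //.
  - rewrite (_ : (fun x => _) = fun x => sqr_grad x * psi x ^+ 2).
      exact: (ii _ (test_functionM Cinfty_sqr_grad (test_function_sqr tpsi))).
    apply/funext => x; rewrite /sqr_grad mulr_suml; apply: eq_bigr => i _.
    by rewrite exprMn mulrC.
  - by apply: integrable_funZ => //; apply: ii; exact: test_function_sqr.
  move=> x _; have -> : \sum_i (psi x * partial i f x) ^+ 2 = sqr_grad x * psi x ^+ 2.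
    by rewrite /sqr_grad mulr_suml; apply: eq_bigr => i _; rewrite exprMn mulrC.
  have [Ux|nU] := pselect (U x); first by rewrite ler_wpM2r ?sqr_ge0// gB.
  by rewrite (test_function_outside tpsiU nU) expr0n/= !mulr0.
rewrite mulr_sumr.
have H' := ler_sum (index_enum 'I_n) (fun i (_ : true) => H i).
rewrite big_split/= in H'.
rewrite -addrA -/S [_ + (4 * eps)^-1 * _]addrC addrA.
apply: lerD; last by rewrite lerNl.
apply: (le_trans H').
by rewrite lerD2l -mulr_sumr ler_wpM2l// invr_ge0 mulr_ge0// ltW.
Qed.

End spectral.

(** Extension by zero followed by truncation at the essential bound. The variational problem uses
    pointwise bounds and measurability on the whole space, while the weak formulation sees q only
    almost everywhere. *)
Lemma Linfty_bounded_representative (R : realType) (n : nat) (A Omega : set 'rV[R]_n) (q : 'rV[R]_n -> R) :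
  measurable Omega -> measurable A -> Omega `<=` A -> Linfty A q ->
  exists (q1 : 'rV[R]_n -> R) (qM : R), [/\ measurable_fun setT q1, forall x, `|q1 x| <= qM &
    {ae @lebesgue_rV R n, forall x, Omega x -> q x = q1 x}].
Proof.
move=> mO mA OA [mq [M HM]]; pose qM := `|M|.
exists (fun x => Num.max (- qM) (Num.min qM ((q \_ Omega) x))), qM; split.
- apply: measurable_maxr => //; apply: measurable_minr => //.
  by apply/(measurable_restrictT _ mO); exact: measurable_funS mq.
- move=> x; rewrite ler_norml le_max lexx/= ge_max ge_min lexx/= andbT.
  by rewrite (@le_trans _ _ 0)// ?oppr_le0 normr_ge0.
- move: HM; apply: filterS => x Hx Ox; have := Hx (OA _ Ox).
  move=> /le_trans /(_ (ler_norm M)); rewrite -/qM ler_norml => /andP[h1 h2].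
  by rewrite patchE mem_set// min_r// max_r.
Qed.

(** The left side is c y p (1 - (g - 1) / k). Where c y <= 1 the last factor is at most 1; where g
    >= 1 + k it is nonpositive. It is used with y the weight, g the squared gradient of f, p = phi^2
    and c = exp(- fs / eps). *)
Lemma concentration_ineq (R : realFieldType) (k c y g p : R) : 0 < k -> 0 <= p -> 0 <= c -> 0 <= y ->
  (c * y <= 1) || (1 + k <= g) -> 1 <= g ->
  c * ((1 + k^-1) * (y * p) - k^-1 * (y * (g * p))) <= p.
Proof.
move=> k0 p0 c0 y0 H g1.
have -> : c * ((1 + k^-1) * (y * p) - k^-1 * (y * (g * p))) = c * y * p * (1 - (g - 1) / k).
  by field; rewrite gt_eqF.
have cyp : 0 <= c * y * p by rewrite !mulr_ge0.
case/orP : H => H.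
  apply: (@le_trans _ _ (c * y * p * 1)).
    by rewrite ler_wpM2l// gerBl divr_ge0 ?subr_ge0// ltW.
  by rewrite mulr1 ler_piMl.
by apply: (le_trans _ p0); rewrite mulr_ge0_le0// subr_le0 ler_pdivlMr// mul1r lerBrDl.
Qed.

(** * Concentration of almost minimizers *)

Section concentration.
Context (R : realType) (n : nat).
Local Notation mu := (@lebesgue_rV R n).
Variables (Omega : set 'rV[R]_n) (f q : 'rV[R]_n -> R) (fM qM : R).
Hypotheses (oO : open Omega) (cf : Cinfty f) (f0 : forall x, Omega x -> 0 <= f x <= fM)
  (ff : forall i x, Omega x -> 0 <= partial i (partial i f) x)
  (g1 : forall x, Omega x -> 1 <= sqr_grad f x)
  (mq : measurable_fun setT q) (qb : forall x, Omega x -> `|q x| <= qM).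
Variables (eps E : R) (phi : 'rV[R]_n -> R).
Hypotheses (e0 : 0 < eps) (tphi : test_function Omega phi)
  (mphi : mass Omega (weight f eps) phi phi = 1)
  (ephi : energy Omega (weight f eps) q eps phi phi <= E).

Let mO : measurable Omega. Proof. exact: open_measurable_rV. Qed.

Let tphi2 : test_function Omega (fun x => phi x ^+ 2).
Proof. exact: test_function_sqr. Qed.

Let twphi2 : test_function Omega (fun x => weight f eps x * phi x ^+ 2).
Proof. exact: (test_functionM (Cinfty_weight cf eps) tphi2). Qed.

Let twgphi2 : test_function Omega (fun x => weight f eps x * (sqr_grad f x * phi x ^+ 2)).
Proof. exact: (test_functionM (Cinfty_weight cf eps) (test_functionM (Cinfty_sqr_grad cf) tphi2)). Qed.

Let mass_sqr : \int[mu]_(x in Omega) (weight f eps x * phi x ^+ 2) = 1.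
Proof. by rewrite -mphi /mass wip.unlock; apply: eq_Rintegral => x _; rewrite expr2. Qed.

Let gradE : \int[mu]_(x in Omega) (weight f eps x * (sqr_grad f x * phi x ^+ 2)) <= 4 * eps * (E + qM).
Proof.
have := sqr_grad_le_energy oO cf f0 ff mq qb e0 tphi.
rewrite mphi mulr1 mulrC ler_pdivrMr ?mulr_gt0// => h; apply: (le_trans h).
by rewrite mulrC ler_pM2l ?mulr_gt0// lerD2r.
Qed.

Lemma energy_ge : 1 <= 4 * eps * (E + qM).
Proof.
rewrite -[leLHS]mass_sqr; apply: le_trans gradE.
apply: le_Rintegral => //; [exact: test_function_integrable twphi2 mO|
  exact: test_function_integrable twgphi2 mO|].
move=> x Ox; rewrite ler_wpM2l ?expR_ge0//.
by rewrite ler_peMl ?sqr_ge0// g1.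
Qed.

(** Integrating [concentration_ineq] against total weighted mass 1 gives at least c (1 + 1/k - I /
    k), where the weighted gradient integral I is at most 1 + k / 2 by the energy bound; the bracket
    is then at least 1 / 2. *)
Lemma concentration (fs k : R) : 0 < k -> (forall x, Omega x -> fs < f x -> 1 + k <= sqr_grad f x) ->
  4 * eps * (E + qM) <= 1 + k / 2 ->
  expR (- (fs / eps)) / 2 <= \int[mu]_(x in Omega) (phi x ^+ 2).
Proof.
move=> k0 Hs HE; set c := expR _.
have c0 : 0 <= c by exact: expR_ge0.
have i1 := test_function_integrable twphi2 mO; have i2 := test_function_integrable twgphi2 mO.
have i3 := test_function_integrable tphi2 mO.
have iB := integrable_funB mO (integrable_funZ mO (1 + k^-1) i1) (integrable_funZ mO k^-1 i2).
have H : \int[mu]_(x in Omega) (c * ((1 + k^-1) * (weight f eps x * phi x ^+ 2) -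
    k^-1 * (weight f eps x * (sqr_grad f x * phi x ^+ 2)))) <= \int[mu]_(x in Omega) (phi x ^+ 2).
  apply: le_Rintegral => //; first exact: integrable_funZ.
  move=> x Ox; apply: concentration_ineq; rewrite ?sqr_ge0 ?expR_ge0 ?g1//.
  have [h|h] := leP (f x) fs; last by rewrite Hs// orbT.
  rewrite /c /weight -expRD -[leRHS]expR0 ler_expR addrC subr_le0.
  by rewrite ler_pM2r ?invr_gt0// h.
apply: le_trans H; rewrite RintegralZl//.
rewrite (RintegralB _ (integrable_funZ mO _ i1) (integrable_funZ mO _ i2))//.
rewrite (RintegralZl _ _ i1)// (RintegralZl _ _ i2)// mass_sqr ler_wpM2l//.
set I := \int[mu]_(x in Omega) _.
have I1 : I <= 1 + k / 2 by apply: le_trans HE; exact: gradE.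
rewrite mulr1; have : k^-1 * I <= k^-1 * (1 + k / 2) by rewrite ler_pM2l ?invr_gt0.
have -> : k^-1 * (1 + k / 2) = k^-1 + 2^-1 by field; rewrite gt_eqF.
by move: (k^-1 * I) (k^-1) => a b; lra.
Qed.

Lemma decay (omega : set 'rV[R]_n) (fr : R) : measurable omega -> omega `<=` Omega ->
  (forall x, omega x -> fr <= f x) ->
  \int[mu]_(x in Omega) (\1_omega x * phi x ^+ 2) <= expR (- (fr / eps)).
Proof.
move=> mo oOm Hr; rewrite -[leRHS]mulr1 -[X in _ * X]mass_sqr.
have i1 := test_function_integrable twphi2 mO.
have i3 := test_function_integrable tphi2 mO.
rewrite -(RintegralZl _ _ i1)//; apply: le_Rintegral => //.
- apply: le_integrable i3 => //.
    apply/measurable_EFinP; apply: measurable_funM; first exact: measurable_indic.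
    apply: measurable_funTS; apply: continuous_measurable_rV.
    exact: Cinfty_continuous (test_Cinfty tphi2).
  move=> x _; rewrite /= lee_fin normrM ler_piMl// indicE.
  by case: (_ \in _); rewrite ?normr1 ?normr0.
- exact: integrable_funZ.
move=> x Ox; rewrite mulrA ler_wpM2r ?sqr_ge0// /weight -expRD indicE.
have [/set_mem ox|_] := boolP (x \in omega); last by rewrite expR_ge0.
rewrite -[leLHS]expR0 ler_expR addrC subr_ge0 ler_pM2r ?invr_gt0//; exact: Hr.
Qed.

End concentration.

(** Of the allowed excess k / 2, one half comes from the trial function and the other from the terms
    that eps makes small. The entry 1 in the minimum yields the sign of E. Energies enter as E + 1
    because the estimates are applied to almost minimizers. *)
Lemma small_eps_bounds (R : realFieldType) (eps E C qM k : R) : 0 < eps -> 0 <= C -> 0 < k ->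
  E <= C + (4 * eps)^-1 * (1 + k / 4) -> 4 * eps * (C + 1 + qM) <= Num.min 1 (k / 4) ->
  1 <= 4 * eps * (E + 1 + qM) -> 4 * eps * (E + 1 + qM) <= 1 + k / 2 /\ 0 <= E.
Proof.
move=> e0 C0 k0 EC; rewrite le_min => /andP[h1 h2] h3.
have h4 : 4 * eps * E <= 4 * eps * C + (1 + k / 4).
  have := ler_wpM2l (ltW (mulr_gt0 (ltr0n R 4) e0)) EC.
  by rewrite mulrDr mulrA mulfV ?mul1r// gt_eqF// mulr_gt0.
split; first by move: h1 h2 h3 h4; rewrite !mulrDr; lra.
have h5 : 0 <= 4 * eps * C by rewrite !mulr_ge0// ltW.
have : 0 <= 4 * eps * E by move: h1 h3; rewrite !mulrDr; lra.
by rewrite pmulr_rge0// mulr_gt0.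
Qed.

(** W is the initial mass on the domain, d that on omega, and B / (4 eps) the leading part of E.
    Comparing exponents, the squared damping at time T costs 2 E T <= 2 C T + T B / (2 eps), against
    a gain of (fr - fs) / eps. *)
Lemma observability_cost_arith (R : realType) (eps E T C B K0 fs fr W d : R) : 0 < eps -> 0 < T ->
  E <= C + (4 * eps)^-1 * B ->
  expR (- E * T) ^+ 2 * W <= K0 ^+ 2 * (T * d) ->
  expR (- (fs / eps)) / 2 <= W -> d <= expR (- (fr / eps)) ->
  fr - fs - T * (B / 2) <= eps * (2 * K0 ^+ 2 * T * expR (2 * C * T)).
Proof.
move=> e0 T0 EC H HW Hd; set gap := fr - fs - _.
(* The inequality 1 + x <= exp(x) turns a bound on the exponential into one on [gap] that is linear
   in eps, so that letting eps tend to 0 gives gap <= 0. *)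
suff H1 : expR (gap / eps) <= 2 * K0 ^+ 2 * T * expR (2 * C * T).
  rewrite -ler_pdivrMl// mulrC; apply: le_trans H1.
  by apply: le_trans (expR_ge1Dx _); rewrite lerDr.
have g : gap / eps <= fr / eps - fs / eps + 2 * C * T - 2 * E * T.
  have -> : gap / eps = fr / eps - fs / eps - 2 * T * ((4 * eps)^-1 * B).
    by rewrite /gap; field; rewrite gt_eqF.
  have := ler_wpM2l (ltW (mulr_gt0 (ltr0n R 2) T0)) EC.
  by move: ((4 * eps)^-1 * B) (fr / eps) (fs / eps) => b u v; lra.
have h : expR (- E * T) ^+ 2 * expR (- (fs / eps)) <= 2 * K0 ^+ 2 * T * expR (- (fr / eps)).
  have p1 : expR (- E * T) ^+ 2 * (expR (- (fs / eps)) / 2) <= K0 ^+ 2 * (T * expR (- (fr / eps))).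
    apply: le_trans (le_trans H _); first by rewrite ler_wpM2l// sqr_ge0.
    by rewrite ler_wpM2l ?sqr_ge0// ler_wpM2l// ltW.
  have := ler_wpM2l (ler0n R 2) p1.
  by move: (expR (- E * T) ^+ 2) (expR (- (fs / eps))) (expR (- (fr / eps))) => x y z; lra.
have := ler_wpM2r (expR_ge0 (fr / eps + 2 * C * T)) h.
have -> : 2 * K0 ^+ 2 * T * expR (- (fr / eps)) * expR (fr / eps + 2 * C * T) =
    2 * K0 ^+ 2 * T * expR (2 * C * T) by rewrite -mulrA -expRD addKr.
apply: le_trans; rewrite -expRM_natl -!expRD ler_expR; apply: (le_trans g).
by move: (fr / eps) (fs / eps) => u v; lra.
Qed.

(** * Slowly decaying solutions and the observability time *)

Section slow_decay.
Context (R : realType) (n : nat).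
Local Notation mu := (@lebesgue_rV R n).
Local Notation leb := (@lebesgue_measure R).
Variables (Omega omega U A : set 'rV[R]_n) (f q : 'rV[R]_n -> R) (K fM k fs fr : R).
Hypotheses (oO : open Omega) (K0 : 0 < K) (OK : forall x, Omega x -> forall i, - K <= x ord0 i < K)
  (oU : open U) (U0 : U !=set0) (UO : U `<=` Omega)
  (mo : measurable omega) (omO : omega `<=` Omega)
  (mA : measurable A) (OA : Omega `<=` A) (qA : Linfty A q)
  (cf : Cinfty f) (f0 : forall x, Omega x -> 0 <= f x <= fM)
  (ff : forall i x, Omega x -> 0 <= partial i (partial i f) x)
  (g1 : forall x, Omega x -> 1 <= sqr_grad f x) (k0 : 0 < k)
  (gU : forall x, U x -> sqr_grad f x <= 1 + k / 4)
  (gs : forall x, Omega x -> fs < f x -> 1 + k <= sqr_grad f x)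
  (gr : forall x, omega x -> fr <= f x).

Let mO : measurable Omega. Proof. exact: open_measurable_rV. Qed.

Let Ofin : (mu Omega < +oo)%E.
Proof.
apply: (@bounded_lebesgue_rV_lty _ _ _ K) => // x Ox i.
by rewrite ler_norml; have /andP[-> /ltW ->] := OK Ox i.
Qed.

Lemma slow_solution : exists C e1 : R, [/\ 0 <= C, 0 < e1 & forall eps, 0 < eps -> eps < e1 ->
  exists (E : R) (w : 'rV[R]_n -> R), [/\ 0 <= E, E <= C + (4 * eps)^-1 * (1 + k / 4), sqi mu Omega w,
    forall T, 0 < T -> weak_solution Omega f q eps T w (fun t x => expR (- E * t) * w x) &
    expR (- (fs / eps)) / 2 <= \int[mu]_(x in Omega) (w x ^+ 2) /\
    \int[mu]_(x in Omega) (\1_omega x * w x ^+ 2) <= expR (- (fr / eps))]].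
Proof.
have [q1 [qM [mq1 q1M qq1]]] := Linfty_bounded_representative mO mA OA qA.
have qM0 : 0 <= qM by exact: le_trans (normr_ge0 _) (q1M 0).
have q1M' x : Omega x -> `|q1 x| <= qM by [].
have [p Up] := U0; have [psi tpsi psip] := test_bump oU Up.
have O0 : Omega !=set0 by exists p; exact: UO.
have tpsiO := test_functionS UO tpsi.
have P0 : 0 < \int[mu]_(x in Omega) (psi x ^+ 2).
  have := @mass_gt0 R n Omega (fun=> 1) 1 oO (measurable_cst _) _ psi p tpsiO psip.
  rewrite /mass wip_cst ?mul1r//; last exact: test_function_sqi tpsiO mO.
  by apply=> x _; rewrite lexx.
set P := \int[mu]_(x in Omega) _ in P0.
have [C0 HC0] := @trial_energy R n Omega f q1 fM qM oO cf f0 mq1 q1M' U psi _ UO gU tpsi.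
pose C := `|C0| / P; have C_ge0 : 0 <= C by rewrite divr_ge0// ltW.
have D0 : 0 < C + 1 + qM by rewrite -addrA addrCA ltr_pwDl// addr_ge0.
have m0 : 0 < Num.min 1 (k / 4) by rewrite lt_min ltr01 divr_gt0.
(* The first entry is the range of [trial_energy]; the second is the smallness that
   [small_eps_bounds] asks for. *)
pose e1 := Num.min 1 (Num.min 1 (k / 4) / (4 * (C + 1 + qM))).
exists C, e1; split => //; first by rewrite lt_min ltr01 divr_gt0// mulr_gt0.
move=> eps e0; rewrite lt_min => /andP[eps1 eps2].
have mr := measurable_weight cf eps.
have rb x := @weight_bounds R n Omega f fM f0 eps x e0.
have [E [phi [w [G [Hphi Hmin [mw sw cw] HG weq]]]]] :=
  @ground_state R n Omega K (weight f eps) q1 _ qM eps oO O0 K0 OK mr rb mq1 q1M' e0.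
have tphi j : test_function Omega (phi j) by case: (Hphi j).
have [chi [tchi mchi echi]] := HC0 eps e0 eps1.
have EC : E <= C + (4 * eps)^-1 * (1 + k / 4).
  have := le_trans (Hmin _ tchi) echi; rewrite mchi -/P => h.
  rewrite -(ler_pM2r P0) mulrDl /C divfK ?gt_eqF// -[X in _ <= _ + X]mulrA.
  by apply: (le_trans h); rewrite lerD2r ler_norm.
(* A bound for the whole minimizing sequence. The loss of 1 becomes O(eps) after multiplication by 4
   eps, so concentration and decay hold for every [phi j] and pass to the limit w. *)
have E1 j : energy Omega (weight f eps) q1 eps (phi j) (phi j) <= E + 1.
  have [_ _ h] := Hphi j; apply: (le_trans h); rewrite lerD2l exprn_ile1//.
  by rewrite invf_le1// ler1n.
have mj j : mass Omega (weight f eps) (phi j) (phi j) = 1 by case: (Hphi j).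
have small : 4 * eps * (C + 1 + qM) <= Num.min 1 (k / 4).
  by rewrite mulrAC -ler_pdivlMl ?mulr_gt0// mulrC ltW.
have [HE E_ge0] := small_eps_bounds e0 C_ge0 k0 EC small
  (energy_ge oO cf f0 ff g1 mq1 q1M' e0 (tphi 0) (mj 0) (E1 0)).
have stest j : sqi mu Omega (phi j) by exact: test_function_sqi (tphi j) mO.
exists E, w; split => //.
- move=> T T0; have mqO : measurable_fun Omega q by apply: measurable_funS qA.1.
  have bq1 : bounded_measurable Omega q1 by split; [exact: measurable_funTS|exists qM].
  apply: (@separable_weak_solution R n Omega f q q1 eps T E oO Ofin T0 cf mqO bq1 qq1 phi w G) => //.
  have sG i : sqi mu Omega (G i) by case: (HG i).
  have cscale (c : R) : Cinfty (fun x => f x * c) by apply: CinftyM => //; exact: Cinfty_cst.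
  have NE : (fun x => expR (- (f x / eps))) = fun x => expR (f x * (- eps^-1)).
    by apply/funext => x; rewrite mulrN.
  apply: (eigenfunction_unweighted oO e0 cf sw sG bq1 _ _ weq).
    by rewrite NE; exact: Cinfty_expR_comp.
  move=> i x; rewrite NE (partial_expR_scale cf) !mulrN mulNr; exact: erefl.
- split.
  + have b1 : exists C : R, forall x : 'rV[R]_n, Omega x -> `|1 : R| <= C by exists 1 => x _; rewrite normr1.
    have c1 := cvg_sqi_sqr mO stest sw (measurable_cst (1 : R)) b1 cw.
    have e (g : 'rV[R]_n -> R) : \int[mu]_(x in Omega) (1 * g x ^+ 2) = \int[mu]_(x in Omega) (g x ^+ 2).
      by apply: eq_Rintegral => x _; rewrite mul1r.
    rewrite -e; apply: (cvgr_to_ge c1); apply: nearW => j; rewrite e.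
    exact: (concentration oO cf f0 ff g1 mq1 q1M' e0 (tphi j) (mj j) (E1 j) k0 gs HE).
  + have b1 : exists C : R, forall x : 'rV[R]_n, Omega x -> `|\1_omega x : R| <= C.
      by exists 1 => x _; rewrite indicE; case: (_ \in _); rewrite ?normr1 ?normr0.
    have m1 : measurable_fun Omega (\1_omega : 'rV[R]_n -> R) by exact: measurable_indic.
    have c1 := cvg_sqi_sqr mO stest sw m1 b1 cw.
    apply: (cvgr_to_le c1); apply: nearW => j.
    exact: (decay oO cf e0 (tphi j) (mj j) mo omO gr).
Qed.

Let L2sq_damped (E t : R) (w : 'rV[R]_n -> R) (D : set 'rV[R]_n) : measurable D -> D `<=` Omega ->
  sqi mu Omega w ->
  L2sq D (fun x => expR (- E * t) * w x) =
  (expR (- E * t) ^+ 2 * \int[mu]_(x in Omega) (\1_D x * w x ^+ 2))%:E.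
Proof.
move=> mD DO [mw fw]; have sD : sqi mu D w.
  split; first exact: measurable_funS mw.
  apply: le_lt_trans fw; apply: ge0_subset_integral => //.
    by apply/measurable_EFinP; exact: measurable_funX.
  by move=> x _; rewrite lee_fin sqr_ge0.
rewrite [LHS](sqi_EFin mD (sqiZ mD _ sD)); congr EFin.
have -> : \int[mu]_(x in D) (expR (- E * t) * w x) ^+ 2 =
    \int[mu]_(x in D) (expR (- E * t) ^+ 2 * w x ^+ 2).
  by apply: eq_Rintegral => x _; rewrite exprMn.
rewrite (RintegralZl _ _ (sqi_sqr_integrable sD))//; congr (_ * _).
rewrite Rintegral_mkcond [RHS](Rintegral_support mu) => [|x nO]; last first.
  by rewrite indicE memNset ?mul0r// => /DO.
apply: eq_Rintegral => x _; rewrite patchE indicE.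
by case: (_ \in _); rewrite ?mul1r ?mul0r.
Qed.

(** Since E >= 0, the mass on omega is largest at time 0, so its time integral is at most T times
    the initial value. This crude bound costs a factor free of eps, which is negligible against the
    exponentials. *)
Lemma observability_time_ge (T : R) : 0 < T -> uniformly_observable Omega f q omega T ->
  fr - fs <= T * ((1 + k / 4) / 2).
Proof.
move=> T0 [C1 [e0 [C10 e00 obs]]]; have [C [e1 [C0 e10 slow]]] := slow_solution.
rewrite -subr_le0; apply/ler_addgt0Pl => d d0; rewrite addr0.
pose Q := 2 * C1 ^+ 2 * T * expR (2 * C * T).
have Q0 : 0 < Q by rewrite !mulr_gt0 ?exprn_gt0 ?expR_gt0.
(* Small enough for observability and for [slow_solution], and such that eps Q <= d for the
   arbitrary slack d. *)
pose eps := Num.min (Num.min e0 e1 / 2) (d / Q).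
have eps0 : 0 < eps by rewrite lt_min !divr_gt0// lt_min e00.
have epsm : eps < Num.min e0 e1.
  rewrite gt_min; apply/orP; left.
  by rewrite ltr_pdivrMr// ltr_pMr ?ltr1n// lt_min e00.
move: epsm; rewrite lt_min => /andP[epse0 epse1].
have [E [w [E0 EC sw weak [HW Hd]]]] := slow eps eps0 epse1.
have [C2 /andP[C20 C21] ob] := obs eps (introT andP (conj eps0 epse0)).
have {ob} := ob w _ sw (weak T T0).
rewrite L2sq_damped// => ob.
have IT : \int[mu]_(x in Omega) (\1_Omega x * w x ^+ 2) = \int[mu]_(x in Omega) (w x ^+ 2).
  by apply: eq_Rintegral => x xO; rewrite indicE xO mul1r.
rewrite IT in ob.
set I := \int[mu]_(x in Omega) (\1_omega x * w x ^+ 2) in Hd.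
have I0 : 0 <= I by apply: Rintegral_ge0 => x _; rewrite mulr_ge0 ?sqr_ge0// indicE.
have mI : measurable (`]0, T[ : set (measurableTypeR R)) by exact: measurable_itv.
have lI : leb `]0, T[%classic = T%:E by rewrite lebesgue_measure_itv/= lte_fin T0 oppr0 adde0.
have J : (\int[leb]_(t in `]0%R, T[) L2sq omega (fun x => (expR (- E * t) * w x)%R) <= (T * I)%:E)%E.
  apply: (@le_trans _ _ (\int[leb]_(t in `]0%R, T[) I%:E)%E); last first.
    by rewrite integral_cst//= lI -EFinM mulrC.
  under eq_integral do rewrite L2sq_damped//.
  apply: ge0_le_integral => //.
  - by move=> t _; rewrite lee_fin mulr_ge0 ?sqr_ge0.
  - apply/measurable_EFinP; apply: measurable_funM => //; apply: measurable_funX.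
    apply: measurable_funTS; apply: measurableT_comp; first exact: measurable_expR.
    exact: measurable_funM.
  move=> t; rewrite /= in_itv/= => /andP[t0 _]; rewrite lee_fin ler_piMl// exprn_ile1//.
  by rewrite -[leRHS]expR0 ler_expR mulNr oppr_le0 mulr_ge0// ltW.
have H : expR (- E * T) ^+ 2 * \int[mu]_(x in Omega) (w x ^+ 2) <= C1 ^+ 2 * (T * I).
  rewrite -lee_fin; apply: (le_trans ob); apply: (@le_trans _ _ ((C2 ^+ 2)%:E * (T * I)%:E)%E).
    by apply: lee_wpmul2l => //; rewrite lee_fin sqr_ge0.
  rewrite -EFinM lee_fin ler_wpM2r ?mulr_ge0 ?(ltW T0)//.
  by rewrite ler_pXn2r// nnegrE// ltW.
apply: (le_trans (observability_cost_arith eps0 T0 EC H HW Hd)).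
by rewrite -/Q -ler_pdivlMr// ge_min lexx orbT.
Qed.

End slow_decay.

(** * The gradient flow *)

Section profile.
Context (R : realType).
Variables (alpha D : R).

Definition profile (s : R) : R := s + alpha * D * (s * s) - alpha / 3 * (s * s * s).

(** A concave parabola with value 1 at 0 and its maximum 1 + alpha D^2 at D. Up to D it increases,
    so [profile] is convex there. *)
Definition slope (s : R) : R := 1 + alpha * s * (2 * D - s).

Lemma is_derive_profile (s : R) : is_derive s 1 profile (slope s).
Proof.
have i1 := is_derive_id s (1 : R); have i2 := is_deriveM i1 i1; have i3 := is_deriveM i2 i1.
have := is_deriveB (is_deriveD i1 (is_deriveZ (alpha * D) i2)) (is_deriveZ (alpha / 3) i3).
move=> h; apply: (is_derive_eq h); by rewrite /slope /GRing.scale/= !fctE; field.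
Qed.

Lemma is_derive_slope (s : R) : is_derive s 1 slope (2 * alpha * (D - s)).
Proof.
have i1 := is_derive_id s (1 : R).
have := is_deriveD (is_derive_cst (1 : R) s (1 : R)) (is_deriveM (is_deriveZ alpha i1)
  (is_deriveB (is_derive_cst (2 * D) s (1 : R)) i1)).
move=> h; apply: (is_derive_eq h); rewrite /GRing.scale/= !fctE /cst/=.
by rewrite -[alpha *: s]/(alpha * s); ring.
Qed.

Lemma Cinfty_profile : Cinfty profile.
Proof.
have ci := @Cinfty_id R; have cc c := @Cinfty_cst R R^o c.
apply: (CinftyB (CinftyD ci (CinftyM (cc _) (CinftyM ci ci)))).
exact: (CinftyM (cc _) (CinftyM (CinftyM ci ci) ci)).
Qed.

Hypotheses (a0 : 0 < alpha) (D0 : 0 < D).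

Lemma slope_ge1 s : 0 <= s <= 2 * D -> 1 <= slope s.
Proof.
by move=> /andP[s0 sD]; rewrite /slope lerDl mulr_ge0 ?subr_ge0// mulr_ge0// ltW.
Qed.

Lemma slope_le_max s : slope s <= 1 + alpha * D ^+ 2.
Proof.
have -> : slope s = 1 + alpha * D ^+ 2 - alpha * (D - s) ^+ 2 by rewrite /slope; ring.
by rewrite gerBl mulr_ge0 ?sqr_ge0// ltW.
Qed.

Lemma slope_homo s t : 0 <= s -> s <= t -> t <= D -> slope s <= slope t.
Proof.
move=> s0 st tD; rewrite -subr_ge0.
have -> : slope t - slope s = alpha * (t - s) * (2 * D - s - t) by rewrite /slope; ring.
rewrite mulr_ge0//; first by rewrite mulr_ge0 ?subr_ge0// ltW.
by lra.
Qed.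

Lemma profile_homo s t : 0 <= s -> s <= t -> t <= D -> profile s <= profile t.
Proof.
move=> s0 st tD; have [c cst h] := MVT_segment st (fun x _ => is_derive_profile x)
  (continuous_subspaceT (Cinfty_continuous Cinfty_profile)).
rewrite -subr_ge0 h mulr_ge0 ?subr_ge0//; apply: (le_trans ler01); apply: slope_ge1.
move: cst; rewrite in_itv/= => /andP[c1 c2]; rewrite (le_trans s0)//=.
by rewrite (le_trans (le_trans c2 tD))// ler_peMl ?ler1n// ltW.
Qed.

(* The level [b] is the equilibrium of the Riccati equation s' = - slope s, whose solution
   is written with the exponential instead of the hyperbolic tangent. *)
Lemma slope_flow (b s0 : R) : 0 < b -> alpha * b ^+ 2 = 1 + alpha * D ^+ 2 -> 0 <= s0 <= D ->
  exists s : R -> R, [/\ s 0 = s0, forall t, `|s t - D| < b,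
    forall t : R, is_derive t 1 s (- slope (s t)) & forall t, D < t -> s t < 0].
Proof.
move=> b0 bE /andP[s00 s0D].
have bD : D < b.
  rewrite -(ltr_pXn2r (n := 2))// ?nnegrE ?(ltW D0) ?(ltW b0)//.
  by rewrite -(ltr_pM2l a0) bE ltrDr.
(* With this value at time 0 for y, the formula for s starts at s0. As y is positive, the quotient
   (1 - y) / (1 + y) stays strictly between -1 and 1, which confines s to the strip of radius b
   around D. *)
pose c := (b - (s0 - D)) / (b + (s0 - D)).
have c1 : 0 < b + (s0 - D) by lra.
have c0 : 0 < c by rewrite divr_gt0//; lra.
pose y (t : R) := c * expR (2 * (alpha * b) * t).
have y0 t : 0 < y t by rewrite mulr_gt0 ?expR_gt0.
pose s (t : R) := D + b * ((1 - y t) / (1 + y t)).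
have yD0 t : 1 + y t != 0 by rewrite gt_eqF// addr_gt0.
have dy (t : R) : is_derive t 1 y (2 * (alpha * b) * y t).
  have d1 : is_derive t 1 (fun x : R => 2 * (alpha * b) * x) (2 * (alpha * b)).
    by have := is_deriveZ (2 * (alpha * b)) (is_derive_id t (1 : R)); rewrite /GRing.scale/= mulr1.
  have := is_deriveZ c (@is_derive1_comp R expR (fun x : R => 2 * (alpha * b) * x) t _ _ (is_derive_expR _) d1).
  by move=> h; apply: (is_derive_eq h); rewrite /y /GRing.scale/=; ring.
have slopeE t : slope (s t) = b * (2 * (2 * (alpha * b) * y t) / (1 + y t) ^+ 2).
  have -> : slope (s t) = 1 + alpha * D ^+ 2 - alpha * (s t - D) ^+ 2 by rewrite /slope; ring.
  by rewrite -bE /s; field.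
have ds (t : R) : is_derive t 1 s (- slope (s t)).
  have k1 := is_derive_cst (1 : R) t (1 : R).
  have kd : is_derive t 1 (fun x : R => 1 + y x) (0 + 2 * (alpha * b) * y t) := is_deriveD k1 (dy t).
  pose z (x : R) : R := 1 + y x.
  have kv := @is_deriveV R z t _ _ (yD0 t) kd.
  have := is_deriveD (is_derive_cst D t (1 : R)) (is_deriveZ b
    (is_deriveM (is_deriveB k1 (dy t)) kv)).
  move=> h; apply: (is_derive_eq h); rewrite slopeE /z !fctE /cst /GRing.scale/=.
  by field.
have slope_gt0 t : 0 < slope (s t).
  rewrite slopeE; apply: mulr_gt0 => //; apply: divr_gt0.
    by apply: mulr_gt0 => //; apply: mulr_gt0 => //; apply: mulr_gt0 => //; exact: mulr_gt0.
  by apply: exprn_gt0; exact: addr_gt0.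
have sE0 : s 0 = s0.
  rewrite /s /y mulr0 expR0 mulr1 /c; field; rewrite gt_eqF//=.
  by rewrite (_ : _ + _ = 2 * b) ?mulf_neq0 ?gt_eqF//; ring.
have cs : continuous s.
  by move=> t; apply: differentiable_continuous; apply/derivable1_diffP; have [] := ds t.
have mvt u v : u < v -> exists2 w, u < w < v & s v - s u = - slope (s w) * (v - u).
  move=> uv; have [w] := MVT uv (fun x _ => ds x) (continuous_subspaceT cs).
  by rewrite in_itv/=; exists w.
have dec u v : u < v -> s v < s u.
  move=> uv; have [w _ h] := mvt u v uv; rewrite -subr_lt0 h.
  by rewrite mulNr oppr_lt0 mulr_gt0// subr_gt0.
exists s; split => //.
- move=> t; rewrite /s addrAC subrr add0r normrM gtr0_norm// gtr_pMr//.
  rewrite normrM normfV [X in _ / X]gtr0_norm ?addr_gt0// ltr_pdivrMr ?addr_gt0// mul1r.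
  by rewrite ltr_norml; have := y0 t; move: (y t) => z z0; lra.
- move=> t tD; rewrite ltNge; apply/negP => st0; have t0 := lt_trans D0 tD.
  have [w /andP[w0 wt] h] := mvt 0 t t0.
  (* If s t were nonnegative, s would have stayed in [0, D] since time 0, being decreasing; its
     speed would have been at least 1, and it would have lost at least t > D, more than s0. *)
  have sw : 1 <= slope (s w).
    apply: slope_ge1; apply/andP; split; first by rewrite (le_trans st0)// ltW// dec.
    by have := dec _ _ w0; rewrite sE0; lra.
  move: h; rewrite sE0 subr0 mulNr => h.
  have : t <= slope (s w) * t by rewrite ler_peMl// ltW.
  by lra.
Qed.

End profile.

(** * Compactly supported extensions *)

Section smooth_extension.
Context (R : realType) (n : nat).
Implicit Types phi f : 'rV[R]_n -> R.

Lemma test_function_Wkinfty (k : nat) phi : test_function setT phi -> Wkinfty setT k phi.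
Proof.
have L psi : test_function setT psi -> Linfty setT psi.
  move=> tpsi; have [C HC] := test_function_bounded tpsi.
  split; last by exists C; apply: aeW => x _.
  by apply: continuous_measurable_rV; exact: Cinfty_continuous (test_Cinfty tpsi).
elim: k phi => [|k IH] phi tphi; split => //; try exact: L.
move=> i; exists (partial i phi); last by apply: IH; exact: test_function_derive.
move=> psi tpsi.
exact: (partial_by_parts i tpsi (test_Cinfty tphi) measurableT (@subsetT _ _)).
Qed.

Lemma test_cutoff (M : R) : exists2 chi, test_function setT chi &
  forall x : 'rV[R]_n, `|x| <= M -> chi x = 1.
Proof.
have [c [cc c1 c0]] := cutoff_exists M.
pose chi (x : 'rV[R]_n) := \prod_(i < n) c (x ord0 i).
have sub x : chi x != 0 -> `|x| <= `|M + 1|.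
  move=> /prodf_neq0 H; apply: rV_norm_le => // i.
  apply: (le_trans _ (ler_norm _)); rewrite leNgt; apply/negP => /ltW /c0 h.
  by have := H i erefl; rewrite h eqxx.
exists chi; last first.
  by move=> x xM; apply: big1 => i _; apply: c1; apply: (le_trans (coord_le_norm x i)).
split => //.
- apply: Cinfty_prod => i.
  apply: (@Cinfty_affine_comp _ _ _ (fun x : 'rV[R]_n => x ord0 i) (fun x => x ord0 i) _ _ c) => //.
  + exact: coord_continuous_rV.
  + by move=> s v x; rewrite !mxE.
- apply: bounded_closed_compact; last exact: closed_closure.
  exists `|M + 1|; split; first exact: num_real.
  move=> B MB x Hx; apply: le_trans (ltW MB).
  have : [set y : 'rV[R]_n | `|y| <= `|M + 1|] x; last by [].
  move: x Hx; rewrite closureE; apply: smallest_sub; last by move=> y /= /sub.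
  apply: (@closed_comp _ _ (fun y : 'rV[R]_n => `|y|) [set z | z <= `|M + 1|]); last exact: closed_le.
  by move=> y _; exact: norm_continuous.
Qed.

(** Multiplication by a cutoff. The radius M is left free, so that the ball where the gradient is
    unchanged can contain a whole trajectory and not only the closure of the domain. *)
Lemma smooth_W2infty_extension (Omega : set 'rV[R]_n) f (M : R) : Cinfty f ->
  (forall x, closure Omega x -> `|x| <= M) -> exists2 ft, W2infty_extension Omega f ft &
  forall x, `|x| < M -> grad ft x = grad f x.
Proof.
move=> cf OM; have [chi tchi chi1] := test_cutoff M.
have tf : test_function setT (fun x => f x * chi x) by exact: test_functionM.
exists (fun x => f x * chi x).
  split; first exact: test_function_Wkinfty.
  - exact: (test_Cinfty tf).
  - by case: tf.
  - by move=> x; rewrite inE => /OM xM; rewrite chi1// mulr1.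
move=> x xM; apply/rowP => i; rewrite !mxE; apply: near_eq_derive.
have : \forall y \near x, `|y| < M.
  exact: (norm_continuous (lt_nbhsl xM)).
by apply: filterS => y /ltW yM; rewrite chi1// mulr1.
Qed.

End smooth_extension.

(** * Potentials depending on one coordinate *)

Section tilted_potential.
Context (R : realType) (n : nat).
Variables (i0 : 'I_n) (a alpha D : R).
Hypotheses (a0 : 0 < alpha) (D0 : 0 < D).

Lemma Cinfty_coord (h : R -> R) : Cinfty h -> Cinfty (fun x : 'rV[R]_n => h (x ord0 i0 - a)).
Proof.
move=> ch.
apply: (@Cinfty_affine_comp _ _ _ (fun x : 'rV[R]_n => x ord0 i0 - a) (fun x => x ord0 i0) _ _ h) => //.
  by move=> x; exact: (cvgB (@coord_continuous_rV R n i0 x) (cvg_cst _)).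
by move=> s v x; rewrite !mxE addrA.
Qed.

Lemma partial_coord (h : R -> R) i (x : 'rV[R]_n) (d : R) : is_derive (x ord0 i0 - a) 1 h d ->
  partial i (fun x : 'rV[R]_n => h (x ord0 i0 - a)) x = (i == i0)%:R * d.
Proof.
move=> dh; have LE (s : R) (v y : 'rV[R]_n) :
    (s *: v + y) ord0 i0 - a = s *: (v ord0 i0 : R) + (y ord0 i0 - a) by rewrite !mxE addrA.
have [_ e] := is_derive_dir ((delta_mx ord0 i : 'rV[R]_n) ord0 i0) dh.
apply: (etrans (derive_affine_comp LE h x (delta_mx ord0 i))); apply: (etrans e).
by rewrite mxE eqxx /= eq_sym.
Qed.

Definition tilt (x : 'rV[R]_n) : R := profile alpha D (x ord0 i0 - a).

Lemma Cinfty_tilt : Cinfty tilt.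
Proof. exact: (Cinfty_coord (Cinfty_profile alpha D)). Qed.

Lemma partial_tilt i x : partial i tilt x = (i == i0)%:R * slope alpha D (x ord0 i0 - a).
Proof. exact: (partial_coord i (is_derive_profile alpha D _)). Qed.

Lemma partial2_tilt i x :
  partial i (partial i tilt) x = (i == i0)%:R * (2 * alpha * (D - (x ord0 i0 - a))).
Proof.
have -> : partial i tilt = fun y : 'rV[R]_n => (i == i0)%:R * slope alpha D (y ord0 i0 - a).
  by apply/funext => y; exact: partial_tilt.
have := is_deriveZ (i == i0)%:R (is_derive_slope alpha D (x ord0 i0 - a)).
move=> /(partial_coord i) e; apply: (etrans e).
by case: (i == i0); rewrite ?mul0r// scale1r.
Qed.

Lemma grad_tilt x : grad tilt x = slope alpha D (x ord0 i0 - a) *: delta_mx ord0 i0.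
Proof. by apply/rowP => i; rewrite !mxE partial_tilt eqxx /= mulrC. Qed.

Lemma sqr_grad_tilt x : sqr_grad tilt x = slope alpha D (x ord0 i0 - a) ^+ 2.
Proof.
rewrite /sqr_grad (bigD1 i0)//= partial_tilt eqxx mul1r big1 ?addr0// => i /negbTE ii0.
by rewrite partial_tilt ii0 mul0r expr0n.
Qed.

Lemma enorm_grad_tilt x : enorm (grad tilt x) = `|slope alpha D (x ord0 i0 - a)|.
Proof.
rewrite -sqrtr_sqr -sqr_grad_tilt; congr Num.sqrt.
by apply: eq_bigr => i _; rewrite mxE.
Qed.

Lemma is_derive_scaler (g : R -> R) (t d : R) (e x : 'rV[R]_n) : is_derive t 1 g d ->
  is_derive t 1 (fun s => x + g s *: e) (d *: e).
Proof.
move=> dg; have E i j : is_derive t 1 (fun s => (x + g s *: e) i j) ((d *: e) i j).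
  have -> : (fun s => (x + g s *: e) i j) = fun s => x i j + e i j *: g s.
    by apply/funext => s; rewrite !mxE mulrC.
  have := is_deriveD (is_derive_cst (x i j) t (1 : R)) (is_deriveZ (e i j) dg).
  by move=> h; apply: (is_derive_eq h); rewrite add0r mxE mulrC.
have dv : derivable (fun s => x + g s *: e) t 1.
  by apply/derivable_mxP => i j; have [] := E i j.
apply: DeriveDef => //; rewrite derive_mx//; apply/matrixP => i j; rewrite mxE.
by have [_ ->] := E i j.
Qed.

Lemma tilt_flushing (Omega omega : set 'rV[R]_n) (K T : R) :
  (forall x, closure Omega x -> 0 <= x ord0 i0 - a <= D) ->
  (forall x, closure Omega x -> `|x| <= K) -> D < T ->
  flushing_in Omega tilt omega T.
Proof.
move=> OD OK DT; pose b := Num.sqrt ((1 + alpha * D ^+ 2) / alpha).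
have m0 : 0 < 1 + alpha * D ^+ 2 by rewrite addr_gt0// mulr_gt0// exprn_gt0.
have b0 : 0 < b by rewrite sqrtr_gt0 divr_gt0.
have bE : alpha * b ^+ 2 = 1 + alpha * D ^+ 2.
  by rewrite sqr_sqrtr ?divr_ge0 ?(ltW m0) ?(ltW a0)// mulrC divfK// gt_eqF.
(* The moving coordinate a + s t is at most [|a|] + D + b in absolute value, and the others keep
   their initial values, bounded by K; so the whole trajectory lies strictly inside the ball of
   radius M. *)
pose M := `|K| + `|a| + D + b + 1.
have KM : `|K| < M.
  by rewrite /M -!addrA ltrDl ltr_wpDl// ltr_pwDl// addr_ge0// ltW.
have OM x : closure Omega x -> `|x| <= M.
  by move=> /OK h; apply: (le_trans h); apply: (le_trans (ler_norm K)); exact: ltW.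
have [ft Hft gft] := smooth_W2infty_extension Cinfty_tilt OM.
exists ft => // x Ox; have xD := OD x Ox.
have [s [s0 sb ds sneg]] := slope_flow a0 D0 b0 bE xD.
pose gamma (t : R) : 'rV[R]_n := x + (s t - s 0) *: delta_mx ord0 i0.
have g0 t : gamma t ord0 i0 = a + s t.
  by rewrite !mxE !eqxx mulr1 s0; ring.
have gM t : `|gamma t| < M.
  apply: rV_norm_lt; first exact: le_lt_trans KM.
  move=> j; have [->|ji] := eqVneq j i0.
    rewrite g0; have := sb t; rewrite ltr_norml => /andP[h1 h2].
    have h3 : `|a + s t| <= `|a| + (D + b).
      apply: (le_trans (ler_normD _ _)); rewrite lerD2l ler_norml.
      by apply/andP; split; lra.
    apply: (le_lt_trans h3); rewrite /M; have := normr_ge0 K.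
    by move: `|K| `|a| => u v; lra.
  rewrite !mxE (negbTE ji) andbF mulr0 addr0.
  by apply: le_lt_trans KM; apply: (le_trans (coord_le_norm x j)); apply: (le_trans (OK x Ox)); exact: ler_norm.
exists gamma.
  split; first by rewrite /gamma subrr scale0r addr0.
  move=> t; rewrite gft// grad_tilt g0 [a + _]addrC addrK -scaleNr.
  apply: is_derive_scaler.
  have := is_deriveB (ds t) (is_derive_cst (s 0) t (1 : R)).
  by move=> h; apply: (is_derive_eq h); rewrite subr0.
(* Any time strictly between D and T will do: s is negative after D, below the smallest value on the
   closure, so the trajectory has left it. *)
exists ((D + T) / 2).
  by apply/andP; split; lra.
left => /OD; rewrite g0 [a + _]addrC addrK => /andP[+ _]; apply/negP; rewrite -ltNge.
by apply: sneg; lra.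
Qed.

End tilted_potential.

(** * The counterexample *)

Section gradient_norm.
Context (R : realType) (n : nat).
Local Notation mu := (@lebesgue_rV R n).
Implicit Types (Omega W : set 'rV[R]_n) (f : 'rV[R]_n -> R) (c : R).

(** If the essential supremum were below c, the open set W would lie in a null set, but nonempty
    open sets have positive measure. *)
Lemma grad_sup_norm_ge Omega W f c : open W -> W !=set0 -> W `<=` Omega ->
  (forall x, W x -> c <= enorm (grad f x)) -> (c%:E <= grad_sup_norm Omega f)%E.
Proof.
move=> oW W0 WO H; have muT : (0 < mu [set: 'rV[R]_n])%E.
  by apply: open_lebesgue_rV_gt0; [exact: openT|exists 0].
rewrite /grad_sup_norm Lnorm.unlock muT leNgt; apply/negP => lt.
have [N [mN N0 HN]] := ess_sup_ge mu (abse \o (EFin \o ((fun x => enorm (grad f x)) \_ Omega))).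
have : (mu W <= mu N)%E.
  apply: le_measure; rewrite ?inE//; first exact: open_measurable_rV.
  move=> x Wx; apply: HN => /=; apply/negP; rewrite -ltNge; apply: (lt_le_trans lt).
  by rewrite patchE mem_set ?lee_fin; [exact: le_trans (H x Wx) (ler_norm _)|exact: WO].
by rewrite N0 leNgt open_lebesgue_rV_gt0.
Qed.

Lemma grad_sup_norm_le Omega f c : 0 <= c -> (forall x, Omega x -> enorm (grad f x) <= c) ->
  (grad_sup_norm Omega f <= c%:E)%E.
Proof.
move=> c0 H; have muT : (0 < mu [set: 'rV[R]_n])%E.
  by apply: open_lebesgue_rV_gt0; [exact: openT|exists 0].
rewrite /grad_sup_norm Lnorm.unlock muT; apply/ess_supP; apply: aeW => x /=.
rewrite patchE; case: ifPn => [/set_mem Ox|_]; last by rewrite normr0 lee_fin.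
by rewrite ger0_norm ?lee_fin ?H// sqrtr_ge0.
Qed.

End gradient_norm.

Section bounded_domain.
Context (R : realType) (n : nat) (Omega : set 'rV[R]_n) (i0 : 'I_n).
Hypotheses (oO : open Omega) (O0 : Omega !=set0) (bO : bounded_set Omega).

Let a := inf [set x ord0 i0 | x in Omega].

Lemma bounded_domain : exists2 K : R, 0 < K & forall x, closure Omega x -> `|x| < K.
Proof.
have [M [_ HM]] := bO; exists (`|M| + 2); first by rewrite ltr_wpDl.
have HM1 x : Omega x -> `|x| <= `|M| + 1.
  by apply: HM; apply: (le_lt_trans (ler_norm M)); rewrite ltrDl.
move=> x Ox; suff : [set y : 'rV[R]_n | `|y| <= `|M| + 1] x.
  by move=> h; apply: (le_lt_trans h); rewrite ltrD2l ltr1n.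
move: x Ox; rewrite closureE; apply: smallest_sub; last by move=> y /HM1.
apply: (@closed_comp _ _ (fun y : 'rV[R]_n => `|y|) [set z | z <= `|M| + 1]); last exact: closed_le.
by move=> y _; exact: norm_continuous.
Qed.

Lemma coord_le_diam x y : Omega x -> Omega y -> x ord0 i0 - y ord0 i0 <= diam Omega.
Proof.
move=> Ox Oy; have [K K0 HK] := bounded_domain.
apply: (@le_trans _ _ (enorm (x - y))).
  apply: (le_trans (ler_norm _)); rewrite -sqrtr_sqr ler_sqrt.
    rewrite (bigD1 i0)//= !mxE lerDl; apply: sumr_ge0 => i _; exact: sqr_ge0.
  by apply: sumr_ge0 => i _; exact: sqr_ge0.
apply: ub_le_sup; last by exists x, y.
exists (Num.sqrt (\sum_(i < n) (2 * K) ^+ 2)) => _ [u [v [Ou Ov ->]]].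
rewrite ler_sqrt; last by apply: sumr_ge0 => i _; exact: sqr_ge0.
apply: ler_sum => i _; rewrite -[leLHS]ger0_norm ?sqr_ge0// normrX.
rewrite lerXn2r ?nnegrE ?mulr_ge0 ?(ltW K0)//.
apply: (le_trans (coord_le_norm _ i)); apply: (le_trans (ler_normB _ _)).
have := HK u (subset_closure Ou); have := HK v (subset_closure Ov).
by move: `|u| `|v| => s t; lra.
Qed.

Lemma coord_inf_lbound x : Omega x -> a <= x ord0 i0.
Proof.
move=> Ox; apply: ge_inf; last by exists x.
have [K K0 HK] := bounded_domain; exists (- K) => _ [y Oy <-].
have := le_lt_trans (coord_le_norm y i0) (HK y (subset_closure Oy)).
by rewrite ltr_norml => /andP[/ltW].
Qed.

Lemma coord_inf_adherent (e : R) : 0 < e -> exists2 x, Omega x & x ord0 i0 < a + e.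
Proof.
move=> e0; have [_ [x Ox <-] h] : exists2 y, [set x ord0 i0 | x in Omega] y & y < a + e.
  apply: inf_adherent => //; split; first by have [x Ox] := O0; exists (x ord0 i0), x.
  by exists a => _ [y Oy <-]; exact: coord_inf_lbound.
by exists x.
Qed.

Lemma closure_coord_bounds x : closure Omega x -> 0 <= x ord0 i0 - a <= diam Omega.
Proof.
pose S : set 'rV[R]_n := (fun y => y ord0 i0 - a) @^-1` [set z | 0 <= z <= diam Omega].
suff : closure Omega `<=` S by exact.
rewrite closureE; apply: smallest_sub.
  apply: closed_comp; last first.
    have -> : [set z : R | 0 <= z <= diam Omega] = `[0, diam Omega]%classic.
      by apply/seteqP; split => z /=; rewrite in_itv.
    exact: interval_closed.
  by move=> y _; exact: (cvgB (@coord_continuous_rV R n i0 y) (cvg_cst _)).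
move=> y Oy; rewrite /S /= subr_ge0 coord_inf_lbound//= lerBlDl -lerBlDr.
apply: lb_le_inf; first by have [z Oz] := O0; exists (z ord0 i0), z.
by move=> _ [z Oz <-]; rewrite lerBlDl -lerBlDr coord_le_diam.
Qed.

Lemma coord_inf_lt p : Omega p -> a < p ord0 i0.
Proof.
move=> Op; have /nbhs_ballP[e /= e0 peO] := open_nbhs_nbhs (conj oO Op).
have Oq : Omega (p - (e / 2) *: delta_mx ord0 i0).
  apply: peO; rewrite -ball_normE /= opprB addrC subrK.
  apply: rV_norm_lt => // i; rewrite !mxE normrM.
  rewrite [X in X * _]gtr0_norm ?divr_gt0//; case: (_ && _); last by rewrite normr0 mulr0.
  by rewrite normr1 mulr1 ltr_pdivrMr// ltr_pMr// ltr1n.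
have := coord_inf_lbound Oq; rewrite !mxE !eqxx mulr1.
by have : 0 < e / 2 by [rewrite divr_gt0]; lra.
Qed.

End bounded_domain.

(** * Choice of the steepness *)

Section slope_choice.
Context (R : realType).
Variables (lambda D : R).
Hypotheses (l0 : 0 < lambda) (D0 : 0 < D).

Lemma slope_choice : exists2 alpha : R, 0 < alpha & (1 + alpha * D ^+ 2) ^+ 2 = 1 + lambda ^+ 2 * D ^+ 2.
Proof.
have D20 : 0 < D ^+ 2 by rewrite exprn_gt0.
have m1 : 1 < 1 + lambda ^+ 2 * D ^+ 2 by rewrite ltrDl mulr_gt0// exprn_gt0.
exists ((Num.sqrt (1 + lambda ^+ 2 * D ^+ 2) - 1) / D ^+ 2).
  by rewrite divr_gt0// subr_gt0 -[ltLHS]sqrtr1 ltr_sqrt// (lt_trans ltr01).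
by rewrite divfK ?gt_eqF// addrC subrK sqr_sqrtr// ltW// (lt_trans ltr01).
Qed.

Variables (alpha : R).
Hypotheses (a0 : 0 < alpha) (aE : (1 + alpha * D ^+ 2) ^+ 2 = 1 + lambda ^+ 2 * D ^+ 2).

Let lam : lambda * D <= 1 + alpha * D ^+ 2.
Proof.
rewrite -(ler_pXn2r (n := 2))// ?nnegrE ?mulr_ge0 ?(ltW l0) ?(ltW D0)//.
  by rewrite aE exprMn lerDr.
by rewrite addr_ge0// mulr_ge0 ?sqr_ge0// ltW.
Qed.

(** By concavity [slope] lies above the chord from the origin to its value at D, and that value is
    at least lambda D. The identity below writes the excess over the chord as a nonnegative term. *)
Lemma slope_ge s : 0 <= s <= D -> lambda * s <= slope alpha D s.
Proof.
move=> /andP[s0 sD]; rewrite -(ler_pM2r D0).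
have h1 : lambda * s * D <= s * (1 + alpha * D ^+ 2).
  by rewrite mulrAC [lambda * D * s]mulrC ler_wpM2l.
apply: (le_trans h1).
have -> : slope alpha D s * D = s * (1 + alpha * D ^+ 2) + (D - s) * (1 + alpha * s * D).
  by rewrite /slope; ring.
by rewrite lerDl mulr_ge0 ?subr_ge0// addr_ge0// !mulr_ge0// ltW.
Qed.

(** The chord bound on the slope, integrated from 0 to s; the remainder is again displayed as a sum
    of terms that are nonnegative on [0, D]. *)
Lemma profile_ge s : 0 <= s <= D -> lambda * s ^+ 2 / 2 <= profile alpha D s.
Proof.
move=> /andP[s0 sD]; rewrite -(ler_pM2r D0).
have h1 : lambda * s ^+ 2 / 2 * D <= s ^+ 2 / 2 * (1 + alpha * D ^+ 2).
  have -> : lambda * s ^+ 2 / 2 * D = s ^+ 2 / 2 * (lambda * D) by ring.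
  by rewrite ler_wpM2l// divr_ge0 ?sqr_ge0.
apply: (le_trans h1).
have -> : profile alpha D s * D = s ^+ 2 / 2 * (1 + alpha * D ^+ 2) +
   (s * (D - s) + s ^+ 2 / 2 + alpha * D * s ^+ 2 * (D - s) / 3 + alpha * D ^+ 2 * s ^+ 2 / 6).
  by rewrite /profile; field.
rewrite lerDl; have Ds : 0 <= D - s by rewrite subr_ge0.
by rewrite !addr_ge0// ?divr_ge0// ?mulr_ge0 ?sqr_ge0// ?(ltW a0) ?(ltW D0)// mulr_ge0// ltW.
Qed.

Lemma profile_le s : 0 <= s <= D -> profile alpha D s <= s * (1 + alpha * D ^+ 2).
Proof.
move=> /andP[s0 sD].
have -> : s * (1 + alpha * D ^+ 2) = profile alpha D s + alpha * s * (D * (D - s) + s ^+ 2 / 3).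
  by rewrite /profile; field.
by rewrite lerDl mulr_ge0 ?mulr_ge0 ?addr_ge0 ?mulr_ge0 ?subr_ge0 ?divr_ge0 ?sqr_ge0// ltW.
Qed.

End slope_choice.

Section tilted_observability.
Context (R : realType) (n : nat).
Variables (Omega omega : set 'rV[R]_n) (q : 'rV[R]_n -> R) (i0 : 'I_n) (a alpha D K rho : R).
Hypotheses (oO : open Omega) (K0 : 0 < K) (OK : forall x, Omega x -> `|x| < K)
  (oo : open omega) (omO : omega `<=` Omega) (qO : Linfty (closure Omega) q)
  (a0 : 0 < alpha) (D0 : 0 < D)
  (OD : forall x, Omega x -> 0 <= x ord0 i0 - a <= D)
  (Oa : forall e : R, 0 < e -> exists2 x, Omega x & x ord0 i0 < a + e)
  (rho0 : 0 < rho) (rhoD : rho <= D) (omr : forall x, omega x -> rho <= x ord0 i0 - a).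

(** The general bound is applied with fr = F(rho) and a level fs = F(sigma) at most half of it, so
    that a fixed proportion of F(rho) remains. *)
Lemma tilt_observability_time (T : R) : 0 < T ->
  uniformly_observable Omega (tilt i0 a alpha D) q omega T -> profile alpha D rho / 2 <= T.
Proof.
move=> T0 obs; have [d0 r0 rD] := And3 D0 rho0 rhoD; pose m := 1 + alpha * D ^+ 2.
have m0 : 0 < m by rewrite addr_gt0// mulr_gt0// exprn_gt0.
have Pr0 : 0 < profile alpha D rho.
  have -> : profile alpha D rho = rho + alpha * (rho * rho) * (D - rho / 3) by rewrite /profile; field.
  have h : 0 <= D - rho / 3 by lra.
  by apply: ltr_wpDr => //; rewrite !mulr_ge0// ltW.
(* F lies below the line of slope m, the maximal slope, so F(sigma) <= sigma m = F(rho) / 2. *)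
pose sigma := profile alpha D rho / (2 * m).
have s0 : 0 < sigma by rewrite divr_gt0// mulr_gt0.
have sD : sigma <= D.
  rewrite ler_pdivrMr ?mulr_gt0//.
  have /le_trans : profile alpha D rho <= rho * m by apply: profile_le => //; rewrite ltW.
  by apply; rewrite mulrCA mulrA; apply: ler_wpM2r; [exact: ltW|lra].
have Ps : profile alpha D sigma <= profile alpha D rho / 2.
  have /le_trans : profile alpha D sigma <= sigma * m by apply: profile_le => //; rewrite ltW.
  apply; rewrite /sigma -mulrA; apply: ler_wpM2l; first exact: ltW.
  by rewrite invfM -mulrA mulVf ?mulr1// gt_eqF.
have sl1 : 1 < slope alpha D sigma.
  have h : 0 < 2 * D - sigma by rewrite subr_gt0 (le_lt_trans sD)// ltr_pMl// ltr1n.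
  by rewrite /slope ltrDl mulr_gt0// mulr_gt0.
have sl2 : 1 < slope alpha D sigma ^+ 2 by rewrite exprn_egt1.
(* The second entry is the excess of the squared gradient over 1 wherever s >= sigma, by
   monotonicity of the slope; the first keeps the loss factor (1 + k / 4) / 2 at most 5 / 8. *)
pose k := Num.min 1 (slope alpha D sigma ^+ 2 - 1).
have k0 : 0 < k by rewrite lt_min ltr01 subr_gt0.
have k1 : k <= 1 by rewrite ge_min lexx.
(* For s < eta the slope is at most 1 + 2 alpha D eta = 1 + k / 12, and its square at most 1 + k / 4
   because k <= 1. The strip is nonempty since a is the infimum of the coordinate. *)
pose eta := k / (24 * (alpha * D)).
have aD0 : 0 < alpha * D by rewrite mulr_gt0.
have eta0 : 0 < eta by rewrite divr_gt0// mulr_gt0.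
pose U := Omega `&` [set x | x ord0 i0 < a + eta].
have oU : open U.
  apply: openI => //; apply: (@open_comp _ _ (fun x : 'rV[R]_n => x ord0 i0) [set z | z < a + eta]); last exact: open_lt.
  by move=> x _; exact: coord_continuous_rV.
have U0 : U !=set0 by have [x Ox xe] := Oa eta0; exists x.
have mo : measurable omega by exact: open_measurable_rV.
have mA : measurable (closure Omega) by apply: closed_measurable_rV; exact: closed_closure.
have OK' x : Omega x -> forall i, - K <= x ord0 i < K.
  move=> Ox i; have := le_lt_trans (coord_le_norm x i) (OK Ox).
  by rewrite ltr_norml => /andP[/ltW -> ->].
have f0 x : Omega x -> 0 <= tilt i0 a alpha D x <= profile alpha D D.
  move=> /OD/andP[h1 h2]; apply/andP; split; last exact: profile_homo.
  have -> : 0 = profile alpha D 0 by rewrite /profile !mul0r !mulr0 subr0 addr0.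
  exact: profile_homo.
have ff i x : Omega x -> 0 <= partial i (partial i (tilt i0 a alpha D)) x.
  move=> /OD/andP[h1 h2]; rewrite partial2_tilt mulr_ge0// mulr_ge0 ?subr_ge0//.
  by rewrite mulr_ge0// ltW.
have sl x : Omega x -> 1 <= slope alpha D (x ord0 i0 - a).
  move=> /OD/andP[h1 h2]; apply: slope_ge1 => //; rewrite h1 (le_trans h2)//.
  by rewrite ler_peMl ?ler1n// ltW.
have g1 x : Omega x -> 1 <= sqr_grad (tilt i0 a alpha D) x.
  by move=> /sl h; rewrite sqr_grad_tilt exprn_ege1.
have gU x : U x -> sqr_grad (tilt i0 a alpha D) x <= 1 + k / 4.
  move=> [Ox /= xe]; rewrite sqr_grad_tilt; have /andP[h1 h2] := OD Ox.
  set s := x ord0 i0 - a in h1 h2 *; have se : s < eta by rewrite /s; lra.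
  have h3 : slope alpha D s <= 1 + k / 12.
    rewrite /slope lerD2l; apply: (@le_trans _ _ (2 * (alpha * D) * eta)).
      apply: (@le_trans _ _ (alpha * s * (2 * D))).
        by rewrite ler_wpM2l ?mulr_ge0 ?(ltW a0)//; lra.
      have -> : alpha * s * (2 * D) = 2 * (alpha * D) * s by ring.
      by rewrite ler_wpM2l ?mulr_ge0 ?(ltW aD0)// ltW.
    by rewrite /eta le_eqVlt; apply/orP; left; apply/eqP; field; rewrite !gt_eqF.
  apply: (@le_trans _ _ ((1 + k / 12) ^+ 2)).
    by rewrite lerXn2r ?nnegrE ?(le_trans ler01 (sl _ Ox))// addr_ge0// divr_ge0// ltW.
  have -> : (1 + k / 12) ^+ 2 = 1 + k / 12 * (2 + k / 12) by ring.
  have : k / 12 * (2 + k / 12) <= k / 12 * 3.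
    by rewrite ler_wpM2l//; [rewrite divr_ge0// ltW|lra].
  by lra.
have gs x : Omega x -> profile alpha D sigma < tilt i0 a alpha D x ->
    1 + k <= sqr_grad (tilt i0 a alpha D) x.
  move=> Ox; have /andP[h1 h2] := OD Ox; rewrite sqr_grad_tilt /tilt.
  set s := x ord0 i0 - a in h1 h2 *; move=> h.
  have ss : sigma <= s.
    rewrite leNgt; apply/negP => /ltW ss.
    by move: h; rewrite ltNge => /negP; apply; apply: profile_homo.
  apply: (@le_trans _ _ (slope alpha D sigma ^+ 2)).
    by rewrite addrC -lerBrDr ge_min lexx orbT.
  rewrite lerXn2r ?nnegrE ?(le_trans ler01 (sl _ Ox)) ?(ltW (lt_trans ltr01 sl1))//.
  by apply: slope_homo => //; exact: ltW.
have gr x : omega x -> profile alpha D rho <= tilt i0 a alpha D x.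
  by move=> ox; have /andP[h1 h2] := OD (omO ox); apply: profile_homo => //; [exact: ltW|exact: omr].
have := observability_time_ge oO K0 OK' oU U0 (@subIsetl _ _ _) mo omO mA (@subset_closure _ Omega) qO
  (Cinfty_tilt i0 a alpha D) f0 ff g1 k0 gU gs gr T0 obs.
(* Thus F(rho) / 2 <= F(rho) - F(sigma) <= 5 T / 8, which is more than enough. *)
move=> h; have h' : T * ((1 + k / 4) / 2) <= T * (5 / 8) by rewrite ler_wpM2l ?(ltW T0)//; lra.
by move: h h' Ps Pr0; move: (profile alpha D rho) (profile alpha D sigma) (T * _) => u v w; lra.
Qed.

End tilted_observability.

Theorem theorem1p6 (R : realType) (n : nat) (Omega : set 'rV[R]_n)
    (q : 'rV[R]_n -> R) :
  (0 < n)%N -> Omega !=set0 -> open Omega -> bounded_set Omega ->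
  connected Omega -> smooth_boundary Omega -> Linfty (closure Omega) q ->
  exists (omega : set 'rV[R]_n) (c delta : R),
    [/\ open omega /\ omega !=set0, omega `<=` Omega, 0 < c, 0 < delta &
      (forall lambda : R, 0 < lambda ->
        exists f : 'rV[R]_n -> R,
          [/\ Cinfty_closure Omega f,
              flushing Omega f omega /\ (T_FC Omega f omega <= (diam Omega)%:E)%E,
              ((c * lambda)%:E <= T_unif Omega f q omega)%E &
              ((lambda ^+ 2 * delta)%:E <= grad_sup_norm Omega f ^+ 2)%E /\
              (grad_sup_norm Omega f ^+ 2
                 <= (lambda ^+ 2 * diam Omega ^+ 2 + n%:R)%:E)%E]) /\
      (forall Lambda : R, 0 < Lambda ->
        exists f : 'rV[R]_n -> R,
          [/\ Cinfty_closure Omega f, flushing Omega f omega &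
              (Lambda%:E * T_FC Omega f omega <= T_unif Omega f q omega)%E])].
Proof.
move=> n0 O0 oO bO _ _ qO; pose i0 := Ordinal n0.
have [p Op] := O0; have [K K0 OK] := bounded_domain bO.
pose a := inf [set x ord0 i0 | x in Omega].
(* Half the height of an interior point p above the infimum a: then p belongs to omega, and a layer
   of positive thickness below omega is left for the ground state. *)
pose rho := (p ord0 i0 - a) / 2.
have pa : a < p ord0 i0 := coord_inf_lt i0 oO bO Op.
have rho0 : 0 < rho by rewrite divr_gt0// subr_gt0.
have OD x : closure Omega x -> 0 <= x ord0 i0 - a <= diam Omega.
  exact: closure_coord_bounds O0 bO x.
have OD' x (Ox : Omega x) := OD x (subset_closure Ox).
have rhoD2 : 2 * rho <= diam Omega.
  by rewrite mulrC divfK//; have /andP[] := OD' p Op.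
have D0 : 0 < diam Omega by apply: lt_le_trans rhoD2; rewrite mulr_gt0.
have rhoD : rho <= diam Omega by apply: le_trans rhoD2; rewrite ler_peMl ?ler1n// ltW.
pose omega := Omega `&` [set x | a + rho < x ord0 i0].
have oo : open omega.
  apply: openI => //.
  apply: (@open_comp _ _ (fun x : 'rV[R]_n => x ord0 i0) [set z | a + rho < z]); last exact: open_gt.
  by move=> x _; exact: coord_continuous_rV.
have omO : omega `<=` Omega by exact: subIsetl.
have omega0 : omega !=set0.
  exists p; split => //=; rewrite -ltrBrDl /rho ltr_pdivrMr// ltr_pMr ?ltr1n//.
  by rewrite subr_gt0.
have omr x : omega x -> rho <= x ord0 i0 - a by move=> [_ /= /ltW]; rewrite lerBrDl.
have main (lambda : R) : 0 < lambda -> exists f : 'rV[R]_n -> R,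
    [/\ Cinfty_closure Omega f,
        flushing Omega f omega /\ (T_FC Omega f omega <= (diam Omega)%:E)%E,
        ((rho ^+ 2 / 4 * lambda)%:E <= T_unif Omega f q omega)%E &
        ((lambda ^+ 2 * rho ^+ 2)%:E <= grad_sup_norm Omega f ^+ 2)%E /\
        (grad_sup_norm Omega f ^+ 2 <= (lambda ^+ 2 * diam Omega ^+ 2 + n%:R)%:E)%E].
  move=> l0; have [alpha a0 aE] := slope_choice l0 D0.
  pose f := tilt i0 a alpha (diam Omega); exists f.
  have OK' x : closure Omega x -> `|x| <= K by move=> /OK/ltW.
  have flush T : diam Omega < T -> flushing_in Omega f omega T.
    exact: (tilt_flushing a0 D0 omega OD OK').
  have slope1 s : 0 <= s <= diam Omega -> 1 <= slope alpha (diam Omega) s.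
    move=> /andP[s0 sD]; apply: slope_ge1 => //; rewrite s0 (le_trans sD)//.
    by rewrite ler_peMl ?ler1n// ltW.
  split.
  - by exists f => //; exact: Cinfty_tilt.
  - split.
      exists (diam Omega + 1); first by rewrite addr_gt0.
      by apply: flush; rewrite ltrDl.
    (* Exit is only shown at times strictly after the diameter, so the infimum is reached through
       [diam Omega + e]. *)
    apply/lee_addgt0Pr => e e0; apply: ereal_inf_lbound; exists (diam Omega + e) => //.
    by split; [rewrite addr_gt0|apply: flush; rewrite ltrDl].
  - apply: le_ereal_inf_tmp => _ [T [T0 obs] <-]; rewrite lee_fin.
    have := tilt_observability_time oO K0 (fun x Ox => OK x (subset_closure Ox)) oo omO qO a0 D0 OD'
      (coord_inf_adherent i0 O0 bO) rho0 rhoD omr T0 obs.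
    apply: le_trans; apply: (@le_trans _ _ (lambda * rho ^+ 2 / 2 / 2)).
      by rewrite le_eqVlt; apply/orP; left; apply/eqP; field.
    rewrite ler_pM2r ?invr_gt0//; apply: profile_ge => //.
    by rewrite (ltW rho0).
  - have lower : ((lambda * rho)%:E <= grad_sup_norm Omega f)%E.
      apply: (grad_sup_norm_ge oo omega0 omO) => x ox.
      have /andP[s0 sD] := OD' x (omO x ox).
      rewrite enorm_grad_tilt; apply: le_trans (ler_norm _).
      apply: le_trans (slope_ge l0 D0 a0 aE _); last by rewrite s0.
      by rewrite ler_pM2l// omr.
    have upper : (grad_sup_norm Omega f <= (1 + alpha * diam Omega ^+ 2)%:E)%E.
      apply: grad_sup_norm_le; first by rewrite addr_ge0// mulr_ge0 ?sqr_ge0// ltW.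
      move=> x Ox; rewrite enorm_grad_tilt ger0_norm; first exact: slope_le_max.
      by apply: (le_trans ler01); apply: slope1; exact: OD'.
    have lr0 : 0 <= lambda * rho by rewrite mulr_ge0// ltW.
    have N0 : (0 <= grad_sup_norm Omega f)%E by apply: le_trans lower; rewrite lee_fin.
    split.
      by rewrite -exprMn expr2 EFinM; apply: lee_pmul.
    (* By the choice of alpha the squared maximal slope is exactly 1 + lambda^2 D^2, and 1 <= n. *)
    apply: (@le_trans _ _ ((1 + alpha * diam Omega ^+ 2) ^+ 2)%:E).
      by rewrite expr2 EFinM; apply: lee_pmul.
    by rewrite aE lee_fin addrC lerD2l ler1n.
have c0 : 0 < rho ^+ 2 / 4 by rewrite divr_gt0// exprn_gt0.
(* The first constant is half of F(rho) >= lambda rho^2 / 2; the second comes from the slope being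
   at least lambda rho on omega. *)
exists omega, (rho ^+ 2 / 4), (rho ^+ 2); split => //.
  by rewrite exprn_gt0.
split => // Lambda L0.
(* Solves c lambda = Lambda D, so that the lower bound on [T_unif] dominates Lambda times the bound
   D on [T_FC]. *)
pose lambda := Lambda * diam Omega / (rho ^+ 2 / 4).
have l0 : 0 < lambda := divr_gt0 (mulr_gt0 L0 D0) c0.
have [f [cf [flush TFC] Tunif _]] := main lambda l0.
exists f; split => //; apply: le_trans Tunif.
apply: (@le_trans _ _ (Lambda%:E * (diam Omega)%:E)%E).
  by apply: lee_wpmul2l => //; rewrite lee_fin ltW.
by rewrite -EFinM lee_fin [leRHS]mulrC divfK// gt_eqF.
Qed.
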